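(* Let $X$ be a smooth projective geometrically irreducible curve over $\mathbb{F}_q$, let $X'=X\otimes_{\mathbb{F}_q}\mathbb{F}_{q^2}$ and $p:X'\to X$ the projection. The map $$\mathrm{Cl}\,X'/\mathrm{Cl}\,X\longrightarrow\mathbb{P}\mathrm{Bun}_2^{\rm tr}X\cup\{c_0\},\qquad[D]\longmapsto t_D$$ is surjective with fibres of the form $\{[D],[-D]\}$.
   Context: $\mathrm{Cl}$ denotes the divisor class group, identified with the Picard group via $D\mapsto\mathcal{L}_D$; $\mathrm{Cl}\,X$ is viewed as a subgroup of $\mathrm{Cl}\,X'$ via the (injective) pullback $p^*$. $\mathbb{P}\mathrm{Bun}_2X$ is the set of isomorphism classes of rank $2$ vector bundles on $X$ modulo tensoring with line bundles. $\mathbb{P}\mathrm{Bun}_2^{\rm tr}X$ is the set of classes of rank $2$ bundles that are indecomposable on $X$ but become decomposable after pullback to $X\otimes\overline{\mathbb{F}}_q$. $c_0=[\mathcal{O}_X\oplus\mathcal{O}_X]$, and $t_D=[p_*\mathcal{L}_D]$ for $[D]\in\mathrm{Cl}\,X'$; this depends only on the class of $[D]$ modulo $\mathrm{Cl}\,X$. *)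

(* Defs.v *)
(* A smooth projective curve over a perfect field k is encoded by its function
   field F, as the abstract nonsingular curve of F / k: the closed points are
   the normalised discrete valuations of F that are trivial on k, the nonempty
   open sets are the cofinite sets of closed points (the generic point, which
   lies in all of them, is left implicit), and O_X(U) consists of the f in F
   that are regular at every point of U.  A sheaf is given by its sections over
   the nonempty open sets, its sections over the empty set being 0. *)
From HB Require Import structures.
From mathcomp Require Import all_boot all_order all_algebra.
From mathcomp Require Import ring_quotient.
From mathcomp Require Import mathcomp_extra boolp classical_sets functions.
From mathcomp Require Import cardinality.

Set Implicit Arguments.
Unset Strict Implicit.
Unset Printing Implicit Defensive.

Import Order.TTheory GRing.Theory Num.Theory.

Local Open Scope classical_set_scope.
Local Open Scope ring_scope.

(* The last condition says that F is a finitely generated extension of k of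
   transcendence degree 1: F is a finite extension of some k(t), with t
   transcendental over k. *)
Record curve (k : fieldType) := Curve {
  funField : fieldType;
  const : {rmorphism k -> funField};
  _ : exists2 t : funField, ~ algebraicOver const t &
      exists (n : nat) (b : 'I_n -> funField), forall z : funField,
      exists (c : 'I_n -> {poly k}) (d : {poly k}),
        (map_poly const d).[t] != 0 /\
        z = \sum_(i < n) (map_poly const (c i)).[t] / (map_poly const d).[t] * b i
}.

(* T is the tensor product of A and K over k: every basis of K over k becomes
   a basis of T over A. *)
Definition is_tensor_algebra (k A K : fieldType) (T : comNzRingType)
    (iA : {rmorphism k -> A}) (iK : {rmorphism k -> K})
    (jA : {rmorphism A -> T}) (jK : {rmorphism K -> T}) : Prop :=
  [/\ forall c, jA (iA c) = jK (iK c),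
      forall z : T, exists (n : nat) (a : 'I_n -> A) (c : 'I_n -> K),
        z = \sum_(i < n) jA (a i) * jK (c i)
    & forall (n : nat) (c : 'I_n -> K),
        (forall b : 'I_n -> k,
           \sum_(i < n) iK (b i) * c i = 0 -> forall i, b i = 0) ->
        forall a : 'I_n -> A,
          \sum_(i < n) jA (a i) * jK (c i) = 0 -> forall i, a i = 0].

(* For every field extension K of k, the spectrum of F (x)_k K, which is the
   generic fibre of X (x)_k K -> X, is irreducible: the nilradical is prime. *)
Definition geometrically_irreducible (k : fieldType) (X : curve k) : Prop :=
  forall (K : fieldType) (i : {rmorphism k -> K}) (T : comNzRingType)
    (jF : {rmorphism funField X -> T}) (jK : {rmorphism K -> T}),
  is_tensor_algebra (const X) i jF jK ->
  forall f g : T, (exists n, (f * g) ^+ n = 0) ->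
    (exists n, f ^+ n = 0) \/ (exists n, g ^+ n = 0).

(* The projection X' = X (x)_k k' -> X. *)
Record base_change (k k' : fieldType) (i : {rmorphism k -> k'})
    (X : curve k) (X' : curve k') := BaseChange {
  bc_map :> {rmorphism funField X -> funField X'};
  _ : is_tensor_algebra (const X) i bc_map (const X')
}.

(* The value of ord at 0, which should be infinite, is set to 0. *)
Record place (k : fieldType) (X : curve k) := Place {
  ord :> funField X -> int;
  ord_zero : ord 0 = 0;
  ord_mul : forall f g, f != 0 -> g != 0 -> ord (f * g) = ord f + ord g;
  ord_add : forall f g, f != 0 -> g != 0 -> f + g != 0 ->
    Num.min (ord f) (ord g) <= ord (f + g);
  ord_const : forall c, ord (const X c) = 0;
  ord_unif : exists f, ord f = 1
}.

Section StructureSheaf.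
Variables (k : fieldType) (X : curve k).
Local Notation F := (funField X).
Implicit Types (x : place X) (U V : set (place X)).

Definition is_open U : Prop := finite_set (~` U).

Definition regular_at x (f : F) : bool := (f == 0) || (0 <= ord x f).

Definition regular_on U : {pred F} :=
  fun f => `[< forall x, U x -> regular_at x f >].

Lemma ord_one x : ord x 1 = 0.
Proof. by rewrite -(rmorph1 (const X)) ord_const. Qed.

Lemma ord_opp1 x : ord x (-1) = 0.
Proof. by rewrite -(rmorph1 (const X)) -rmorphN ord_const. Qed.

Lemma ord_opp x f : ord x (- f) = ord x f.
Proof.
have [->|f0] := eqVneq f 0; first by rewrite oppr0.
by rewrite -mulN1r ord_mul ?oppr_eq0 ?oner_eq0 // ord_opp1 add0r.
Qed.

Lemma ord_sub_ge x f g (m : int) : f - g != 0 ->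
  (f == 0) || (m <= ord x f) -> (g == 0) || (m <= ord x g) ->
  m <= ord x (f - g).
Proof.
have [->|f0] := eqVneq f 0.
  by rewrite sub0r ord_opp oppr_eq0 => /negbTE->.
have [->|g0] := eqVneq g 0; first by rewrite subr0.
move=> fg0 /= mf mg; apply: le_trans (ord_add x f0 _ fg0); last by rewrite oppr_eq0.
by rewrite le_min mf ord_opp.
Qed.

Fact regular_on_subring U : subring_closed (regular_on U).
Proof.
split=> [|f g /asboolP rf /asboolP rg|f g /asboolP rf /asboolP rg].
- by apply/asboolP => x _; rewrite /regular_at ord_one lexx orbT.
- apply/asboolP => x Ux; rewrite /regular_at.
  have [//|fg0] := eqVneq (f - g) 0.
  by rewrite (ord_sub_ge fg0) ?orbT // -/(regular_at x _); [apply: rf|apply: rg].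
- apply/asboolP => x Ux; move: (rf x Ux) (rg x Ux); rewrite /regular_at mulf_eq0.
  have [//|f0] := eqVneq f 0; have [//|g0] := eqVneq g 0.
  by move=> /= rfx rgx; rewrite ord_mul // addr_ge0.
Qed.
HB.instance Definition _ U :=
  GRing.isSubringClosed.Build F (regular_on U) (regular_on_subring U).

Record Oring U := MkO { Oval :> F; OvalP : Oval \in regular_on U }.
HB.instance Definition _ U := [isSub for @Oval U].
HB.instance Definition _ U := [Choice of Oring U by <:].
HB.instance Definition _ U := [SubChoice_isSubComNzRing of Oring U by <:].

Fact Ores_subproof U V (VU : V `<=` U) (f : Oring U) : val f \in regular_on V.
Proof. by apply/asboolP => x /VU Ux; move/asboolP: (OvalP f); apply. Qed.
Definition Ores U V (VU : V `<=` U) (f : Oring U) : Oring V :=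
  MkO (Ores_subproof VU f).

(* The data underlying a sheaf of O_X-modules.  Only the sections over open
   sets are meaningful: all conditions below are restricted to open sets. *)
Record premodule := Premodule {
  sec :> forall U : set (place X), lmodType (Oring U);
  res : forall U V : set (place X), V `<=` U -> sec U -> sec V
}.
Implicit Types E L M N : premodule.

Definition is_presheaf M : Prop :=
  [/\ forall U (UU : U `<=` U), is_open U -> forall s : M U, res UU s = s,
      forall U V W (VU : V `<=` U) (WV : W `<=` V) (WU : W `<=` U),
        is_open U -> is_open V -> is_open W ->
        forall s : M U, res WV (res VU s) = res WU s
    & forall U V (VU : V `<=` U), is_open U -> is_open V ->
        forall (a : Oring U) (s t : M U),
        res VU (a *: s + t) = Ores VU a *: res VU s + res VU t].

Definition is_sheaf M : Prop :=
  is_presheaf M /\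
  forall (I : Type) (i0 : I) (V : I -> set (place X)) (U : set (place X)),
    (forall i, is_open (V i)) -> is_open U ->
    forall VU : forall i, V i `<=` U, U `<=` \bigcup_i V i ->
    forall s : (forall i, M (V i)),
    (forall i j, res (@subIsetl _ (V i) (V j)) (s i) =
                 res (@subIsetr _ (V i) (V j)) (s j)) ->
    exists! t : M U, forall i, res (VU i) t = s i.

Definition is_hom M N (h : forall U, M U -> N U) : Prop :=
  (forall U, is_open U -> forall (a : Oring U) (s t : M U),
     h U (a *: s + t) = a *: h U s + h U t) /\
  (forall U V (VU : V `<=` U), is_open U -> is_open V ->
     forall s : M U, h V (res VU s) = res VU (h U s)).

Definition isomorphic M N : Prop :=
  exists2 h : (forall U, M U -> N U), is_hom h &
    forall U, is_open U -> bijective (h U).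

(* Locally free of rank n: locally, there are n sections that form a basis of
   the restriction of E, that is, an isomorphism from O_U^n to E_U. *)
Definition vector_bundle (n : nat) E : Prop :=
  is_sheaf E /\
  forall x : place X, exists U : set (place X), [/\ is_open U, U x &
    exists e : 'I_n -> E U,
    forall V (VU : V `<=` U), is_open V -> forall s : E V,
    exists! a : 'I_n -> Oring V, s = \sum_(i < n) a i *: res VU (e i)].

Definition line_bundle L : Prop := vector_bundle 1 L.

Definition OX : premodule :=
  @Premodule (fun U => (Oring U)^o) (fun U V VU f => Ores VU f).

Definition dsum M N : premodule :=
  @Premodule (fun U => (M U * N U)%type)
    (fun U V VU s => (res VU s.1, res VU s.2)).

Definition is_bilinear M N E (b : forall U, M U -> N U -> E U) : Prop :=
  [/\ forall U, is_open U -> forall (a : Oring U) (s s' : M U) (t : N U),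
        b U (a *: s + s') t = a *: b U s t + b U s' t,
      forall U, is_open U -> forall (a : Oring U) (s : M U) (t t' : N U),
        b U s (a *: t + t') = a *: b U s t + b U s t'
    & forall U V (VU : V `<=` U), is_open U -> is_open V ->
        forall (s : M U) (t : N U),
        b V (res VU s) (res VU t) = res VU (b U s t)].

(* T is a tensor product of M and N, by the universal property. *)
Definition is_tensor M N T : Prop :=
  is_sheaf T /\
  exists2 b : (forall U, M U -> N U -> T U), is_bilinear b &
    forall G, is_sheaf G ->
    forall c : (forall U, M U -> N U -> G U), is_bilinear c ->
    exists h : (forall U, T U -> G U),
      [/\ is_hom h,
          forall U, is_open U -> forall s t, h U (b U s t) = c U s t
        & forall h' : (forall U, T U -> G U), is_hom h' ->
            (forall U, is_open U -> forall s t, h' U (b U s t) = c U s t) ->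
            forall U, is_open U -> h' U =1 h U].

Definition decomposable E : Prop :=
  exists (m n : nat) (M N : premodule),
    [/\ (0 < m)%N, (0 < n)%N, vector_bundle m M, vector_bundle n N
      & isomorphic E (dsum M N)].

(* The class of E in PBun_2 X, as an equivalence class.  The universe of
   premodule is too large for [set premodule]. *)
Definition pbun_class E : premodule -> Prop := fun E' =>
  vector_bundle 2 E' /\ exists2 L, line_bundle L & is_tensor E L E'.

Definition c0 : premodule -> Prop := pbun_class (dsum OX OX).

Definition divisor_pred : {pred place X -> int} :=
  fun D => `[< finite_set [set x | D x != 0] >].

Fact divisor_zmod : zmod_closed divisor_pred.
Proof.
split=> [|D D' /asboolP fD /asboolP fD'].
  apply/asboolP; apply: (@sub_finite_set _ _ set0); last exact: finite_set0.
  by move=> x /eqP[].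
apply/asboolP.
apply: (@sub_finite_set _ _ ([set x | D x != 0] `|` [set x | D' x != 0])).
  move=> x /= DD'; apply/orP; rewrite -negb_and; apply: contra DD'.
  by move=> /andP[/eqP Dx /eqP D'x]; apply/eqP; rewrite -[LHS]/(D x - D' x) Dx D'x subrr.
by rewrite finite_setU.
Qed.
HB.instance Definition _ :=
  GRing.isZmodClosed.Build (place X -> int) divisor_pred divisor_zmod.

Record divisor := Divisor {
  divisor_val :> place X -> int; divisor_valP : divisor_val \in divisor_pred }.
HB.instance Definition _ := [isSub for divisor_val].
HB.instance Definition _ := [Choice of divisor by <:].
HB.instance Definition _ := [SubChoice_isSubZmodule of divisor by <:].

Definition principal : {pred divisor} :=
  fun D => `[< exists2 f : F, f != 0 & forall x, D x = ord x f >].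

Lemma ord_inv x (f : F) : f != 0 -> ord x f^-1 = - ord x f.
Proof.
move=> f0; apply/eqP; rewrite -addr_eq0 addrC.
by rewrite -ord_mul ?invr_eq0 // divff // ord_one.
Qed.

Fact principal_zmod : zmod_closed principal.
Proof.
split=> [|D D' /asboolP[f f0 Df] /asboolP[g g0 Dg]].
  by apply/asboolP; exists 1; [exact: oner_neq0 | move=> x; rewrite ord_one].
apply/asboolP; exists (f / g); first by rewrite mulf_neq0 ?invr_eq0.
by move=> x; rewrite ord_mul ?invr_eq0 // ord_inv // -Df -Dg.
Qed.
HB.instance Definition _ :=
  GRing.isZmodClosed.Build divisor principal principal_zmod.

Definition Cl : zmodType := Quotient.quot principal.
Definition divisor_class (D : divisor) : Cl := \pi_Cl%qT D.

(* The sections over U of the line bundle of D: div(f) + D >= 0 on U. *)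
Definition LD_pred (D : divisor) U : {pred F} :=
  fun f => `[< forall x, U x -> (f == 0) || (- D x <= ord x f) >].

Fact LD_zmod D U : zmod_closed (LD_pred D U).
Proof.
split=> [|f g /asboolP rf /asboolP rg].
  by apply/asboolP => x _; rewrite eqxx.
apply/asboolP => x Ux; have [//|fg0] := eqVneq (f - g) 0.
by rewrite (ord_sub_ge fg0) ?orbT //; [apply: rf|apply: rg].
Qed.
HB.instance Definition _ D U :=
  GRing.isZmodClosed.Build F (LD_pred D U) (LD_zmod D U).

Record LD_sec D U := MkLD { LD_val :> F; LD_valP : LD_val \in LD_pred D U }.
HB.instance Definition _ D U := [isSub for @LD_val D U].
HB.instance Definition _ D U := [Choice of LD_sec D U by <:].
HB.instance Definition _ D U := [SubChoice_isSubZmodule of LD_sec D U by <:].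

Fact LD_scale_subproof D U (a : Oring U) (s : LD_sec D U) :
  val a * val s \in LD_pred D U.
Proof.
apply/asboolP => x Ux.
have /asboolP/(_ x Ux) := OvalP a; have /asboolP/(_ x Ux) := LD_valP s.
rewrite /regular_at /= mulf_eq0.
have [//|a0] := eqVneq (Oval a) 0; have [//|s0] := eqVneq (LD_val s) 0.
by move=> /= Ds ra; rewrite ord_mul // -[leLHS]add0r lerD.
Qed.
Definition LD_scale D U (a : Oring U) (s : LD_sec D U) : LD_sec D U :=
  MkLD (LD_scale_subproof a s).

Fact LD_scaleA D U (a b : Oring U) (s : LD_sec D U) :
  LD_scale a (LD_scale b s) = LD_scale (a * b) s.
Proof. by apply: val_inj; rewrite /= mulrA. Qed.
Fact LD_scale1 D U : left_id 1 (@LD_scale D U).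
Proof. by move=> s; apply: val_inj; rewrite /= mul1r. Qed.
Fact LD_scaleDr D U : right_distributive (@LD_scale D U) +%R.
Proof. by move=> a s t; apply: val_inj; rewrite /= mulrDr. Qed.
Fact LD_scaleDl D U (s : LD_sec D U) :
  {morph (@LD_scale D U)^~ s : a b / a + b}.
Proof. by move=> a b; apply: val_inj; rewrite /= mulrDl. Qed.
HB.instance Definition _ D U := GRing.Zmodule_isLmodule.Build (Oring U)
  (LD_sec D U) (@LD_scaleA D U) (@LD_scale1 D U) (@LD_scaleDr D U)
  (@LD_scaleDl D U).

Fact LD_res_subproof D U V (VU : V `<=` U) (s : LD_sec D U) :
  val s \in LD_pred D V.
Proof. by apply/asboolP => x /VU Ux; move/asboolP: (LD_valP s); apply. Qed.
Definition LD (D : divisor) : premodule :=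
  @Premodule (fun U => LD_sec D U)
    (fun U V VU s => MkLD (LD_res_subproof VU s)).

End StructureSheaf.

Arguments c0 {k} X _.

Definition restrict_scalars (A B : comNzRingType) (u : {rmorphism A -> B})
  (M : lmodType B) : Type := M.

Section RestrictScalars.
Variables (A B : comNzRingType) (u : {rmorphism A -> B}) (M : lmodType B).
Local Notation uM := (restrict_scalars u M).

HB.instance Definition _ := GRing.Zmodule.copy uM M.

Definition restrict_scale (a : A) (s : uM) : uM := u a *: (s : M).

Fact restrict_scaleA a b s :
  restrict_scale a (restrict_scale b s) = restrict_scale (a * b) s.
Proof. by rewrite /restrict_scale scalerA rmorphM. Qed.
Fact restrict_scale1 : left_id 1 restrict_scale.
Proof. by move=> s; rewrite /restrict_scale rmorph1 scale1r. Qed.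
Fact restrict_scaleDr : right_distributive restrict_scale +%R.
Proof. by move=> a s t; rewrite /restrict_scale scalerDr. Qed.
Fact restrict_scaleDl s : {morph restrict_scale^~ s : a b / a + b}.
Proof. by move=> a b; rewrite /restrict_scale rmorphD scalerDl. Qed.
HB.instance Definition _ := GRing.Zmodule_isLmodule.Build A uM
  restrict_scaleA restrict_scale1 restrict_scaleDr restrict_scaleDl.

End RestrictScalars.

Section BaseChange.
Variables (k k' : fieldType) (i : {rmorphism k -> k'}).
Variables (X : curve k) (X' : curve k') (p : base_change i X X').

(* p maps the point y to the point x *)
Definition lies_over (y : place X') (x : place X) : Prop :=
  forall f : funField X, regular_at y (p f) = regular_at x f.

Definition preim (U : set (place X)) : set (place X') :=
  [set y | exists2 x, U x & lies_over y x].

Lemma preimS U V : V `<=` U -> preim V `<=` preim U.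
Proof. by move=> VU y [x Vx yx]; exists x => //; apply: VU. Qed.

Fact psharp_subproof U (f : Oring U) : p (val f) \in regular_on (preim U).
Proof.
by apply/asboolP => y [x Ux ->]; move/asboolP: (OvalP f); apply.
Qed.
Definition psharp U (f : Oring U) : Oring (preim U) := MkO (psharp_subproof f).

Fact psharp_zmod_morphism U : zmod_morphism (@psharp U).
Proof. by move=> f g; apply: val_inj; rewrite /= rmorphB. Qed.
Fact psharp_monoid_morphism U : monoid_morphism (@psharp U).
Proof.
by split=> [|f g]; apply: val_inj; rewrite /= (rmorph1, rmorphM).
Qed.
HB.instance Definition _ U := GRing.isZmodMorphism.Build (Oring U)
  (Oring (preim U)) (@psharp U) (@psharp_zmod_morphism U).
HB.instance Definition _ U := GRing.isMonoidMorphism.Build (Oring U)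
  (Oring (preim U)) (@psharp U) (@psharp_monoid_morphism U).

Definition pushforward (M : premodule X') : premodule X :=
  @Premodule _ X (fun U => restrict_scalars (@psharp U) (M (preim U)))
    (fun U V VU s => res (preimS VU) (s : M (preim U))).

Definition pushforward_hom (M N : premodule X') (h : forall U, M U -> N U) :
  forall U, pushforward M U -> pushforward N U := fun U => h (preim U).

(* E' is a pullback of E, by the adjunction between p^* and p_*. *)
Definition is_pullback (E : premodule X) (E' : premodule X') : Prop :=
  is_sheaf E' /\
  exists2 eta : (forall U, E U -> pushforward E' U), is_hom eta &
    forall G : premodule X', is_sheaf G ->
    forall c : (forall U, E U -> pushforward G U), is_hom c ->
    exists h : (forall U, E' U -> G U),
      [/\ is_hom h,
          forall U, is_open U -> forall s,
            pushforward_hom h (eta U s) = c U s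
        & forall h' : (forall U, E' U -> G U), is_hom h' ->
            (forall U, is_open U -> forall s,
               pushforward_hom h' (eta U s) = c U s) ->
            forall U, is_open U -> h' U =1 h U].

(* PBun_2^tr X, when p is the projection from X (x)_k kbar. *)
Definition PBun2tr (c : premodule X -> Prop) : Prop :=
  exists E, [/\ vector_bundle 2 E, ~ decomposable E,
      (exists2 E', is_pullback E E' & decomposable E')
    & c = pbun_class E].

(* D' = p^* D: the coefficient of D' at y is that of D at p(y), times the
   ramification index, which is the order at y of a uniformiser at p(y). *)
Definition is_pullback_divisor (D : divisor X) (D' : divisor X') : Prop :=
  forall (y : place X') (x : place X) (f : funField X),
    lies_over y x -> ord x f = 1 -> D' y = ord y (p f) * D x.

(* The image of p^* : Cl X -> Cl X'. *)
Definition pulled_back : {pred Cl X'} :=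
  fun c => `[< exists (D : divisor X) (D' : divisor X'),
    is_pullback_divisor D D' /\ c = divisor_class D' >].

Fact pulled_back_zmod : zmod_closed pulled_back.
Proof.
split=> [|c d /asboolP[C [C' [CC' ->]]] /asboolP[D [D' [DD' ->]]]].
  apply/asboolP; exists 0, 0; split; last by rewrite /divisor_class raddf0.
  by move=> y x f _ _; rewrite mulr0.
apply/asboolP; exists (C - D), (C' - D').
split; last by rewrite /divisor_class raddfB.
by move=> y x f yx fx; rewrite mulrBr -(CC' y x f) // -(DD' y x f).
Qed.
HB.instance Definition _ :=
  GRing.isZmodClosed.Build (Cl X') pulled_back pulled_back_zmod.

(* Cl X' / Cl X *)
Definition relCl : zmodType := Quotient.quot pulled_back.
Definition relCl_class (D : divisor X') : relCl :=
  \pi_relCl%qT (divisor_class D).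

Definition t_ (D : divisor X') : premodule X -> Prop :=
  pbun_class (pushforward (LD D)).

End BaseChange.

(* Main.v *)
(* Choosing a basis of the generic fibre, a bundle of rank n is a family (A_x)
   of invertible matrices over the function field F, almost all integral with
   integral inverse, and homomorphisms are matrices over F; tensoring with a
   line bundle multiplies (A_x) by an idele.  In particular p_* L_D is a lattice
   in F2 = F(zeta), seen as a 2-dimensional space over F, where zeta generates
   F_(q^2) and sigma is the conjugation of F2 / F.

   Fibres: for D' = D o sigma, sigma induces p_* L_D' = p_* L_D, and D + D' comes
   from X by the norm, so [D'] = -[D].  Conversely, a similarity of p_* L_D and
   p_* L_D' is an F-linear map z |-> alpha z + beta sigma(z), whose inverse has
   the same shape with alpha', beta', and alpha' alpha + beta' sigma(beta) = 1.
   If alpha' alpha is not 0 then, being regular everywhere, it is constant, and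
   alpha is an equivalence of D and D' up to a divisor of X; otherwise
   beta' sigma(beta) = 1 and beta is one of D and -D'.

   Image: p_* L_D has the endomorphism zeta, so it is decomposable over kbar; if
   it is decomposable on X, the off-diagonal entries of zeta show that it is
   similar to O + O.  Conversely, if E is indecomposable but becomes decomposable
   over kbar, then the endomorphisms of E include one with an irreducible
   characteristic polynomial, as otherwise their combinations over kbar would
   contain no nontrivial idempotent.  It makes the generic fibre of E a vector
   space over F2 of dimension 1, so that E = p_* L_D. *)
Require Import Defs.
From HB Require Import structures.
From mathcomp Require Import all_boot all_order all_algebra all_field.
From mathcomp Require Import pgroup zify ring.
From mathcomp Require Import mathcomp_extra boolp classical_sets functions.
From mathcomp Require Import cardinality finmap.

Set Implicit Arguments.
Unset Strict Implicit.
Unset Printing Implicit Defensive.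

Import Order.TTheory GRing.Theory Num.Theory.

Local Open Scope classical_set_scope.
Local Open Scope ring_scope.

(** An extension of constants is unramified, and the facts about p rest on one form of this: if
    constants d_1, ..., d_n are independent over k and the sum of the a_j d_j is regular at all
    places above x, then every a_j is regular at x. The proof needs an automorphism with fixed field
    k, which then permutes the places above x; the q-power map serves both for F_(q^2) and for kbar,
    so no finite subextension of kbar has to be chosen. Hence 1, zeta is an integral basis of F2
    above every x, and the endomorphisms of the pullback of E are combinations over kbar of those of
    E.

    A divisor becomes a lattice through one element of F2 for each x, with prescribed orders at all
    places above x; weak approximation provides it.

    Places being mere valuations, their supply has to be derived from the field: a nonzero function
    has finitely many zeros and poles, every x has a place above it, and a transcendental function
    has a pole. The last makes regular functions constant, because k is algebraically closed in F
    when F (x) kbar is a field. *)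

HB.instance Definition _ (k : fieldType) (X : curve k) := gen_eqMixin (place X).
HB.instance Definition _ (k : fieldType) (X : curve k) :=
  gen_choiceMixin (place X).

(** * Valuations and weak approximation *)

Section Valuations.
Variables (k : fieldType) (X : curve k).
Local Notation F := (funField X).
Implicit Types (x y : place X) (f g h : F).

(** Since [ord x 0] is the default 0, the disjunct is what gives 0 infinite order. *)
Definition ord_ge x (m : int) : {pred F} := fun f => (f == 0) || (m <= ord x f).

Fact ord_ge_zmod x m : zmod_closed (ord_ge x m).
Proof.
split=> [|f g fm gm]; first by rewrite unfold_in eqxx.
rewrite unfold_in; have [//|fg0] := eqVneq (f - g) 0.
exact: ord_sub_ge.
Qed.
HB.instance Definition _ x m :=
  GRing.isZmodClosed.Build F (ord_ge x m) (ord_ge_zmod x m).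

Definition valring x : {pred F} := fun f => regular_at x f.

Lemma ord_ge0E x f : (f \in ord_ge x 0) = (f \in valring x).
Proof. by []. Qed.

Lemma ord_geE x m f : f != 0 -> (f \in ord_ge x m) = (m <= ord x f).
Proof. by rewrite unfold_in => /negbTE->. Qed.

Lemma ord_geM x m n f g :
  f \in ord_ge x m -> g \in ord_ge x n -> f * g \in ord_ge x (m + n).
Proof.
have [->|f0] := eqVneq f 0; first by rewrite mul0r !rpred0.
have [->|g0] := eqVneq g 0; first by rewrite mulr0 !rpred0.
rewrite !ord_geE ?mulf_neq0 // ord_mul // => fm gn; exact: lerD.
Qed.

Lemma ord_ge_le x m n f : n <= m -> f \in ord_ge x m -> f \in ord_ge x n.
Proof.
have [->|f0] := eqVneq f 0; first by rewrite !rpred0.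
by rewrite !ord_geE //; apply: le_trans.
Qed.

Lemma valringE x f : f != 0 -> (f \in valring x) = (0 <= ord x f).
Proof. exact: ord_geE. Qed.

Fact valring_subring x : subring_closed (valring x).
Proof.
split=> [|f g|f g].
- by rewrite unfold_in /regular_at ord_one lexx orbT.
- by rewrite -!ord_ge0E; apply: rpredB.
- by rewrite -!ord_ge0E => fx gx; rewrite -[0]addr0; apply: ord_geM.
Qed.
HB.instance Definition _ x :=
  GRing.isSubringClosed.Build F (valring x) (valring_subring x).

Lemma ordX x f n : ord x (f ^+ n) = ord x f *+ n.
Proof.
have [->|f0] := eqVneq f 0.
  by case: n => [|n]; rewrite ?expr0 ?ord_one // expr0n ord_zero mul0rn.
elim: n => [|n IH]; first by rewrite expr0 ord_one.
by rewrite exprS ord_mul ?expf_neq0 // IH mulrS.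
Qed.

Lemma ordXz x f (n : int) : f != 0 -> ord x (f ^ n) = n * ord x f.
Proof.
move=> f0; case: n => n.
  by rewrite -exprnP ordX -mulr_natl natz.
by rewrite NegzE -exprnN ord_inv ?expf_neq0 // ordX mulNr -mulr_natl natz.
Qed.

Lemma ord_div x f g : f != 0 -> g != 0 -> ord x (f / g) = ord x f - ord x g.
Proof. by move=> f0 g0; rewrite ord_mul ?invr_eq0 // ord_inv. Qed.

Lemma ord_prod x (I : eqType) (s : seq I) (f : I -> F) :
  (forall i, f i != 0) -> ord x (\prod_(i <- s) f i) = \sum_(i <- s) ord x (f i).
Proof.
move=> f0; elim: s => [|i s IH]; first by rewrite !big_nil ord_one.
by rewrite !big_cons ord_mul ?IH // prodf_seq_neq0; apply/allP => j _; apply/implyP.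
Qed.

Lemma const_valring x c : const X c \in valring x.
Proof. by rewrite unfold_in /regular_at ord_const lexx orbT. Qed.

Lemma valring_total x f : f \notin valring x -> f^-1 \in valring x.
Proof.
have [->|f0] := eqVneq f 0; first by rewrite !rpred0.
rewrite !valringE ?invr_eq0 // ord_inv // -ltNge oppr_ge0.
exact: ltW.
Qed.

(** The strict ultrametric rule. Asking for [r] in an additive subgroup lets it be 0 or a long sum,
    and [f + r != 0] is what later refutes vanishing sums. *)
Lemma ord_addl x f r :
  f != 0 -> r \in ord_ge x (ord x f + 1) -> f + r != 0 /\ ord x (f + r) = ord x f.
Proof.
move=> f0 rf; have fN : f \notin ord_ge x (ord x f + 1).
  by rewrite ord_geE // -ltNge ltrDl.
have nz : f + r != 0.
  by apply: contra fN; rewrite addr_eq0 => /eqP e; rewrite {1}e rpredN.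
split=> //; apply/eqP; rewrite eq_le; apply/andP; split.
  rewrite leNgt; apply: contra fN => lt.
  by rewrite -{1}(addrK r f) rpredB // ord_geE // lezD1.
rewrite -(ord_geE _ _ nz); apply: rpredD; first by rewrite ord_geE.
by apply: ord_ge_le rf; rewrite lerDl.
Qed.

Lemma ord_eq0 x f : f \in valring x -> f^-1 \in valring x -> ord x f = 0.
Proof.
have [->|f0] := eqVneq f 0; first by rewrite ord_zero.
rewrite !valringE ?invr_eq0 // ord_inv // oppr_ge0 => f1 f2.
by apply: le_anti; rewrite f1 f2.
Qed.

Lemma unif_neq0 x f : ord x f = 1 -> f != 0.
Proof. by move=> fx; apply: contra_eq_neq fx => ->; rewrite ord_zero. Qed.

(** Dividing f by the right power of u leaves a unit at x, hence a unit at y, so the two orders are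
    proportional. *)
Lemma place_incl_ord x y u : (forall f, f \in valring x -> f \in valring y) ->
  ord x u = 1 -> forall f, f != 0 -> ord y f = ord x f * ord y u.
Proof.
move=> xy ux f f0; have u0 := unif_neq0 ux.
pose g := f / u ^ ord x f.
have ue0 : u ^ ord x f != 0 by rewrite expfz_eq0 negb_and u0 orbT.
have g0 : g != 0 by rewrite mulf_neq0 ?invr_eq0.
have gx : ord x g = 0 by rewrite ord_div // ordXz // ux mulr1 subrr.
have gy : ord y g = 0.
  by apply: ord_eq0; apply: xy; rewrite valringE ?invr_eq0 // ?ord_inv // gx.
by move: gy; rewrite ord_div // ordXz // => /eqP; rewrite subr_eq0 => /eqP.
Qed.

Lemma place_inj x y : ord x =1 ord y -> x = y.
Proof.
case: x y => [ox z1 m1 a1 c1 u1] [oy z2 m2 a2 c2 u2] /= /funext e.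
by subst oy; congr Place; apply: Prop_irrelevance.
Qed.

(** The factor [ord y u] is nonnegative and divides the order 1 of a uniformiser at y, so it is 1:
    discrete valuation rings of F are not strictly nested. *)
Lemma place_incl x y : (forall f, f \in valring x -> f \in valring y) -> x = y.
Proof.
move=> xy; have [u ux] := ord_unif x; have ordE := place_incl_ord xy ux.
have u0 := unif_neq0 ux.
have uy0 : 0 <= ord y u by rewrite -valringE // xy // valringE // ux.
have [v vy] := ord_unif y.
have := ordE v (unif_neq0 vy); rewrite vy => e.
suff uy : ord y u = 1.
  apply: place_inj => f; have [->|f0] := eqVneq f 0; first by rewrite !ord_zero.
  by rewrite ordE // uy mulr1.
have : ord y u \is a GRing.unit.
  by apply/unitrP; exists (ord x v); rewrite [ord y u * _]mulrC -e.
by rewrite unfold_in => /orP[/eqP//|/eqP uy]; rewrite uy in uy0.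
Qed.

Lemma place_separate x y : x <> y ->
  exists2 f, f \in valring x & f \notin valring y.
Proof.
move=> xy; apply: contrapT => H; apply: xy; apply: place_incl => f fx.
by apply: contrapT => /negP fy; apply: H; exists f.
Qed.

Lemma separate2 x y : x <> y -> exists g, [/\ g != 0, 0 < ord x g & ord y g < 0].
Proof.
move=> xy; have [f fx fy] := place_separate xy.
have [g gy gx] := place_separate (nesym xy).
have f0 : f != 0 by apply: contraNneq fy => ->; apply: rpred0.
have g0 : g != 0 by apply: contraNneq gx => ->; apply: rpred0.
move: fx fy gy gx; rewrite !valringE // -!ltNge => fx fy gy gx.
by exists (f / g); rewrite mulf_neq0 ?invr_eq0 // !ord_div //; split=> //; lia.
Qed.

Lemma separate_seq x (s : seq (place X)) : x \notin s ->
  exists g, [/\ g != 0, 0 < ord x g & forall y, y \in s -> ord y g < 0].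
Proof.
elim: s => [_|y s IH].
  have [u ux] := ord_unif x; exists u; split; first exact: unif_neq0 ux.
    by rewrite ux.
  by [].
rewrite inE negb_or => /andP[/eqP xy /IH[g [g0 gx gs]]].
have [h [h0 hx hy]] := separate2 xy.
have [gy|gy] := ltP (ord y g) 0.
  by exists g; split=> // z; rewrite inE => /orP[/eqP->//|/gs].
(* m exceeds every [|ord z h|] on s, so there the poles of g^m dominate h; at y, where g has no
   pole, h dominates. *)
pose m := (\sum_(z <- s) `|ord z h|).+1.
have hm z : z \in s -> ord z (g ^+ m) < ord z h.
  move=> zs; rewrite ordX -mulr_natr.
  have : (`|ord z h| <= \sum_(z <- s) `|ord z h|)%N.
    by rewrite (big_rem z) //= leq_addr.
  have := gs z zs; rewrite /m; nia.
have gm0 : g ^+ m != 0 by rewrite expf_neq0.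
have hy' : ord y h < ord y (g ^+ m).
  by rewrite ordX; apply: lt_le_trans hy _; rewrite mulrn_wge0.
have [gh0 ghy] : h + g ^+ m != 0 /\ ord y (h + g ^+ m) = ord y h.
  by apply: ord_addl => //; rewrite ord_geE // lezD1.
exists (h + g ^+ m); split=> //.
  have : h + g ^+ m \in ord_ge x 1.
    by rewrite rpredD // ord_geE // -?gtz0_ge1 // ordX -mulr_natr /m; nia.
  by rewrite ord_geE // => ?; lia.
move=> z; rewrite inE => /orP[/eqP->|zs]; first by rewrite ghy.
have zz := hm z zs.
have [_] : g ^+ m + h != 0 /\ ord z (g ^+ m + h) = ord z (g ^+ m).
  by apply: ord_addl => //; rewrite ord_geE // lezD1.
by rewrite addrC => ->; have := gs z zs; rewrite ordX -mulr_natr /m; nia.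
Qed.

(** With g vanishing at x and having poles on s, u = 1 / (1 + g) is 1 at x and 0 on s. In u^m p + (1
    - u)^2 the first term has order 1 at x and, for large m, positive order on s; the second has
    order at least 2 at x and order 0 on s. *)
Lemma local_unif x (s : seq (place X)) : x \notin s ->
  exists h, [/\ h != 0, ord x h = 1 & forall y, y \in s -> ord y h = 0].
Proof.
move=> xs; have [g [g0 gx gs]] := separate_seq xs.
have [p px] := ord_unif x; have p0 := unif_neq0 px.
have [g10 g1x] : 1 + g != 0 /\ ord x (1 + g) = ord x 1.
  apply: ord_addl; rewrite ?oner_neq0 // ord_geE // ord_one; lia.
rewrite ord_one in g1x.
pose u := (1 + g)^-1; have u0 : u != 0 by rewrite invr_eq0.
have ux : ord x u = 0 by rewrite ord_inv // g1x.
have us y : y \in s -> 0 < ord y u.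
  move=> ys; rewrite ord_inv // addrC.
  have [_ ->] : g + 1 != 0 /\ ord y (g + 1) = ord y g.
    apply: ord_addl; rewrite // ord_geE ?oner_neq0 // ord_one.
    by have := gs y ys; lia.
  by have := gs y ys; lia.
have vE : 1 - u = g * u.
  by rewrite /u; field.
pose m := (\sum_(z <- s) `|ord z p|).+1.
have um0 : u ^+ m * p != 0 by rewrite mulf_neq0 ?expf_neq0.
have v0 : g * u != 0 by rewrite mulf_neq0.
exists (u ^+ m * p + (g * u) ^+ 2).
have umx : ord x (u ^+ m * p) = 1.
  by rewrite ord_mul ?expf_neq0 // ordX ux mul0rn add0r.
have [nz ox] : u ^+ m * p + (g * u) ^+ 2 != 0 /\
    ord x (u ^+ m * p + (g * u) ^+ 2) = ord x (u ^+ m * p).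
  apply: ord_addl; rewrite // umx ord_geE ?expf_neq0 // ordX ord_mul // ux.
  by rewrite addr0; lia.
split=> //; first by rewrite ox.
move=> y ys; rewrite addrC.
have vy : ord y (g * u) = 0.
  rewrite -vE.
  have [_ ->] : 1 - u != 0 /\ ord y (1 - u) = ord y 1; last by rewrite ord_one.
  apply: ord_addl; rewrite ?oner_neq0 // ord_geE ?oppr_eq0 // ord_opp ord_one.
  by have := us y ys; lia.
have vy2 : ord y ((g * u) ^+ 2) = 0 by rewrite ordX vy mul0rn.
have [_ ->] : (g * u) ^+ 2 + u ^+ m * p != 0 /\
    ord y ((g * u) ^+ 2 + u ^+ m * p) = ord y ((g * u) ^+ 2); last by [].
apply: ord_addl; rewrite ?expf_neq0 // vy2 ord_geE // ord_mul ?expf_neq0 //.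
rewrite ordX -mulr_natr.
have : (`|ord y p| <= \sum_(z <- s) `|ord z p|)%N by rewrite (big_rem y) //= leq_addr.
have := us y ys; rewrite /m; nia.
Qed.

Lemma prescribed_ords (s : seq (place X)) (m : place X -> int) :
  exists2 g, g != 0 & forall x, x \in s -> ord x g = m x.
Proof.
suff [g g0 gs] : exists2 g, g != 0 & forall x, x \in undup s -> ord x g = m x.
  by exists g => // x; rewrite -mem_undup; apply: gs.
have := undup_uniq s; move: (undup s) => {}s us.
have /choice[h hP] : forall x, exists h, h != 0 /\ (x \in s -> ord x h = 1 /\
    forall y, y \in s -> y != x -> ord y h = 0).
  move=> x; have /local_unif[h [h0 hx hs]] : x \notin rem x s.
    by rewrite mem_rem_uniq // inE /= eqxx.
  exists h; split=> // xs; split=> // y ys yx; apply: hs.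
  by rewrite mem_rem_uniq // inE yx.
exists (\prod_(x <- s) h x ^ m x).
  by rewrite prodf_seq_neq0; apply/allP => x _; rewrite expfz_eq0 negb_and (hP x).1 orbT.
move=> x xs; rewrite ord_prod; last first.
  by move=> y; rewrite expfz_eq0 negb_and (hP y).1 orbT.
rewrite (bigD1_seq x) //= big_seq_cond big1 => [|y /andP[ys yx]].
  by rewrite addr0 ordXz ?(hP x).1 // ((hP x).2 xs).1 mulr1.
by rewrite ordXz ?(hP y).1 // ((hP y).2 ys).2 ?mulr0 // eq_sym.
Qed.

End Valuations.

(** * Zeros and poles *)

(** Fraction-free elimination: the rows of [T] combine those of C so as to clear column 0, and since
    [T] is c times the identity outside column [i0], multiplying by it kills no nonzero vector. *)
Lemma idomain_left_kernel (R : idomainType) n (C : 'M[R]_(n.+1, n)) :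
  exists2 v : 'rV_n.+1, v != 0 & v *m C = 0.
Proof.
elim: n C => [|n IH] C.
  by exists (const_mx 1); [apply/rV0Pn; exists 0; rewrite mxE oner_neq0 | rewrite thinmx0].
suff [T [i0 [c [c0 Tc T0]]]] : exists (T : 'M[R]_(n.+1, n.+2)) i0 c,
    [/\ c != 0, forall i j, T i (lift i0 j) = c *+ (i == j) &
     forall i, (T *m C) i 0 = 0].
  have [v v0 vTC] := IH (col' 0 (T *m C)).
  exists (v *m T).
    have /rV0Pn[j vj] := v0; apply/rV0Pn; exists (lift i0 j).
    rewrite mxE (bigD1 j) //= Tc eqxx big1 ?addr0 ?mulf_neq0 // => i /negbTE ij.
    by rewrite Tc ij mulr0n mulr0.
  rewrite -mulmxA; apply/rowP => j; rewrite [RHS]mxE.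
  have [j' ->|->] := unliftP 0 j.
    have /rowP/(_ j') := vTC; rewrite [LHS]mxE [RHS]mxE => <-.
    by rewrite mxE; apply: eq_bigr => i _; rewrite [in RHS]mxE.
  by rewrite mxE big1 // => i _; rewrite T0 mulr0.
have [/existsP[i0 Ci0]|/existsPn C0] := boolP [exists i, C i 0 != 0].
  exists (\matrix_(i, j) (C i0 0 *+ (j == lift i0 i) - C (lift i0 i) 0 *+ (j == i0))), i0, (C i0 0).
  split=> // [i j|i].
    by rewrite mxE (inj_eq lift_inj) lift_eqF mulr0n subr0 eq_sym.
  rewrite mxE (bigD1 i0) //= (bigD1 (lift i0 i)) ?lift_eqF //= !mxE !eqxx.
  rewrite eq_liftF lift_eqF /= big1 => [|j /andP[/negbTE j1 /negbTE j2]].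
    by rewrite !mulr0n !mulr1n sub0r subr0 addr0 mulNr mulrC addNr.
  by rewrite mxE j1 j2 !mulr0n subr0 mul0r.
exists (\matrix_(i, j) (j == lift 0 i)%:R), 0, 1; split; first exact: oner_neq0.
  by move=> i j; rewrite mxE (inj_eq lift_inj) eq_sym.
move=> i; rewrite mxE big1 // => j _.
by have := C0 j; rewrite negbK => /eqP->; rewrite mulr0.
Qed.

(** * Algebraic relations over k[u] *)

Section Finiteness.
Variables (k : fieldType) (X : curve k).
Local Notation F := (funField X).
Implicit Types (x y : place X) (f g h u : F) (P Q : {poly k}).

Definition ev u P : F := (map_poly (const X) P).[u].

Lemma evB u : zmod_morphism (ev u).
Proof. by move=> P Q; rewrite /ev rmorphB hornerD hornerN. Qed.
Lemma evM u : monoid_morphism (ev u).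
Proof. by split=> [|P Q]; rewrite /ev (rmorph1, rmorphM) (hornerC, hornerM). Qed.
HB.instance Definition _ u := GRing.isZmodMorphism.Build {poly k} F (ev u) (evB u).
HB.instance Definition _ u := GRing.isMonoidMorphism.Build {poly k} F (ev u) (evM u).

Lemma evX u : ev u 'X = u.
Proof. by rewrite /ev map_polyX hornerX. Qed.
Lemma evC u c : ev u c%:P = const X c.
Proof. by rewrite /ev map_polyC hornerC. Qed.

Definition transcendental u := forall P, P != 0 -> ev u P != 0.

Lemma transcendentalP u : ~ algebraicOver (const X) u -> transcendental u.
Proof.
move=> nu P P0; apply/eqP => Pu; apply: nu; exists P => //.
exact/eqP.
Qed.

(** For transcendental u this is [F : k(u)] < N, with denominators cleared. *)
Definition lin_dep u N := forall z : 'I_N -> F, exists P : 'I_N -> {poly k},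
  (exists i, P i != 0) /\ \sum_i ev u (P i) * z i = 0.

Lemma curve_gen : exists2 t : F, ~ algebraicOver (const X) t &
  exists (n : nat) (b : 'I_n -> F), forall z : F,
  exists (c : 'I_n -> {poly k}) (d : {poly k}),
    ev t d != 0 /\ z = \sum_(i < n) ev t (c i) / ev t d * b i.
Proof. by rewrite /ev; case: X. Qed.

Lemma curve_lin_dep : exists t N, transcendental t /\ lin_dep t N.
Proof.
have [t ttr [n [b bP]]] := curve_gen; exists t, n.+1.
split; first exact: transcendentalP.
move=> z; have /choice[C /choice[d Cd]] := fun j => bP (z j).
have [v v0 vC] := idomain_left_kernel (\matrix_(j < n.+1, i < n) C j i).
exists (fun j => v 0 j * d j); split.
  have /rV0Pn[j vj] := v0; exists j; rewrite mulf_neq0 //.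
  by have [d0 _] := Cd j; apply: contraNneq d0 => ->; rewrite rmorph0.
rewrite (eq_bigr (fun j => \sum_i ev t (v 0 j * C j i) * b i)).
  rewrite exchange_big big1 // => i _; rewrite -mulr_suml -rmorph_sum.
  have /rowP/(_ i) := vC; rewrite [LHS]mxE [RHS]mxE.
  by under eq_bigr do rewrite mxE; move=> ->; rewrite rmorph0 mul0r.
move=> j _; have [d0 zj] := Cd j; rewrite {1}zj mulr_sumr; apply: eq_bigr => i _.
by rewrite !rmorphM /=; field.
Qed.

Lemma evE u P n : (size P <= n)%N -> ev u P = \sum_(i < n) const X P`_i * u ^+ i.
Proof.
move=> Pn; rewrite /ev (horner_coef_wide _ (n := n)); last first.
  by rewrite size_map_poly.
by apply: eq_bigr => i _; rewrite coef_map.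
Qed.

Lemma ev_rev u P m : u != 0 -> (size P <= m.+1)%N ->
  ev u^-1 (\poly_(i < m.+1) P`_(m - i)) = ev u P / u ^+ m.
Proof.
move=> u0 Pm; rewrite (evE _ (n := m.+1)) ?size_poly // (evE _ Pm) mulr_suml.
rewrite (reindex_inj rev_ord_inj) /=; apply: eq_bigr => i _.
rewrite coef_poly subSS ltnS leq_subr; have im : (i <= m)%N by rewrite -ltnS.
rewrite subKn // -mulrA; congr (_ * _); rewrite exprVn.
have -> : u ^+ m = u ^+ (m - i) * u ^+ i by rewrite -exprD subnK.
by field; rewrite !expf_neq0.
Qed.

Lemma rev_poly_eq0 P m : (size P <= m.+1)%N ->
  \poly_(i < m.+1) P`_(m - i) = 0 -> P = 0.
Proof.
move=> Pm /polyP P0; apply/polyP => i; rewrite coef0.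
have [im|mi] := leqP i m.
  by have := P0 (m - i)%N; rewrite coef_poly ltnS leq_subr coef0 subKn.
by rewrite nth_default // (leq_trans Pm).
Qed.

Lemma transcendental_neq0 u : transcendental u -> u != 0.
Proof. by move=> /(_ 'X); rewrite polyX_eq0 evX; apply. Qed.

Lemma transcendentalV u : transcendental u -> transcendental u^-1.
Proof.
move=> utr P P0; have u0 := transcendental_neq0 utr.
have := @ev_rev u^-1 P (size P); rewrite invr_eq0 invrK => /(_ u0 (leqnSn _)) e.
apply/eqP => Pu; move: e; rewrite Pu mul0r => /eqP.
apply/negP; apply: utr; apply: contraNneq P0 => R0.
by apply/eqP; apply: rev_poly_eq0 R0.
Qed.

(** Reversing the coefficients turns a relation over k[u] into one over k[1/u]. At any given place u
    or 1/u is regular, and the regular one can serve as parameter. *)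
Lemma lin_depV u N : transcendental u -> lin_dep u N -> lin_dep u^-1 N.
Proof.
move=> utr ud z; have u0 := transcendental_neq0 utr.
have [P [[i Pi] Pz]] := ud z; pose m := (\max_i size (P i))%N.
have Pm j : (size (P j) <= m.+1)%N by apply: leqW; apply: (leq_bigmax j).
exists (fun j => \poly_(l < m.+1) (P j)`_(m - l)); split.
  by exists i; apply: contraNneq Pi => /rev_poly_eq0->.
rewrite (eq_bigr (fun j => (ev u (P j) * z j) / u ^+ m)).
  by rewrite -mulr_suml Pz mul0r.
by move=> j _; rewrite ev_rev // mulrAC.
Qed.

(** In a relation between the powers of f, the lowest nonzero coefficient is divisible by f, and the
    cofactor h is a polynomial in u and f. So f divides a nonzero polynomial in u inside every ring
    that contains k, u and f. *)
Lemma algebraic_const_term u N f : f != 0 -> lin_dep u N ->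
  exists P h, [/\ P != 0, ev u P = f * h &
  forall S : subringClosed F, (forall c, const X c \in S) -> u \in S -> f \in S ->
    h \in S].
Proof.
move=> f0 ud; have [P [[i Pi] Pf]] := ud (fun i => f ^+ i).
have [j Pj jmin] := @arg_minnP _ i (fun i => P i != 0) (fun i => val i) Pi.
exists (P j), (- \sum_(l < N | (j < l)%N) ev u (P l) * f ^+ (l - j.+1)).
split=> //.
  apply: (mulfI (expf_neq0 j f0)); apply/eqP; rewrite -subr_eq0; apply/eqP.
  rewrite -[RHS]Pf mulrN mulrN opprK mulrA -exprSr mulr_sumr.
  rewrite [RHS](bigD1 j) //= mulrC; congr (_ + _).
  rewrite [RHS](bigID (fun l : 'I_N => j < l)%N) /= [X in _ = _ + X]big1; last first.
    move=> l /andP[lj jl]; have /eqP-> : P l == 0; last by rewrite rmorph0 mul0r.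
    by apply: contraNT jl => Pl; rewrite ltn_neqAle jmin // andbT eq_sym.
  rewrite addr0; apply: eq_big => [l|l jl].
    by apply/esym/andb_idl => jl; apply: contraTneq jl => ->; rewrite ltnn.
  by rewrite mulrCA -exprD addnC subnK.
move=> S cS uS fS; rewrite rpredN rpred_sum // => l _; rewrite rpredM ?rpredX //.
by rewrite (evE _ (leqnn _)) rpred_sum // => a _; rewrite rpredM ?rpredX.
Qed.

Lemma ev_closed u P (S : subringClosed F) : (forall c, const X c \in S) -> u \in S ->
  ev u P \in S.
Proof.
by move=> cS uS; rewrite (evE _ (leqnn _)) rpred_sum // => a _; rewrite rpredM ?rpredX.
Qed.

(** Factors Q common to all coefficients are divided out, so that the relation stays nontrivial
    modulo Q. *)
Lemma lin_dep_primitive u N Q : transcendental u -> lin_dep u N ->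
  (1 < size Q)%N -> forall z : 'I_N -> F, exists P : 'I_N -> {poly k},
  (exists i, ~~ (Q %| P i)) /\ \sum_i ev u (P i) * z i = 0.
Proof.
move=> utr ud Q1 z; have [P [[i Pi] Pz]] := ud z.
have Q0 : Q != 0 by rewrite -size_poly_gt0 (leq_trans _ Q1).
have [n] := ubnP (size (P i)); elim: n P Pi Pz => // n IH P Pi Pz Pn.
have [/existsP[j Pj]|/existsPn QP] := boolP [exists j, ~~ (Q %| P j)].
  by exists P; split=> //; exists j.
have PE j : P j = P j %/ Q * Q by have := QP j; rewrite negbK => /divpK.
apply: (IH (fun j => P j %/ Q)).
- by apply: contraNneq Pi => e; rewrite PE e mul0r.
- apply: (mulIf (utr Q Q0)); rewrite mul0r -{}[RHS]Pz mulr_suml.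
  by apply: eq_bigr => j _; rewrite {2}PE rmorphM /= mulrAC.
- move: Pn; rewrite {1}PE size_mul //; last by apply: contraNneq Pi => e; rewrite PE e mul0r.
  by move: (size Q) (size (P i %/ Q)) Q1 => [|[|a]] b // _; rewrite !addnS /= ltnS; apply:
    leq_ltn_trans; rewrite leq_addr.
Qed.

End Finiteness.

(** * Finiteness of the zeros and poles of a function *)

Section FiniteSupport.
Variables (k : fieldType) (X : curve k).
Local Notation F := (funField X).
Implicit Types (x y : place X) (f g h u : F) (P Q : {poly k}).

Lemma irredp_coprimep Q P : irreducible_poly Q -> ~~ (Q %| P) -> coprimep Q P.
Proof.
move=> [Q1 Qirr] QP; rewrite /coprimep; apply: contraNT QP => gN1.
have := Qirr _ gN1 (dvdp_gcdl Q P) => /eqp_dvdl <-; exact: dvdp_gcdr.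
Qed.

Lemma ord_ge1M x f g : f \in ord_ge x 1 -> g \in valring x -> f * g \in ord_ge x 1.
Proof. by move=> f1 gx; rewrite -[1]addr0 ord_geM. Qed.

Lemma ev_valring x u P : u \in valring x -> ev u P \in valring x.
Proof. by move=> ux; apply: ev_closed => // c; apply: const_valring. Qed.

(** By Bezout, P(u) times some polynomial in u is 1 minus a multiple of Q(u), a unit at x. *)
Lemma ev_ord_eq0 x u P Q : irreducible_poly Q -> u \in valring x ->
  ev u Q \in ord_ge x 1 -> ~~ (Q %| P) -> ev u P != 0 /\ ord x (ev u P) = 0.
Proof.
move=> Qirr ux Qu /(irredp_coprimep Qirr)/Bezout_eq1_coprimepP[[a b] /= ab].
have e : ev u P * ev u b = 1 - ev u Q * ev u a.
  by rewrite -[X in X - _](rmorph1 (ev u)) -ab !(rmorphD, rmorphM) /=; ring.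
have [nz o1] : 1 + - (ev u Q * ev u a) != 0 /\ ord x (1 + - (ev u Q * ev u a)) = ord x 1.
  apply: ord_addl; first exact: oner_neq0.
  by rewrite rpredN ord_one add0r ord_ge1M // ev_valring.
rewrite ord_one -e in o1; move: nz; rewrite -e mulf_eq0 negb_or => /andP[P0 b0].
split=> //; move: o1; rewrite ord_mul //.
have := ev_valring P ux; have := ev_valring b ux; rewrite !valringE //; lia.
Qed.

(** Given N zeros x_i of Q(u), take g_i with a zero at x_i and poles at the other x_j. In a relation
    between the inverses of the g_i that is nontrivial modulo Q, a coefficient prime to Q is a unit
    at x_i, so its term has a pole there while all the others vanish. *)
Lemma finite_zeros_irred u N Q : transcendental u -> lin_dep u N ->
  irreducible_poly Q ->
  finite_set [set x | u \in valring x /\ ev u Q \in ord_ge x 1].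
Proof.
move=> utr ud Qirr; apply: contrapT => /(infinite_set_fset N)[B BZ NB].
have sN : size (take N B) == N by rewrite size_takel.
pose s := Tuple sN; have su : uniq s by rewrite take_uniq // fset_uniq.
have /tuple_uniqP xinj := su; pose x := tnth s.
have xZ i : u \in valring (x i) /\ ev u Q \in ord_ge (x i) 1.
  by by apply: BZ => /=; apply: (mem_take (n0 := N)); exact: (mem_tnth i s).
have /choice[g gP] : forall i, exists g, [/\ g != 0, 0 < ord (x i) g &
    forall j, j != i -> ord (x j) g < 0].
  move=> i; have /separate_seq[g [g0 gi gs]] : x i \notin rem (x i) s.
    by rewrite mem_rem_uniq // inE /= eqxx.
  exists g; split=> // j ji; apply: gs; rewrite mem_rem_uniq // inE mem_tnth andbT.
  by rewrite /= (inj_eq xinj).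
have [P [[i Pi] Pg]] := lin_dep_primitive utr ud Qirr.1 (fun i => (g i)^-1).
have [gi0 gi gj] := gP i; have [ui Qi] := xZ i.
have [Pi0 oPi] := ev_ord_eq0 Qirr ui Qi Pi.
move: Pg; rewrite (bigD1 i) //=; apply/eqP.
apply: (@ord_addl _ _ (x i) _ _ _ _).1; first by rewrite mulf_neq0 ?invr_eq0.
rewrite ord_mul ?invr_eq0 // oPi ord_inv // add0r.
apply: (@ord_ge_le _ _ _ 1); first by lia.
apply: rpred_sum => j ji; have [gj0 _ gji] := gP j.
rewrite mulrC ord_ge1M ?ev_valring // ord_geE ?invr_eq0 // ord_inv //.
by have := gji i; rewrite eq_sym ji => /(_ isT); lia.
Qed.

Lemma finite_zeros_ev u N Q : transcendental u -> lin_dep u N -> Q != 0 ->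
  finite_set [set x | u \in valring x /\ ev u Q \in ord_ge x 1].
Proof.
move=> utr ud; have [n] := ubnP (size Q); elim: n Q => // n IH Q Qn Q0.
have [Q1|Q1] := leqP (size Q) 1.
  apply: (@sub_finite_set _ _ set0); last exact: finite_set0.
  move=> x /= [ux]; move: Q0; rewrite (size1_polyC Q1) polyC_eq0 => c0.
  by rewrite evC ord_geE ?fmorph_eq0 // ord_const.
have [Qirr|] := pselect (irreducible_poly Q); first exact: finite_zeros_irred ud Qirr.
move=> /not_andP[//|/existsNP[q /not_implyP[q1 /not_implyP[qQ /negP qeq]]]].
have q0 : q != 0 by apply: contraNneq Q0 => q0; rewrite q0 dvd0p in qQ.
have QE : Q = Q %/ q * q by rewrite divpK.
have r0 : Q %/ q != 0 by apply: contraNneq Q0 => r0; rewrite QE r0 mul0r.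
have sq : (size q < size Q)%N.
  by rewrite ltn_neqAle dvdp_leq // andbT dvdp_size_eqp.
have sr : (size (Q %/ q)%R < size Q)%N.
  rewrite size_divp //; move: q0 q1 Q1; rewrite -size_poly_gt0.
  by move: (size (polyseq q)) (size (polyseq Q)) => a b; lia.
have fq := IH _ (leq_trans sq Qn) q0; have fr := IH _ (leq_trans sr Qn) r0.
apply: (@sub_finite_set _ _ (_ `|` _)); last by rewrite finite_setU; split; [exact: fq|exact: fr].
have eq0 := utr _ q0; have er0 := utr _ r0.
have e : ev u Q = ev u (Q %/ q) * ev u q by rewrite -rmorphM -QE.
move=> x /= [ux].
rewrite e ord_geE ?mulf_neq0 // (ord_geE _ _ eq0) (ord_geE _ _ er0) ord_mul //.
have := ev_valring q ux; have := ev_valring (Q %/ q) ux; rewrite (valringE _ eq0) (valringE _ er0).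
have [h1 h2 h3 h4|h1 h2 h3 h4] := ltP 0 (ord x (ev u q)); first by left; split=> //; lia.
by right; split=> //; lia.
Qed.

(** Where u is regular, a zero of f is a zero of the polynomial in u that f divides; u = t and u =
    1/t together cover all places. *)
Lemma finite_zeros f : f != 0 -> finite_set [set x : place X | 0 < ord x f].
Proof.
move=> f0; have [t [N [ttr td]]] := curve_lin_dep X.
have t0 := transcendental_neq0 ttr.
have fz u : transcendental u -> lin_dep u N ->
    finite_set [set x | u \in valring x /\ 0 < ord x f].
  move=> utr ud; have [P [h [P0 Ph hS]]] := algebraic_const_term f0 ud.
  apply: sub_finite_set (finite_zeros_ev utr ud P0) => x /= [ux fx]; split=> //.
  rewrite Ph ord_ge1M //; first by rewrite ord_geE // ; lia.
  by apply: hS => //; [exact: const_valring | rewrite valringE // ltW].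
apply: (@sub_finite_set _ _ (_ `|` _)); last first.
  by rewrite finite_setU; split; [exact: (fz _ ttr td)|
    exact: (fz _ (transcendentalV ttr) (lin_depV ttr td))].
move=> x /= fx; have [tx|/valring_total tx] := boolP (t \in valring x); last by right.
by left.
Qed.

Lemma finite_ord f : f != 0 -> finite_set [set x : place X | ord x f != 0].
Proof.
move=> f0; have fV0 : f^-1 != 0 by rewrite invr_eq0.
apply: (@sub_finite_set _ _ (_ `|` _)); last first.
  by rewrite finite_setU; split; [exact: finite_zeros f0|exact: finite_zeros fV0].
by move=> x /=; rewrite ord_inv // neq_lt oppr_gt0 orbC => /orP.
Qed.

Lemma finite_poles f : finite_set [set x : place X | f \notin valring x].
Proof.
have [->|f0] := eqVneq f 0.
  by apply: (@sub_finite_set _ _ set0); [move=> x /=; rewrite rpred0|exact: finite_set0].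
apply: sub_finite_set (finite_ord f0) => x /=; apply: contraNneq => fx.
by rewrite valringE // fx.
Qed.

End FiniteSupport.

(** * Existence of places *)

Section ValuationRing.
Variables (k : fieldType) (X : curve k).
Local Notation F := (funField X).
Variable R : subringClosed F.
Hypothesis constR : forall c, const X c \in R.
Hypothesis totR : forall z, z \notin R -> z^-1 \in R.
Implicit Types (z w u : F) (P Q : {poly k}).

(** The maximal ideal of R. No condition [z \in R] is required, as by [totR] an element outside R
    has its inverse in R. *)
Let M : {pred F} := fun z => (z == 0) || (z^-1 \notin R).
Let U z := (z \in R) && (z^-1 \in R).

Let ME z : (z \in M) = (z == 0) || (z^-1 \notin R). Proof. by []. Qed.

Let M_R z : z \in M -> z \in R.
Proof.
rewrite ME => /orP[/eqP->|/totR]; first exact: rpred0.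
by rewrite invrK.
Qed.

Let R_MU z : z \in R -> z \notin M -> U z.
Proof. by move=> zR; rewrite ME negb_or negbK /U zR => /andP[]. Qed.

Let U_M z : z != 0 -> U z -> z \notin M.
Proof. by move=> z0 /andP[_ zV]; rewrite ME negb_or negbK z0. Qed.

Let one_M : 1 \notin M.
Proof. by rewrite ME oner_eq0 invr1 rpred1. Qed.

Let MM z w : z \in M -> w \in R -> z * w \in M.
Proof.
have [->|w0] := eqVneq w 0; first by rewrite mulr0 !ME eqxx.
rewrite !ME mulf_eq0 (negbTE w0) orbF => /orP[->//|zV wR].
apply/orP; right; apply: contra zV => zw.
have -> : z^-1 = w * (z * w)^-1 by rewrite invfM mulrCA divff ?mulr1.
exact: rpredM.
Qed.

Let MD z w : z \in M -> w \in M -> z + w \in M.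
Proof.
have wlog z' w' : w' != 0 -> z' / w' \in R -> w' \in M -> z' + w' \in M.
  move=> w0 zw wM; have -> : z' + w' = w' * (z' / w' + 1).
    by rewrite mulrDr mulr1 mulrC divfK.
  by rewrite MM // rpredD ?rpred1.
have [->|z0] := eqVneq z 0; first by rewrite add0r.
have [->|w0] := eqVneq w 0; first by rewrite addr0.
move=> zM wM; have [zw|/totR] := boolP (z / w \in R); first exact: wlog.
by rewrite invf_div addrC => wz; apply: wlog.
Qed.

Let M_sum (I : finType) (p : pred I) (f : I -> F) :
  (forall i, p i -> f i \in M) -> \sum_(i | p i) f i \in M.
Proof. by move=> fM; apply: (big_ind (fun z => z \in M)) => //; rewrite ME eqxx. Qed.

Let UM z w : U z -> U w -> U (z * w).
Proof. by move=> /andP[z1 z2] /andP[w1 w2]; rewrite /U invfM !rpredM. Qed.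

Let UV z : U z -> U z^-1.
Proof. by rewrite /U invrK andbC. Qed.

Let UX z n : U z -> U (z ^+ n).
Proof. by move=> /andP[z1 z2]; rewrite /U -exprVn !rpredX. Qed.

(** Q has least degree among the nonzero polynomials with value in M, that is, it generates the
    trace of M on k[u]: the remainder of P modulo Q would contradict minimality if P(u) were in
    M. *)
Lemma ev_minimal u (P0 : {poly k}) : u \in R -> P0 != 0 -> ev u P0 \in M ->
  exists Q, [/\ Q != 0, (1 < size Q)%N, ev u Q \in M &
    forall P, ~~ (Q %| P) -> U (ev u P)].
Proof.
move=> uR; have evR P : ev u P \in R by apply: ev_closed.
have [n] := ubnP (size P0); elim: n P0 => // n IH Q Qn Q0 QM.
have [[P [P0 PQ PM]]|H] := pselect (exists P, [/\ P != 0, (size P < size Q)%N & ev u P \in M]).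
  by apply: (IH P) => //; apply: leq_trans PQ Qn.
have Q1 : (1 < size Q)%N.
  rewrite ltnNge; apply/negP => sQ.
  have [c Qc] : exists c, Q = c%:P by exists Q`_0; apply: size1_polyC.
  move: QM; rewrite Qc evC; apply/negP; apply: U_M.
    by rewrite fmorph_eq0; apply: contraNneq Q0 => c0; rewrite Qc c0.
  by rewrite /U constR -fmorphV constR.
exists Q; split=> // P QP; apply: R_MU => //; apply/negP => PM.
apply: H; exists (P %% Q); split.
- by rewrite -/(Q %| P).
- by rewrite ltn_modp.
- have -> : P %% Q = P - Q * (P %/ Q) by rewrite {2}(divp_eq P Q) mulrC addrC addKr.
  rewrite rmorphB rmorphM /=; apply: MD => //.
  by rewrite -mulrN MM // rpredN.
Qed.

Variable s : F.
Hypotheses (s0 : s != 0) (sR : s \in R) (sV : s^-1 \notin R).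

Let sM : s \in M. Proof. by rewrite ME sV orbT. Qed.

Let param : exists u N Q, [/\ transcendental u, lin_dep u N, u \in R & [/\
  Q != 0, (1 < size Q)%N, ev u Q \in M & forall P, ~~ (Q %| P) -> U (ev u P)]].
Proof.
have [t [N [ttr td]]] := curve_lin_dep X.
have [u [utr ud uR]] : exists u, [/\ transcendental u, lin_dep u N & u \in R].
  have [tR|/totR tR] := boolP (t \in R); first by exists t.
  by exists t^-1; split=> //; [exact: transcendentalV|exact: lin_depV].
have [P [h [P0 Ph hR]]] := algebraic_const_term s0 ud.
have : ev u P \in M by rewrite Ph MM // hR.
by move=> /(ev_minimal uR P0)[Q QP]; exists u, N, Q.
Qed.

Let dvd_part u Q : (forall P, ~~ (Q %| P) -> U (ev u P)) -> (1 < size Q)%N ->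
  forall P, P != 0 -> exists a v, U v /\ ev u P = ev u Q ^+ a * v.
Proof.
move=> QU Q1 P; have [n] := ubnP (size P); elim: n P => // n IH P Pn P0.
have [/divpK QP|QP] := boolP (Q %| P); last first.
  by exists 0, (ev u P); rewrite expr0 mul1r QU.
have Q0 : Q != 0 by rewrite -size_poly_gt0 (leq_trans _ Q1).
have r0 : P %/ Q != 0 by apply: contraNneq P0 => r0; rewrite -QP r0 mul0r.
have [|a [v [vU e]]] := IH (P %/ Q) _ r0.
  rewrite size_divp //; move: P0 Q1 Pn; rewrite -size_poly_gt0.
  by move: (size (polyseq P)) (size (polyseq Q)) => a b; lia.
by exists a.+1, v; rewrite -{1}QP rmorphM /= e exprSr mulrAC.
Qed.

(* The ideals (w 0), (w 1), ..., (w r), (q) form a strictly decreasing chain, so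
   a dependence relation over k[u] between the w i bounds r. *)
Let chain q r := exists w : nat -> F, [/\ w 0 = 1,
  forall i, w i != 0, forall i, (i < r)%N -> w i.+1 / w i \in M & q / w r \in M].

Let chain_lt (w : nat -> F) r i j : (forall i, w i != 0) ->
  (forall i, (i < r)%N -> w i.+1 / w i \in M) -> (i < j <= r)%N -> w j / w i \in M.
Proof.
move=> w0 wM; elim: j => // j IH; rewrite ltnS => /andP[ij jr].
have -> : w j.+1 / w i = w j.+1 / w j * (w j / w i) by rewrite mulrA divfK.
apply: MM; first exact: wM.
move: ij; rewrite leq_eqVlt => /orP[/eqP->|ij]; first by rewrite divff ?rpred1.
by apply/M_R/IH; rewrite ij ltnW.
Qed.

(** Let i be the first index whose coefficient is prime to Q in the relation. Its term is a unit
    times [w i]; the later terms lie in [w i] M because the chain decreases, the earlier ones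
    because they are divisible by q, which is in [w r] M. This is contradictory. *)
Let chain_bound u N Q r : transcendental u -> lin_dep u N -> u \in R ->
  (1 < size Q)%N -> (forall P, ~~ (Q %| P) -> U (ev u P)) ->
  chain (ev u Q) r -> (r < N)%N.
Proof.
move=> utr ud uR Q1 QU [w [w1 w0 wM qM]]; rewrite ltnNge; apply/negP => Nr.
have evR P : ev u P \in R by apply: ev_closed.
have wlt i j : (i < j <= r)%N -> w j / w i \in M by apply: chain_lt.
have wle i j : (i <= j <= r)%N -> w j / w i \in R.
  rewrite leq_eqVlt andb_orl => /orP[/andP[/eqP-> _]|/wlt/M_R//].
  by rewrite divff ?rpred1.
have [P [[i0 Pi0] Pw]] := lin_dep_primitive utr ud Q1 (fun i : 'I_N => w i).
have [i Pi imin] := @arg_minnP _ i0 (fun i => ~~ (Q %| P i)) val Pi0.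
have ir : (i <= r)%N by apply: leq_trans (ltnW (ltn_ord i)) Nr.
have Pz : ev u (P i) != 0.
  apply: contraNneq Pi => e; rewrite (_ : P i = 0) ?dvdp0 //.
  by apply/eqP; apply: contraTT isT => /utr; rewrite e eqxx.
apply: (negP (U_M Pz (QU _ Pi))).
have -> : ev u (P i) = - \sum_(j < N | j != i) ev u (P j) * w j / w i.
  rewrite -mulr_suml; apply/eqP; rewrite -subr_eq0 opprK.
  rewrite -(inj_eq (mulIf (w0 i))) mul0r mulrDl divfK //.
  by move: Pw; rewrite (bigD1 i) //= => ->.
rewrite -mulN1r mulrC MM ?rpredN1 //.
apply: M_sum => j ji; have jr : (j <= r)%N := leq_trans (ltnW (ltn_ord j)) Nr.
have [ij|] := ltnP i j; first by rewrite -mulrA mulrC MM // wlt // ij.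
rewrite leq_eqVlt (negbTE (ji : val j != val i)) /= => ij.
have QP : Q %| P j by apply: contraLR ij => /imin; rewrite -leqNgt.
have -> : ev u (P j) * w j / w i =
   ev u Q / w r * (w r / w i * (ev u (P j %/ Q) * w j)).
  by rewrite -{1}(divpK QP) rmorphM /=; field; rewrite !w0.
by rewrite MM // rpredM ?wle ?ir ?leqnn //= rpredM // -[w j]divr1 -w1 wle.
Qed.

Let M0V z w : z != 0 -> w != 0 -> z / w \notin R -> w / z \in M.
Proof. by move=> z0 w0 zw; rewrite ME invf_div zw orbT. Qed.

(** For a chain of maximal length, p = q / [w r] generates M. A nonzero z of R is divisible by
    boundedly many powers of p: it divides some P(u) = q^a v with v a unit, and the statement holds
    for q because the powers of p form a chain. *)
Let unif : exists p, [/\ p \in M, p != 0, forall z, z \in M -> z / p \in R &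
  forall z, z \in R -> z != 0 -> exists b, forall n, z / p ^+ n \in R -> (n <= b)%N].
Proof.
have [u [N [Q [utr ud uR [Q0 Q1 QM QU]]]]] := param.
have cb r : chain (ev u Q) r -> (r < N)%N by apply: chain_bound.
have q0 : ev u Q != 0 by apply: utr.
have ex : exists r, `[< chain (ev u Q) r >].
  by exists 0; apply/asboolP; exists (fun=> 1); split=> //; rewrite ?oner_neq0 // divr1.
have bd r : `[< chain (ev u Q) r >] -> (r <= N)%N by move=> /asboolP/cb/ltnW.
have [r /asboolP[w [w1 w0 wM qM]] rmax] := ex_maxnP ex bd.
pose p := ev u Q / w r; have p0 : p != 0 by rewrite mulf_neq0 ?invr_eq0.
have pM z : z \in M -> z / p \in R.
  have [->|z0] := eqVneq z 0; first by rewrite mul0r rpred0.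
  move=> zM; apply: contrapT => /negP/(M0V z0 p0) pz.
  suff : (r.+1 <= r)%N by rewrite ltnn.
  (* If z / p is not in R then p / z is in M, and [w r * z] prolongs the chain. *)
  apply: rmax; apply/asboolP; exists (fun i => if (i <= r)%N then w i else w r * z).
  split=> //; first by move=> i; case: ifP => // _; rewrite mulf_neq0.
    move=> i; rewrite ltnS => ir; rewrite ir; case: ltnP => [|ri]; first exact: wM.
    have -> : i = r by apply/eqP; rewrite eqn_leq ir.
    by rewrite mulrC mulKf.
  by rewrite ltnn invfM mulrA.
have pX n : (0 < n)%N -> ~~ U (p ^+ n).
  move=> n0; have : p ^+ n \in M by case: n n0 => // n _; rewrite exprS MM // rpredX // M_R.
  by apply: contraL; apply: U_M; rewrite expf_neq0.
have pM1 : p \in M by exact: qM.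
clearbody p.
exists p; split=> // z zR z0.
have [P [h [P0 Ph hR]]] := algebraic_const_term z0 ud.
have [a [v [vU e]]] := dvd_part QU Q1 P0.
have qb n : ev u Q / p ^+ n \in R -> (n <= N)%N.
  case: n => // n qn; apply: cb; exists (fun i => p ^+ i); split=> //.
  - by move=> i; rewrite expf_neq0.
  - by move=> i _; rewrite exprS mulfK ?expf_neq0.
  - have -> : ev u Q / p ^+ n = p * (ev u Q / p ^+ n.+1).
      by rewrite exprS; field; rewrite p0 expf_neq0.
    exact: MM.
have [e0 e0R e0max] : exists2 n, ev u Q / p ^+ n \in R & ev u Q / p ^+ n.+1 \notin R.
  have ex' : exists n, ev u Q / p ^+ n \in R by exists 0; rewrite expr0 divr1 M_R.
  have [n nR nmax] := ex_maxnP ex' qb; exists n => //.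
  by apply/negP => /nmax; rewrite ltnn.
have qU : U (ev u Q / p ^+ e0).
  apply: R_MU => //; apply: contra e0max => /pM.
  by rewrite -mulrA -invfM -exprSr.
exists (e0 * a)%N => n nR; rewrite leqNgt; apply/negP => lt.
have := pX (n - e0 * a)%N; rewrite subn_gt0 => /(_ lt)/negP; apply.
have pnR : p ^+ (n - e0 * a) \in R by rewrite rpredX // M_R.
rewrite /U pnR /=.
have hh : h \in R by apply: hR.
have /andP[_ v'] := UM vU (UX a qU).
have -> : (p ^+ (n - e0 * a))^-1 =
    z / p ^+ n * h * (v * (ev u Q / p ^+ e0) ^+ a)^-1.
  have v0 : v != 0 by apply: contraTneq (utr _ P0) => v0; rewrite e v0 mulr0 eqxx.
  have h0 : h != 0 by apply: contraTneq (utr _ P0) => h0; rewrite Ph h0 mulr0 eqxx.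
  have -> : z / p ^+ n * h = ev u Q ^+ a * v / p ^+ n by rewrite -e Ph mulrAC.
  have -> : p ^+ n = p ^+ (n - e0 * a) * (p ^+ e0) ^+ a.
    by rewrite -exprM -exprD subnK // ltnW.
  rewrite exprMn exprVn; have := expf_neq0 a q0; have := expf_neq0 a (expf_neq0 e0 p0).
  have := expf_neq0 (n - e0 * a) p0.
  move: (p ^+ _) ((p ^+ e0) ^+ a) (ev u Q ^+ a) => A B C A0 B0 C0.
  by field; rewrite v0 A0 B0 C0.
by rewrite rpredM // rpredM.
Qed.

(** The order of z is the unique integer n for which z / p^n is a unit of R. *)
Lemma valuation_ring_place : exists x : place X, forall f, (f \in valring x) = (f \in R).
Proof.
have [p [pM p0 pdiv pbd]] := unif.
have expR z : z \in R -> z != 0 -> exists n : nat, U (z / p ^+ n).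
  move=> zR z0; have [b zb] := pbd z zR z0.
  have ex : exists n, z / p ^+ n \in R by exists 0; rewrite expr0 divr1.
  have [n nR nmax] := ex_maxnP ex zb; exists n.
  apply: R_MU => //; apply/negP => /pdiv; rewrite -mulrA -invfM -exprSr => /nmax.
  by rewrite ltnn.
have exU z : exists n : int, z != 0 -> U (z / p ^ n).
  have [->|z0] := eqVneq z 0; first by exists 0.
  have [zR|/totR zR] := boolP (z \in R).
    by have [n zn] := expR z zR z0; exists n.
  have [|n zn] := expR _ zR; first by rewrite invr_eq0.
  exists (- n%:Z) => _; rewrite -exprnN invrK -[_ * _]invrK invfM; exact: UV.
have /choice[o oU] := exU.
have pz0 n : p ^ n != 0 by rewrite expfz_eq0 negb_and p0 orbT.
have pU0 (n : int) : U (p ^ n) -> n = 0.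
  have pX m : ~~ U (p ^+ m.+1).
    have : p ^+ m.+1 \in M by rewrite exprS MM // rpredX // M_R.
    by apply: contraL; apply: U_M; rewrite expf_neq0.
  case: n => [[|m]|m] //; first by rewrite -exprnP (negbTE (pX m)).
  by rewrite NegzE -exprnN => /UV; rewrite invrK (negbTE (pX m)).
have oE z n : z != 0 -> U (z / p ^ n) -> o z = n.
  move=> z0 zn; apply/eqP; rewrite -subr_eq0; apply/eqP/pU0.
  have -> : p ^ (o z - n) = z / p ^ n * (z / p ^ o z)^-1.
    by rewrite expfzDr // -invr_expz; field; rewrite z0 !pz0.
  exact/UM/UV/oU.
have oge z n : z != 0 -> (z / p ^ n \in R) = (n <= o z).
  move=> z0; have /andP[zR zV] := oU z z0.
  have [no|on] := leP n (o z).
    have -> : z / p ^ n = z / p ^ o z * p ^ (o z - n).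
      by rewrite expfzDr // -invr_expz; field; rewrite !pz0.
    rewrite rpredM // -[o z - n]gez0_abs ?subr_ge0 // -exprnP rpredX // M_R //.
  apply/negP => zn.
  have : p ^ (o z - n) \in R.
    have -> : p ^ (o z - n) = z / p ^ n * (z / p ^ o z)^-1.
      by rewrite expfzDr // -invr_expz; field; rewrite z0 !pz0.
    exact: rpredM.
  have -> : p ^ (o z - n) = (p ^+ `|n - o z|%N)^-1.
    by rewrite -[o z - n]opprB -invr_expz exprnP gez0_abs // subr_ge0 ltW.
  move=> H; have := pU0 `|n - o z|%N%:Z; rewrite -exprnP /U H andbT rpredX ?M_R // => /(_ isT).
  by move=> /eqP; rewrite eqz_nat absz_eq0 subr_eq0 => /eqP e; rewrite e ltxx in on.
pose od z := if z == 0 then 0 else o z.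
have odE z : z != 0 -> od z = o z by rewrite /od => /negbTE->.
have od1 : od 0 = 0 by rewrite /od eqxx.
have od2 f g : f != 0 -> g != 0 -> od (f * g) = od f + od g.
  move=> f0 g0; rewrite !odE ?mulf_neq0 //; apply: oE; rewrite ?mulf_neq0 //.
  rewrite expfzDr // invfM mulrACA; apply: UM; exact: oU.
have od3 f g : f != 0 -> g != 0 -> f + g != 0 -> Num.min (od f) (od g) <= od (f + g).
  move=> f0 g0 fg0; rewrite !odE // -oge // mulrDl.
  by rewrite rpredD // oge // ge_min lexx ?orbT.
have od4 c : od (const X c) = 0.
  have [->|c0] := eqVneq c 0; first by rewrite rmorph0.
  rewrite odE ?fmorph_eq0 //; apply: oE; first by rewrite fmorph_eq0.
  by rewrite expr0z divr1 /U -fmorphV !constR.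
have od5 : exists f, od f = 1.
  exists p; rewrite odE //; apply: oE => //.
  by rewrite expr1z divff // /U invr1 rpred1.
exists (Place od1 od2 od3 od4 od5) => f.
have [->|f0] := eqVneq f 0; first by rewrite !rpred0.
by rewrite valringE //= odE // -oge // expr0z divr1.
Qed.

End ValuationRing.

(** * Places whose valuation ring contains a given subring *)

Section PlaceExistence.
Variables (k : fieldType) (X : curve k).
Local Notation F := (funField X).
Variable S : subringClosed F.
Hypothesis constS : forall c, const X c \in S.
Variable s : F.
Hypotheses (s0 : s != 0) (sS : s \in S) (sVS : s^-1 \notin S).

(* Chevalley: a subring containing S that is maximal among those without s^-1
   is a valuation ring. *)
Let maximal_avoiding : exists R : subringClosed F,
  [/\ {subset S <= R}, s^-1 \notin R &
      forall z, z \notin R -> exists2 p, p \is a polyOver R & s^-1 = p.[z]].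
Proof.
pose good (A : set F) := [/\ forall f, f \in S -> A f, ~ A s^-1,
  forall f g, A f -> A g -> A (f - g) & forall f g, A f -> A g -> A (f * g)].
have goodS : good [set f | f \in S].
  by split=> //= [|f g|f g]; [exact/negP|exact: rpredB|exact: rpredM].
have [|A [[A0|Agood] Amax]] := @Zorn_bigcup F [set A | A = set0 \/ good A].
- move=> C Cgood Ctot.
  have [[A [CA Agood]]|H] := pselect (exists A, C A /\ good A); last first.
    left; apply/seteqP; split=> // f [A CA Af].
    by have [A0|Agood] := Cgood A CA; [rewrite A0 in Af|case: H; exists A].
  have Cf B f : C B -> B f -> good B.
    by move=> CB Bf; case: (Cgood B CB) => // B0; rewrite B0 in Bf.
  have up f g : (\bigcup_(B in C) B) f -> (\bigcup_(B in C) B) g ->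
      exists B, [/\ C B, good B, B f & B g].
    move=> [B CB Bf] [D CD Dg]; have [BD|DB] := Ctot B D CB CD.
      by exists D; split=> //; [exact: Cf Dg|exact: BD].
    by exists B; split=> //; [exact: Cf Bf|exact: DB].
  right; split.
  + by move=> f fS; exists A => //; case: Agood => /(_ f fS).
  + by move=> [B CB Bs]; have [_ /(_ Bs)] := Cf B _ CB Bs.
  + move=> f g Cuf Cug; have [B [CB [_ _ BB _] Bf Bg]] := up f g Cuf Cug.
    by exists B => //; apply: BB.
  + move=> f g Cuf Cug; have [B [CB [_ _ _ BM] Bf Bg]] := up f g Cuf Cug.
    by exists B => //; apply: BM.
- case: (Amax [set f | f \in S]); last by right.
  rewrite A0; split; first exact: sub0set.
  by move=> /(_ 1 (rpred1 S)).
have [AS As AB AM] := Agood.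
have Asub : subring_closed (fun f : F => `[< A f >]).
  split; first exact/asboolP/AS/rpred1.
    by move=> f g /asboolP Af /asboolP Ag; apply/asboolP/AB.
  by move=> f g /asboolP Af /asboolP Ag; apply/asboolP/AM.
have [R RE] : exists R : subringClosed F, forall f, f \in R <-> A f.
  pose R : subringClosed F := HB.pack (fun f : F => `[< A f >])
    (GRing.isSubringClosed.Build F _ Asub).
  exists R; by move=> f; split=> [/asboolP|Af]; last exact/asboolP.
exists R; split=> [f /AS/RE//||z zR]; first by apply/negP => /RE.
apply: contrapT => H.
(* R[z] strictly contains R, so if it avoided s^-1 it would contradict maximality. *)
apply: (Amax [set f | exists2 p, p \is a polyOver R & f = p.[z]]).
  split.
    move=> f /RE Rf; exists f%:P; first by rewrite polyOverC.
    by rewrite hornerC.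
  move=> sub; move/negP: zR; apply; apply/RE/sub.
  by exists 'X; [exact: polyOverX|rewrite hornerX].
right; split=> //.
- move=> f /AS/RE fR; exists f%:P; first by rewrite polyOverC.
  by rewrite hornerC.
- move=> _ _ [p pR ->] [q qR ->]; exists (p - q); first exact: rpredB.
  by rewrite hornerD hornerN.
- move=> _ _ [p pR ->] [q qR ->]; exists (p * q); first exact: rpredM.
  by rewrite hornerM.
Qed.

(** If neither z nor 1/z were in R, maximality would write s^-1 as a polynomial over R in each of
    them; the shorter of the two expressions can then be used to shorten the longer, without end. *)
Lemma place_exists : exists x : place X,
  (forall f, f \in S -> f \in valring x) /\ 0 < ord x s.
Proof.
have [R [SR sR ext]] := maximal_avoiding.
(* Otherwise s^-1 is a polynomial in 1/c, with c = 1 - s b. Clearing denominators puts c^n / s in R,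
   and c^n = 1 - s d with d in R, so s^-1 would be in R. *)
have unitR b : b \in R -> (1 - s * b)^-1 \in R.
  move=> bR; apply: contrapT => /negP/ext[p pR e].
  have sR' : s \in R by apply: SR.
  pose c := 1 - s * b; have cR : c \in R by rewrite rpredB ?rpred1 ?rpredM.
  have c0 : c != 0.
    apply: contraNneq sR => /eqP; rewrite subr_eq0 => /eqP e1.
    by rewrite -[s^-1]mulr1 e1 mulKf.
  have [d dR cd] : exists2 d, d \in R & c ^+ size p = 1 - s * d.
    elim: (size p) => [|n [d dR cd]]; first by exists 0; rewrite ?rpred0 // mulr0 subr0.
    exists (b + d - s * b * d); first by rewrite rpredB ?rpredD ?rpredM.
    by rewrite exprS cd /c; ring.
  case/negP: sR; have -> : s^-1 = c ^+ size p * s^-1 + d.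
    by rewrite cd; field.
  rewrite rpredD // e horner_coef mulr_sumr rpred_sum // => i _.
  rewrite mulrCA rpredM //; first exact/polyOverP.
  by rewrite exprVn -exprB ?unitfE // ?rpredX // ltnW.
have totR z : z \notin R -> z^-1 \in R.
  have [->|z0] := eqVneq z 0; first by rewrite rpred0.
  move=> zR; apply: contrapT => /negP zVR.
  (* Multiplying s^-1 = q(1/y) by s y^n gives (1 - s q_0) y^n as a combination of lower powers of y.
     As 1 - s q_0 is a unit of R, the top term of p can be replaced. *)
  have red n (y : F) (p q : {poly F}) : y != 0 -> (size p <= n.+1)%N ->
      (size q <= n.+1)%N -> p \is a polyOver R -> q \is a polyOver R ->
      s^-1 = p.[y] -> s^-1 = q.[y^-1] ->
      exists p' : {poly F}, [/\ (size p' <= n)%N, p' \is a polyOver R & s^-1 = p'.[y]].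
    move=> y0 pn qn pR qR ep eq; have pcR i : p`_i \in R by apply/polyOverP.
    have qcR i : q`_i \in R by apply/polyOverP.
    have sR' : s \in R by apply: SR.
    pose e := (1 - s * q`_0)^-1; have eR : e \in R by apply: unitR.
    have c0 : 1 - s * q`_0 != 0.
      apply: contraNneq sR => /eqP; rewrite subr_eq0 => /eqP e1.
      by rewrite -[s^-1]mulr1 e1 mulKf.
    exists (\poly_(i < n) (p`_i + p`_n * (s * e * q`_(n - i)))).
    split; first exact: size_poly.
      by apply/polyOverP => i; rewrite coef_poly; case: ifP; rewrite ?rpred0 // rpredD ?rpredM.
    have yn : y ^+ n = \sum_(i < n) s * e * q`_(n - i) * y ^+ i.
      apply: (mulfI c0); rewrite mulr_sumr.
      under eq_bigr do rewrite -!mulrA mulrCA [X in _ * X]mulrA divff // mul1r.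
      rewrite -mulr_sumr mulrBl mul1r -mulrA -{1}[y ^+ n]mul1r -{1}(divff s0) -mulrA -mulrBr.
      congr (_ * _); rewrite eq (horner_coef_wide _ qn) big_ord_recl expr0 mulr1 mulrDl addrC addKr.
      rewrite mulr_suml (reindex_inj rev_ord_inj) /=; apply: eq_bigr => i _.
      rewrite /bump /= add1n subnSK // -mulrA; congr (_ * _).
      have -> : y ^+ n = y ^+ (n - i) * y ^+ i by rewrite -exprD subnK // ltnW.
      by rewrite exprVn mulKf ?expf_neq0.
    rewrite horner_poly ep (horner_coef_wide _ pn) big_ord_recr /= yn mulr_sumr -big_split /=.
    by apply: eq_bigr => i _; rewrite mulrDl !mulrA.
  have [p pR ep] := ext _ zR; have [q qR eq] := ext _ zVR.
  have [N] := ubnP (size p + size q)%N.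
  elim: N z z0 zR zVR p q pR qR ep eq => // N IH z z0 zR zVR p q pR qR ep eq lN.
  wlog pq : z z0 zR zVR p q pR qR ep eq lN / (size q <= size p)%N.
    have [pq|/ltnW pq] := leqP (size q) (size p); first by move=> H; apply: (H z z0 _ _ p q).
    by move=> H; apply: (H z^-1 _ _ _ q p); rewrite ?invrK ?invr_eq0 // addnC.
  have : (0 < size p)%N.
    rewrite size_poly_gt0; apply: contraTneq isT => p0; move/eqP: ep.
    by rewrite p0 horner0 invr_eq0 (negbTE s0).
  case sp: (size p) pq lN => [//|n] qn lN _.
  have [|p' [pn' pR' ep']] := red n z p q z0 _ qn pR qR ep eq; first by rewrite sp.
  apply: (IH z z0 zR zVR p' q) => //; move: lN.
  by rewrite addSn ltnS; apply: leq_ltn_trans; rewrite leq_add2r.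
have [x xR] := valuation_ring_place (R := R) (fun c => SR _ (constS c)) totR s0 (SR _ sS) sR.
exists x; split=> [f /SR|]; first by rewrite xR.
by move: sR; rewrite -xR valringE ?invr_eq0 // ord_inv // oppr_ge0 -ltNge.
Qed.

End PlaceExistence.

(** * Extension of scalars *)

Section BaseChangeTheory.
Variables (k k' : fieldType) (i : {rmorphism k -> k'}).
Variables (X : curve k) (X' : curve k') (p : base_change i X X').
Local Notation F := (funField X).
Local Notation F' := (funField X').
Local Notation cX := (const X').

Definition lin_indep n (c : 'I_n -> k') := forall b : 'I_n -> k,
  \sum_j i (b j) * c j = 0 -> forall j, b j = 0.

Lemma bc_const c : p (const X c) = cX (i c).
Proof. by case: p => f [/= H _ _]; apply: H. Qed.

Lemma bc_span z : exists n (a : 'I_n -> F) (c : 'I_n -> k'),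
  z = \sum_j p (a j) * cX (c j).
Proof. by case: p => f [/= _ H _]; apply: H. Qed.

Lemma bc_free n (c : 'I_n -> k') : lin_indep c -> forall a : 'I_n -> F,
  \sum_j p (a j) * cX (c j) = 0 -> forall j, a j = 0.
Proof. by case: p => f [/= _ _ H]; apply: H. Qed.

(** A finite substitute for a basis of k' over k: an element is added to the free family only when
    it is not yet in its span. *)
Lemma lin_indep_basis n (c : 'I_n -> k') :
  exists r (d : 'I_r -> k') (B : 'I_n -> 'I_r -> k),
    lin_indep d /\ forall j, c j = \sum_l i (B j l) * d l.
Proof.
elim: n c => [|n IH] c.
  exists 0, (fun=> 0), (fun _ _ => 0); split; first by move=> b _ [].
  by case.
have [r [d [B [dfree cB]]]] := IH (fun j => c (lift ord0 j)).
have [[b cb]|nb] := pselect (exists b : 'I_r -> k, c ord0 = \sum_l i (b l) * d l).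
  exists r, d, (fun j => oapp B b (unlift ord0 j)); split=> // j.
  by case: unliftP => [j' ->|->].
exists r.+1, (fun l => oapp d (c ord0) (unlift ord0 l)).
exists (fun j => oapp (fun j' l => oapp (B j') 0 (unlift ord0 l))
   (fun l => (l == ord0)%:R) (unlift ord0 j)); split.
  move=> b; rewrite big_ord_recl unlift_none /=.
  under eq_bigr do rewrite liftK /=.
  have [b0|b0] := eqVneq (b ord0) 0.
    rewrite b0 rmorph0 mul0r add0r => /dfree e j.
    by case: (unliftP ord0 j) => [j' ->|->].
  move=> /eqP; rewrite addr_eq0 => /eqP e; case: nb.
  exists (fun l => - b (lift ord0 l) / b ord0).
  apply: (mulfI (_ : i (b ord0) != 0)); first by rewrite fmorph_eq0.
  rewrite e mulr_sumr -sumrN; apply: eq_bigr => l _.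
  by rewrite rmorphM rmorphN fmorphV; field; rewrite fmorph_eq0.
move=> j; rewrite big_ord_recl unlift_none /=.
under [X in _ + X]eq_bigr do rewrite liftK /=.
case: unliftP => [j' ->|->] /=; first by rewrite ?unlift_none /= rmorph0 mul0r add0r cB; apply:
  eq_bigr => l _; rewrite ?liftK.
rewrite ?eqxx rmorph1 mul1r big1 ?addr0 // => l _.
by rewrite ?lift_eqF rmorph0 mul0r.
Qed.

Lemma bc_relation n (a : 'I_n -> F) (c : 'I_n -> k') r (d : 'I_r -> k')
    (B : 'I_n -> 'I_r -> k) : lin_indep d ->
  (forall j, c j = \sum_l i (B j l) * d l) ->
  \sum_j p (a j) * cX (c j) = 0 -> forall l, \sum_j a j * const X (B j l) = 0.
Proof.
move=> dfree cB ac0; apply: (bc_free dfree); rewrite -[RHS]ac0.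
under eq_bigr do rewrite rmorph_sum mulr_suml.
rewrite exchange_big; apply: eq_bigr => j _ /=.
rewrite cB rmorph_sum mulr_sumr; apply: eq_bigr => l _.
by rewrite !rmorphM bc_const mulrA.
Qed.

(** If r were not in k, then r and 1 would be independent over k, and -r + f = 0 would be a relation
    over F. *)
Lemma bc_const_inter f r : p f = cX r -> exists b, f = const X b /\ r = i b.
Proof.
move=> fr; have [[b rb]|nb] := pselect (exists b, r = i b).
  exists b; split=> //; apply: (fmorph_inj p); by rewrite bc_const -rb.
pose c (j : 'I_2) := if val j == 0 then r else 1.
have cfree : lin_indep c.
  move=> b; rewrite !big_ord_recl big_ord0 /c /= addr0 mulr1.
  have [b0|b0] := eqVneq (b ord0) 0.
    rewrite b0 rmorph0 mul0r add0r => /eqP; rewrite fmorph_eq0 => /eqP b1 j.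
    by case: (unliftP ord0 j) => [j' ->|->//]; rewrite ord1.
  move=> /eqP; rewrite addr_eq0 => /eqP e; case: nb.
  exists (- b (lift ord0 ord0) / b ord0).
  apply: (mulfI (_ : i (b ord0) != 0)); first by rewrite fmorph_eq0.
  by rewrite e rmorphM rmorphN fmorphV; field; rewrite fmorph_eq0.
have := bc_free cfree (a := fun j : 'I_2 => if val j == 0 then - 1 else f).
rewrite !big_ord_recl big_ord0 /c /= addr0 rmorph1 mulr1 rmorphN rmorph1 fr.
by rewrite mulN1r addNr => /(_ erefl ord0) /= /eqP; rewrite oppr_eq0 oner_eq0.
Qed.

Lemma lies_overE (y : place X') (x : place X) f : lies_over p y x ->
  (p f \in valring y) = (f \in valring x).
Proof. exact. Qed.

Lemma lies_over_inj (y : place X') (x x' : place X) :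
  lies_over p y x -> lies_over p y x' -> x = x'.
Proof. by move=> yx yx'; apply: place_incl => f; rewrite -(lies_overE f yx) -(lies_overE f
  yx'). Qed.

(** The restriction of [ord y] to F, divided by its least positive value e. It is not trivial on F:
    otherwise all of F', being spanned by F and k', would be regular at y. *)
Lemma lies_over_exists (y : place X') : exists x, lies_over p y x.
Proof.
have [f0 f0y] : exists f, ord y (p f) != 0.
  apply: contrapT => /forallNP H; have [u uy] := ord_unif y.
  have : u^-1 \in valring y.
    have [n [a [c ->]]] := bc_span u^-1; rewrite rpred_sum // => j _.
    rewrite rpredM ?const_valring //; have [->|a0] := eqVneq (a j) 0.
      by rewrite rmorph0 rpred0.
    by rewrite valringE ?fmorph_eq0 //; have := H (a j) => /negP; rewrite negbK => /eqP->.
  have u0 := unif_neq0 uy.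
  by rewrite valringE ?invr_eq0 // ord_inv // uy.
have nz f : ord y (p f) != 0 -> f != 0.
  by apply: contra_neq => ->; rewrite rmorph0 ord_zero.
have ex : exists n, (0 < n)%N && `[< exists f, ord y (p f) = n%:Z >].
  exists `|ord y (p f0)|%N; rewrite absz_gt0 f0y; apply/asboolP.
  have [h|h] := ger0P (ord y (p f0)); first by exists f0; rewrite gez0_abs.
  by exists f0^-1; rewrite fmorphV ord_inv ?fmorph_eq0 ?nz // ltz0_abs.
have [e /andP[e0 /asboolP[g ge]] emin] := ex_minnP ex.
have g0 : g != 0 by apply: nz; rewrite ge; lia.
have dvd f : exists m : int, ord y (p f) = m * e%:Z.
  have [->|f_0] := eqVneq f 0; first by exists 0; rewrite rmorph0 ord_zero mul0r.
  exists (ord y (p f) %/ e)%Z.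
  have em := divz_eq (ord y (p f)) e; set m := (_ %/ _)%Z in em *.
  suff r0 : (ord y (p f) %% e)%Z = 0 by rewrite {1}em r0 addr0.
  have gm : g ^ m != 0 by rewrite expfz_eq0 negb_and g0 orbT.
  have rE : ord y (p (f / g ^ m)) = (ord y (p f) %% e)%Z.
    rewrite fmorph_div ord_div ?fmorph_eq0 // rmorphXz ?unitfE // ordXz ?fmorph_eq0 // ge.
    by rewrite {1}em addrC addKr.
  have r_ge : 0 <= (ord y (p f) %% e)%Z by rewrite modz_ge0 //; lia.
  have r_lt : (ord y (p f) %% e)%Z < e by rewrite ltz_pmod.
  apply/eqP; apply: contraTT r_lt => r0; rewrite -leNgt.
  have := emin `|(ord y (p f) %% e)%Z|%N; rewrite absz_gt0 r0 -lez_nat gez0_abs // => -> //.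
  by apply/asboolP; exists (f / g ^ m).
have /choice[o oE] := dvd.
have e0Z : (e%:Z : int) != 0 by lia.
have epos : 0 < (e%:Z : int) by lia.
have od1 : o 0 = 0 by apply: (mulIf e0Z); rewrite -oE rmorph0 ord_zero mul0r.
have od2 f h : f != 0 -> h != 0 -> o (f * h) = o f + o h.
  move=> f_0 h_0; apply: (mulIf e0Z).
  by rewrite mulrDl -!oE rmorphM ord_mul ?fmorph_eq0.
have od3 f h : f != 0 -> h != 0 -> f + h != 0 -> Num.min (o f) (o h) <= o (f + h).
  move=> f_0 h_0 fh0.
  have := @ord_add _ _ y (p f) (p h); rewrite -rmorphD !fmorph_eq0 !oE.
  by move=> /(_ f_0 h_0 fh0); rewrite !ge_min !ler_pM2r.
have od4 c : o (const X c) = 0.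
  by apply: (mulIf e0Z); rewrite -oE bc_const ord_const mul0r.
have od5 : exists f, o f = 1 by exists g; apply: (mulIf e0Z); rewrite -oE mul1r.
exists (Place od1 od2 od3 od4 od5) => f.
by rewrite /regular_at fmorph_eq0 /= oE pmulr_lge0.
Qed.

Lemma ramification (y : place X') (x : place X) f u : lies_over p y x ->
  ord x u = 1 -> ord y (p f) = ord y (p u) * ord x f.
Proof.
move=> yx ux; have u0 := unif_neq0 ux.
have [->|f0] := eqVneq f 0; first by rewrite rmorph0 !ord_zero mulr0.
pose g := f / u ^ ord x f.
have ue0 : u ^ ord x f != 0 by rewrite expfz_eq0 negb_and u0 orbT.
have g0 : g != 0 by rewrite mulf_neq0 ?invr_eq0.
have gx : ord x g = 0 by rewrite ord_div // ordXz // ux mulr1 subrr.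
have : ord y (p g) = 0.
  by apply: ord_eq0; rewrite -?fmorphV (lies_overE _ yx) valringE ?invr_eq0 // ?ord_inv // gx.
rewrite fmorph_div ord_div ?fmorph_eq0 // rmorphXz ?unitfE // ordXz ?fmorph_eq0 //.
by move=> /eqP; rewrite subr_eq0 mulrC => /eqP.
Qed.

Definition under (y : place X') : place X := projT1 (cid (lies_over_exists y)).

Lemma underP y : lies_over p y (under y).
Proof. by rewrite /under; case: cid. Qed.

Lemma lies_over_under y x : lies_over p y x <-> under y = x.
Proof.
split=> [yx|<-]; last exact: underP.
exact: lies_over_inj (underP y) yx.
Qed.

Lemma under_valring y f : (p f \in valring y) = (f \in valring (under y)).
Proof. exact: lies_overE (underP y). Qed.

(** A uniformiser at x has nonzero order at every place above x. *)
Lemma bc_finite_over (x : place X) : finite_set [set y | under y = x].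
Proof.
have [u ux] := ord_unif x.
have pu0 : p u != 0 by rewrite fmorph_eq0 (unif_neq0 ux).
apply: sub_finite_set (finite_ord pu0) => y /= yx.
apply: contra_eq_neq ux => e; apply/negP => /eqP ux.
have : u^-1 \in valring x.
  by rewrite -yx -under_valring fmorphV valringE ?invr_eq0 // ord_inv // e oppr0.
by rewrite valringE ?invr_eq0 ?(unif_neq0 ux) // ord_inv ?(unif_neq0 ux) // ux.
Qed.

(** The image in F' of the tensor product over k of the local ring at x and k'. *)
Let integral_span x : {pred F'} := fun z => `[< exists n (a : 'I_n -> F) (c : 'I_n -> k'),
  (forall j, a j \in valring x) /\ z = \sum_j p (a j) * cX (c j) >].

Let integral_span0 x : 0 \in integral_span x.
Proof. by apply/asboolP; exists 0, (fun=> 0), (fun=> 0); split=> [[]//|]; rewrite big_ord0. Qed.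

Let integral_spanD x z w : z \in integral_span x -> w \in integral_span x ->
  z + w \in integral_span x.
Proof.
move=> /asboolP[n [a [c [ax ->]]]] /asboolP[m [b [d [bx ->]]]]; apply/asboolP.
exists (n + m)%N, (fun j => match fintype.split j with inl l => a l | inr l => b l end),
  (fun j => match fintype.split j with inl l => c l | inr l => d l end).
split=> [j|]; first by case: fintype.split.
rewrite big_split_ord; congr (_ + _); apply: eq_bigr => j _.
  by case: splitP => l /= e; [congr (p (a _) * cX (c _)); apply: val_inj|have := ltn_ord j;
    rewrite e ltnNge leq_addr].
case: splitP => l /= e; first by have := ltn_ord l; rewrite -e ltnNge leq_addr.
by congr (p (b _) * cX (d _)); apply/val_inj/(@addnI n).
Qed.

Let integral_span_scale x f c z : f \in valring x -> z \in integral_span x ->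
  p f * cX c * z \in integral_span x.
Proof.
move=> fx /asboolP[n [a [d [ax ->]]]]; apply/asboolP.
exists n, (fun j => f * a j), (fun j => c * d j); split=> [j|]; first exact: rpredM.
by rewrite mulr_sumr; apply: eq_bigr => j _; rewrite !rmorphM mulrACA.
Qed.

Let integral_span_ring x : subring_closed (integral_span x).
Proof.
have N z : z \in integral_span x -> - z \in integral_span x.
  move=> zx; have -> : - z = p (-1) * cX 1 * z by rewrite !rmorphN !rmorph1; ring.
  by apply: integral_span_scale => //; rewrite rpredN1.
split.
- apply/asboolP; exists 1, (fun=> 1), (fun=> 1); split=> [_|]; first exact: rpred1.
  by rewrite big_ord1 !rmorph1 mulr1.
- by move=> z w zx wx; apply: integral_spanD => //; apply: N.
- move=> z w /asboolP[n [a [c [ax ->]]]] wx; rewrite mulr_suml.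
  apply: (big_ind (fun z => z \in integral_span x)); first exact: integral_span0.
    exact: integral_spanD.
  by move=> j _; apply: integral_span_scale.
Qed.

(** A uniformiser u at x is not invertible in S, the local ring tensored with k', so some place is
    regular on S and positive at u. The place of F under it is regular on the local ring at x, hence
    equal to x. *)
Lemma over_exists (x : place X) : exists y, under y = x.
Proof.
pose S : subringClosed F' := HB.pack (integral_span x)
  (GRing.isSubringClosed.Build F' _ (integral_span_ring x)).
have [u ux] := ord_unif x; have u0 := unif_neq0 ux.
have pS f : f \in valring x -> p f \in S.
  move=> fx; apply/asboolP; exists 1, (fun=> f), (fun=> 1); split=> [//|].
  by rewrite big_ord1 rmorph1 mulr1.
have cS c : cX c \in S.
  apply/asboolP; exists 1, (fun=> 1), (fun=> c); split=> [_|]; first exact: rpred1.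
  by rewrite big_ord1 rmorph1 mul1r.
have uS : (p u)^-1 \notin S.
  apply/negP => /asboolP[n [a [c [ax e]]]].
  (* The constant 1 joins the c_j: in a coordinate where 1 does not vanish, the expansion of u^-1
     shows that u^-1 is regular at x. *)
  have [r [d [B [dfree cB]]]] := lin_indep_basis (fun j => oapp c 1 (unlift ord0 j)).
  have rel := @bc_relation _ (fun j => oapp (fun l => - a l) u^-1 (unlift ord0 j)) _ _ _ _ dfree cB.
  have {rel} rel l : u^-1 * const X (B ord0 l) = \sum_j a j * const X (B (lift ord0 j) l).
    move: rel; rewrite big_ord_recl unlift_none /= rmorph1 mulr1 fmorphV e.
    under [in X in _ + X]eq_bigr do rewrite liftK /= rmorphN mulNr.
    rewrite sumrN subrr => /(_ erefl l); rewrite big_ord_recl unlift_none /=.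
    under eq_bigr do rewrite liftK /= mulNr.
    by rewrite sumrN => /eqP; rewrite subr_eq0 => /eqP.
  have [l Bl] : exists l, B ord0 l != 0.
    apply: contrapT => /forallNP B0; have := cB ord0; rewrite unlift_none /= big1.
      by move/eqP; rewrite oner_eq0.
    by move=> l _; have /negP := B0 l; rewrite negbK => /eqP->; rewrite rmorph0 mul0r.
  have : u^-1 \in valring x.
    have cB0 : const X (B ord0 l) != 0 by rewrite fmorph_eq0.
    rewrite -[u^-1](mulfK cB0) rel -fmorphV rpredM ?const_valring //.
    by rewrite rpred_sum // => j _; rewrite rpredM ?const_valring.
  by rewrite valringE ?invr_eq0 // ord_inv // ux.
have pu0 : p u != 0 by rewrite fmorph_eq0.
have uSx : p u \in S by apply: pS; rewrite valringE // ux.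
have [y [yS uy]] := place_exists cS pu0 uSx uS.
exists y; apply/esym/place_incl => f fx; rewrite -under_valring.
exact/yS/pS.
Qed.

End BaseChangeTheory.

(** * Automorphisms of the constants and descent of integrality *)

Section ScalarAutomorphism.
Variables (k k' : fieldType) (i : {rmorphism k -> k'}).
Variables (X : curve k) (X' : curve k') (p : base_change i X X').
Local Notation F := (funField X).
Local Notation F' := (funField X').
Local Notation cX := (const X').
Variable theta : {rmorphism k' -> k'}.
Hypothesis theta_i : forall b, theta (i b) = i b.

(** This makes the map id (x) theta on F' well defined. In terms of a family free over k, a relation
    amounts to relations with coefficients in k, which theta fixes. *)
Let theta_zero n (a : 'I_n -> F) (c : 'I_n -> k') :
  \sum_j p (a j) * cX (c j) = 0 -> \sum_j p (a j) * cX (theta (c j)) = 0.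
Proof.
move=> ac0; have [r [d [B [dfree cB]]]] := lin_indep_basis i c.
have rel := bc_relation dfree cB ac0.
under eq_bigr do rewrite cB !rmorph_sum mulr_sumr.
rewrite exchange_big big1 //= => l _.
under eq_bigr do rewrite !rmorphM theta_i -(bc_const p) mulrA -rmorphM /=.
by rewrite -mulr_suml -rmorph_sum rel rmorph0 mul0r.
Qed.

Let catf T n m (a : 'I_n -> T) (b : 'I_m -> T) (j : 'I_(n + m)) :=
  match fintype.split j with inl l => a l | inr l => b l end.

Let catfl T n m (a : 'I_n -> T) (b : 'I_m -> T) l : catf a b (lshift m l) = a l.
Proof. by rewrite /catf -[lshift m l]/(unsplit (inl l)) unsplitK. Qed.
Let catfr T n m (a : 'I_n -> T) (b : 'I_m -> T) l : catf a b (rshift n l) = b l.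
Proof. by rewrite /catf -[rshift n l]/(unsplit (inr l)) unsplitK. Qed.

Let cat_sum (f : k' -> k') n m (a : 'I_n -> F) (b : 'I_m -> F) c d :
  \sum_j p (catf a b j) * cX (f (catf c d j)) =
  \sum_j p (a j) * cX (f (c j)) + \sum_j p (b j) * cX (f (d j)).
Proof.
by rewrite big_split_ord; congr (_ + _); apply: eq_bigr => j _;
  rewrite ?catfl ?catfr.
Qed.

Let theta_eq n m (a : 'I_n -> F) (b : 'I_m -> F) c d :
  \sum_j p (a j) * cX (c j) = \sum_j p (b j) * cX (d j) ->
  \sum_j p (a j) * cX (theta (c j)) = \sum_j p (b j) * cX (theta (d j)).
Proof.
move=> e; apply/eqP; rewrite -subr_eq0 -sumrN; apply/eqP.
have := @theta_zero _ (catf a (fun j => - b j)) (catf c d).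
rewrite (cat_sum theta) (cat_sum id) e => H.
rewrite -[RHS]H; first by congr (_ + _); apply: eq_bigr => j _; rewrite rmorphN mulNr.
by rewrite -big_split big1 //= => j _; rewrite rmorphN mulNr subrr.
Qed.

Lemma scalar_extension_exists : exists phi : {rmorphism F' -> F'},
  (forall f, phi (p f) = p f) /\ (forall c, phi (cX c) = cX (theta c)).
Proof.
have /choice[phi phiE] : forall z, exists w, forall n (a : 'I_n -> F) c,
    z = \sum_j p (a j) * cX (c j) -> w = \sum_j p (a j) * cX (theta (c j)).
  move=> z; have [n [a [c zE]]] := bc_span p z.
  by exists (\sum_j p (a j) * cX (theta (c j))) => m b d; rewrite zE; apply: theta_eq.
have phiD z w : phi (z + w) = phi z + phi w.
  have [n [a [c zE]]] := bc_span p z; have [m [b [d wE]]] := bc_span p w.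
  rewrite (phiE _ _ _ _ zE) (phiE _ _ _ _ wE) -(cat_sum theta).
  by apply: phiE; rewrite (cat_sum id) zE wE.
have phi1 f c : phi (p f * cX c) = p f * cX (theta c).
  by rewrite (phiE _ 1 (fun=> f) (fun=> c)) ?big_ord1.
have phi0 : phi 0 = 0.
  by rewrite (phiE _ 0 (fun=> 0) (fun=> 0)) ?big_ord0.
have phi_sum n (f : 'I_n -> F') : phi (\sum_j f j) = \sum_j phi (f j).
  exact: (big_morph _ phiD phi0).
have phiM z w : phi (z * w) = phi z * phi w.
  have [n [a [c zE]]] := bc_span p z; have [m [b [d wE]]] := bc_span p w.
  rewrite zE wE mulr_suml !phi_sum mulr_suml; apply: eq_bigr => j _.
  rewrite !mulr_sumr phi_sum; apply: eq_bigr => l _.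
  by rewrite mulrACA -!rmorphM phi1 !phi1 /= [in LHS]rmorphM [in LHS]rmorphM [in LHS]rmorphM
    mulrACA.
have phi_1 : phi 1 = 1.
  by have := phi1 1 1; rewrite !rmorph1 mulr1.
have phiN z : phi (- z) = - phi z.
  by apply/eqP; rewrite -addr_eq0 -phiD addNr phi0.
have phiB : zmod_morphism phi by move=> z w; rewrite phiD phiN.
have phiR : monoid_morphism phi by split.
pose ph : {rmorphism F' -> F'} := HB.pack phi
  (GRing.isZmodMorphism.Build F' F' phi phiB) (GRing.isMonoidMorphism.Build F' F' phi phiR).
exists ph; split=> [f|c].
  by have := phi1 f 1; rewrite !rmorph1 !mulr1.
by have := phi1 1 c; rewrite !rmorph1 !mul1r.
Qed.

Variable phi : {rmorphism F' -> F'}.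
Hypothesis phi_p : forall f, phi (p f) = p f.
Hypothesis phi_c : forall c, phi (cX c) = cX (theta c).
Hypothesis theta_surj : forall c, exists d, theta d = c.

Lemma scalar_extension_surj z : exists w, phi w = z.
Proof.
have /choice[eta etaK] := theta_surj; have [n [a [c ->]]] := bc_span p z.
exists (\sum_j p (a j) * cX (eta (c j))); rewrite rmorph_sum.
by apply: eq_bigr => j _; rewrite rmorphM phi_p phi_c etaK.
Qed.

(** Surjectivity of phi keeps the composite valuation normalised. *)
Lemma twist_exists (y : place X') : exists y' : place X', forall f, ord y' f = ord y (phi f).
Proof.
pose o f := ord y (phi f).
have od1 : o 0 = 0 by rewrite /o rmorph0 ord_zero.
have od2 f h : f != 0 -> h != 0 -> o (f * h) = o f + o h.
  by move=> f_0 h_0; rewrite /o rmorphM ord_mul ?fmorph_eq0.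
have od3 f h : f != 0 -> h != 0 -> f + h != 0 -> Num.min (o f) (o h) <= o (f + h).
  by move=> f0 h0 fh0; rewrite /o rmorphD ord_add -?rmorphD ?fmorph_eq0.
have od4 c : o (cX c) = 0 by rewrite /o phi_c ord_const.
have od5 : exists f, o f = 1.
  by have [u uy] := ord_unif y; have [v vu] := scalar_extension_surj u; exists v; rewrite /o vu.
by exists (Place od1 od2 od3 od4 od5).
Qed.

Definition twist (y : place X') : place X' := projT1 (cid (twist_exists y)).

Lemma twistE y f : ord (twist y) f = ord y (phi f).
Proof. by rewrite /twist; case: cid. Qed.

Lemma twist_valring y f : (f \in valring (twist y)) = (phi f \in valring y).
Proof. by rewrite !unfold_in /regular_at fmorph_eq0 twistE. Qed.

Lemma under_twist y : under p (twist y) = under p y.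
Proof.
apply/lies_over_under => f.
by rewrite -!/(valring _ _) -[LHS]/(p f \in valring _) twist_valring phi_p under_valring.
Qed.

Hypothesis theta_fixed : forall c, theta c = c -> exists b, c = i b.

(* Dividing by the last coefficient makes it 1; then phi(g) - g no longer
   involves the last term, and its coefficients are still independent because
   the fixed points of theta are the scalars of k. *)
Lemma integral_descent (x : place X) n (a : 'I_n -> F) (c : 'I_n -> k') :
  lin_indep i c ->
  (forall y, under p y = x -> \sum_j p (a j) * cX (c j) \in valring y) ->
  forall j, a j \in valring x.
Proof.
elim: n a c => [|n IH] a c cfree reg; first by case.
pose d := c ord_max.
have d0 : d != 0.
  apply/eqP => d0; have := cfree (fun j => (j == ord_max)%:R).
  rewrite (bigD1 ord_max) //= -/d d0 mulr0 add0r big1 => [|j /negbTE->]; last first.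
    by rewrite rmorph0 mul0r.
  by move=> /(_ erefl ord_max) /eqP; rewrite eqxx oner_eq0.
pose e (j : 'I_n) := c (widen_ord (leqnSn n) j) / d.
pose f (j : 'I_n) := a (widen_ord (leqnSn n) j).
pose g := \sum_j p (f j) * cX (e j) + p (a ord_max).
have greg y : under p y = x -> g \in valring y.
  move=> yx; have -> : g = (\sum_j p (a j) * cX (c j)) * cX d^-1.
    rewrite big_ord_recr /= mulrDl mulr_suml -/d; congr (_ + _).
      by apply: eq_bigr => j _; rewrite rmorphM mulrA.
    by rewrite -mulrA -rmorphM divff // rmorph1 mulr1.
  by rewrite rpredM ?const_valring ?reg.
have phig : phi g - g = \sum_j p (f j) * cX (theta (e j) - e j).
  rewrite /g rmorphD rmorph_sum phi_p opprD addrACA subrr addr0 -sumrB.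
  by apply: eq_bigr => j _; rewrite rmorphM phi_p phi_c -mulrBr rmorphB.
have fx : forall j, f j \in valring x.
  apply: (IH f (fun j => theta (e j) - e j)).
    move=> b be0; pose w := \sum_j i (b j) * e j.
    have /theta_fixed[b' wb'] : theta w = w.
      apply/eqP; rewrite -subr_eq0 /w rmorph_sum -sumrB; apply/eqP.
      rewrite -[RHS]be0; apply: eq_bigr => j _.
      by rewrite rmorphM theta_i -mulrBr.
    have := cfree (fun j => oapp b (- b') (unlift ord_max j)).
    rewrite big_ord_recr /= unlift_none /= -/d.
    rewrite (eq_bigr (fun j => i (b j) * e j * d)) => [|j _].
      rewrite -mulr_suml -/w wb' rmorphN mulNr subrr => /(_ erefl) H j.
      have := H (lift ord_max j); by rewrite liftK.
    have -> : widen_ord (leqnSn n) j = lift ord_max j.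
      by apply: val_inj; rewrite /= /bump leqNgt ltn_ord.
    rewrite liftK /= -mulrA /e divfK //; congr (_ * c _).
    by apply: val_inj; rewrite /= /bump leqNgt ltn_ord.
  (* phi(g) is regular at y because g is regular at the twist of y, which also lies above x. *)
  move=> y yx; rewrite -phig rpredB ?greg // -twist_valring.
  by apply: greg; rewrite under_twist.
move=> j; have [j' ->|->] := unliftP ord_max j.
  have <- : widen_ord (leqnSn n) j' = lift ord_max j'.
    by apply: val_inj; rewrite /= /bump leqNgt ltn_ord.
  exact: fx.
have [y yx] := over_exists p x; rewrite -yx -under_valring.
have -> : p (a ord_max) = g - \sum_j p (f j) * cX (e j) by rewrite /g addrC addKr.
rewrite rpredB ?greg // rpred_sum // => l _.
by rewrite rpredM ?const_valring // under_valring yx.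
Qed.

End ScalarAutomorphism.

(** * Regular functions are constant *)

Section Constants.
Variables (k : fieldType) (X : curve k).
Local Notation F := (funField X).

(** In k[1/f] the element 1/f is not invertible, so a place regular on this ring vanishes at 1/f. *)
Lemma transcendental_pole (f : F) : transcendental f -> exists x : place X, f \notin valring x.
Proof.
move=> ftr; have f0 := transcendental_neq0 ftr; have utr := transcendentalV ftr.
pose u := f^-1; pose T : {pred F} := fun z => `[< exists P, z = ev u P >].
have Tring : subring_closed T.
  split; first by apply/asboolP; exists 1; rewrite rmorph1.
    by move=> _ _ /asboolP[P ->] /asboolP[Q ->]; apply/asboolP; exists (P - Q); rewrite rmorphB.
  by move=> _ _ /asboolP[P ->] /asboolP[Q ->]; apply/asboolP; exists (P * Q); rewrite rmorphM.
pose S : subringClosed F := HB.pack T (GRing.isSubringClosed.Build F _ Tring).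
have cS c : const X c \in S by apply/asboolP; exists c%:P; rewrite evC.
have uS : u \in S by apply/asboolP; exists 'X; rewrite evX.
have u0 : u != 0 by rewrite invr_eq0.
have uVS : u^-1 \notin S.
  apply/negP => /asboolP[P e].
  have : ev u ('X * P - 1) == 0 by rewrite rmorphB rmorphM rmorph1 /= evX -e divff // subrr.
  apply/negP/utr; rewrite subr_eq0; apply: contraNneq (oner_neq0 k) => XP.
  by move/(congr1 (fun P : {poly k} => P.[0])): XP; rewrite hornerM hornerX mul0r -polyC1
    hornerC => <-.
have [x [_ ux]] := place_exists cS u0 uS uVS; exists x.
by move: ux; rewrite ord_inv // valringE // oppr_gt0 -ltNge.
Qed.

Variables (kbar : closedFieldType) (ibar : {rmorphism k -> kbar}).
Variables (Xbar : curve kbar) (pbar : base_change ibar X Xbar).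

(** A polynomial over k that kills f splits over kbar. Since the function field of Xbar has no zero
    divisors, f becomes one of the roots, and a function of F that is constant over kbar is a
    constant of k. *)
Lemma algebraic_constant (f : F) : ~ transcendental f -> exists c, f = const X c.
Proof.
move=> /existsNP[P /not_implyP[P0 /negP]]; rewrite negbK => /eqP Pf.
have [r Pr] := closed_field_poly_normal (map_poly ibar P).
have [c fc] : exists c, pbar f = const Xbar c.
  have : (map_poly (const Xbar) (map_poly ibar P)).[pbar f] = 0.
    have -> : map_poly (const Xbar) (map_poly ibar P) = map_poly pbar (map_poly (const X) P).
      by apply/polyP => l; rewrite !coef_map /= bc_const.
    by rewrite horner_map [X in pbar X]Pf rmorph0.
  rewrite Pr map_polyZ hornerZ => /eqP; rewrite mulf_eq0 fmorph_eq0 lead_coef_eq0.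
  rewrite map_poly_eq0 (negbTE P0) /= rmorph_prod horner_prod prodf_seq_eq0 => /hasP[c _ /=].
  rewrite rmorphB /= map_polyX map_polyC hornerD hornerN hornerX hornerC subr_eq0 => /eqP e.
  by exists c.
by have [b [fb _]] := bc_const_inter fc; exists b.
Qed.

Lemma regular_constant (f : F) : (forall x, f \in valring x) -> exists c, f = const X c.
Proof.
move=> reg; apply: algebraic_constant => /transcendental_pole[x].
by rewrite reg.
Qed.

End Constants.

(** * Quadratic extensions of finite fields *)

Section Frobenius.
Variables (k : finFieldType) (k' : fieldType) (i : {rmorphism k -> k'}).
Local Notation q := #|k|.

Lemma card_pchar_nat : [pchar k'].-nat q.
Proof.
have [p p_pr pk] := finPcharP k.
have : p.-nat q.
  by have := pprimeChar_pgroup pk; rewrite /pgroup cardsT.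
by move=> h; apply: pi_pnat h _; rewrite (rmorph_pchar i).
Qed.

Lemma frobenius_exists : exists theta : {rmorphism k' -> k'}, forall c, theta c = c ^+ q.
Proof.
pose f (c : k') := c ^+ q.
have fD x y : f (x + y) = f x + f y by apply: exprDn_pchar; exact: card_pchar_nat.
have q0 : (0 < q)%N by apply/card_gt0P; exists 0.
have f0 : f 0 = 0 by rewrite /f expr0n; case: q q0.
have fB : zmod_morphism f.
  by move=> x y; apply/eqP; rewrite -subr_eq0 opprB addrA -fD ?subrK ?subrr // addrC fD addKr subrr.
have fM : monoid_morphism f by split=> [|x y]; rewrite /f ?expr1n // exprMn.
exists (HB.pack f (GRing.isZmodMorphism.Build k' k' f fB)
   (GRing.isMonoidMorphism.Build k' k' f fM) : {rmorphism k' -> k'}).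
by [].
Qed.

(** X^q - X is the product of the X - b for b in k, so it has no further root in any extension of
    k. *)
Lemma frobenius_fixed c : c ^+ q = c -> exists b, c = i b.
Proof.
move=> cq; have : (map_poly i ('X^q - 'X)).[c] = 0.
  by rewrite rmorphB /= map_polyXn map_polyX hornerD hornerN hornerXn hornerX cq subrr.
rewrite finField_genPoly rmorph_prod horner_prod => /eqP/prodf_eq0[b _].
rewrite rmorphB /= map_polyX map_polyC hornerD hornerN hornerX hornerC subr_eq0 => /eqP e.
by exists b.
Qed.

End Frobenius.

Section QuadraticExtension.
Variables (k k2 : finFieldType) (i : {rmorphism k -> k2}).
Hypothesis hk2 : #|k2| = (#|k| ^ 2)%N.
Local Notation q := #|k|.

Lemma expf_card_quad (c : k2) : (c ^+ q) ^+ q = c.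
Proof. by rewrite -exprM -[RHS]expf_card hk2. Qed.

Lemma frobenius_surj_fin (c : k2) : exists d, d ^+ q = c.
Proof. by exists (c ^+ q); apply: expf_card_quad. Qed.

Lemma quad_element_exists : exists c : k2, forall b, c <> i b.
Proof.
apply: contrapT => /forallNP H.
have : (#|k2| <= #|k|)%N.
  have /choice[g gE] : forall c, exists b, c = i b.
    by move=> c; apply: contrapT => /forallNP nb; apply: (H c) => b; exact: nb.
  by apply: (leq_card g) => x y e; rewrite (gE x) e -gE.
have q1 : (1 < q)%N := finNzRing_gt1 k.
by rewrite hk2; move: q1; nia.
Qed.

Variable c : k2.
Hypothesis ck : forall b, c <> i b.

Lemma quad_conj_neq : c ^+ q <> c.
Proof. by move=> /(frobenius_fixed i)[b]; apply: ck. Qed.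

Lemma quad_min_poly : exists tau nu : k,
  [/\ i tau = c + c ^+ q, i nu = c * c ^+ q & c ^+ 2 = i tau * c - i nu].
Proof.
have [theta thE] := frobenius_exists i.
have [|tau tauE] := @frobenius_fixed _ _ i (c + c ^+ q).
  by rewrite -thE rmorphD /= !thE expf_card_quad addrC.
have [|nu nuE] := @frobenius_fixed _ _ i (c * c ^+ q).
  by rewrite exprMn expf_card_quad mulrC.
exists tau, nu; split=> //; rewrite -tauE -nuE; ring.
Qed.

Lemma quad_free a b : i a + i b * c = 0 -> a = 0 /\ b = 0.
Proof.
have [->|b0] := eqVneq b 0.
  by rewrite rmorph0 mul0r addr0 => /eqP; rewrite fmorph_eq0 => /eqP.
move=> e; case: (ck (b := - a / b)).
apply: (mulfI (_ : i b != 0)); first by rewrite fmorph_eq0.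
rewrite rmorphM rmorphN fmorphV -(addKr (i a) (i b * c)) e.
by field; rewrite fmorph_eq0.
Qed.

Lemma quad_span z : exists a b, z = i a + i b * c.
Proof.
pose f (ab : k * k) := i ab.1 + i ab.2 * c.
have finj : injective f.
  move=> [a b] [a' b'] /eqP; rewrite -subr_eq0 /f /= => /eqP e.
  have [] := @quad_free (a - a') (b - b').
    by rewrite !rmorphB -[RHS]e; ring.
  by move=> /eqP; rewrite subr_eq0 => /eqP-> /eqP; rewrite subr_eq0 => /eqP->.
have /(_ z)/codomP[[a b] ->] : forall z, z \in codom f.
  by move=> w; apply: (inj_card_onto finj); rewrite card_prod hk2 -mulnn.
by exists a, b.
Qed.

Lemma quad_irreducible tau nu : i tau = c + c ^+ q -> i nu = c * c ^+ q ->
  forall r : k, r ^+ 2 - tau * r + nu != 0.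
Proof.
move=> tauE nuE r; apply/eqP => /(congr1 i); rewrite rmorph0 rmorphD rmorphB.
rewrite rmorphXn rmorphM /= tauE nuE => e.
have /eqP : (i r - c) * (i r - c ^+ q) = 0 by rewrite -[RHS]e; ring.
rewrite mulf_eq0 !subr_eq0 => /orP[/eqP e'|/eqP e'].
  by case: (ck (b := r)).
have : (i r) ^+ q = c by rewrite e' expf_card_quad.
by rewrite -rmorphXn expf_card /= => e''; case: (ck (b := r)).
Qed.

End QuadraticExtension.

Section IrreducibleQuadratic.
Variables (k : finFieldType) (kbar : closedFieldType) (ibar : {rmorphism k -> kbar}).
Local Notation q := #|k|.

Lemma frobenius_surj_closed (c : kbar) : exists d, d ^+ q = c.
Proof.
have q1 : (1 < q)%N := finNzRing_gt1 k.
have /closed_rootP[d] : size ('X^q - c%:P) != 1.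
  by rewrite size_XnsubC ?(ltnW q1) //; case: q q1 => [|[]].
by rewrite /root hornerD hornerN hornerXn hornerC subr_eq0 => /eqP; exists d.
Qed.

Variables tau nu : k.
Hypothesis irr : forall r : k, r ^+ 2 - tau * r + nu != 0.

(** The q-power map permutes the roots. It moves r, as r is not in k, so r^q is the second root and
    the roots are distinct in every characteristic. *)
Lemma quadratic_roots_closed : exists r : kbar,
  [/\ r ^+ q <> r, r + r ^+ q = ibar tau & r * r ^+ q = ibar nu].
Proof.
pose P := 'X^2 - ibar tau *: 'X + (ibar nu)%:P.
have sP : size P = 3.
  rewrite /P -addrA size_polyDl size_polyXn // ltnS.
  rewrite (leq_trans (size_polyD _ _)) // geq_max size_polyN.
  by rewrite (leq_trans (size_scale_leq _ _)) ?size_polyX // (leq_trans (size_polyC_leq1 _)).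
have /closed_rootP[r rP] : size P != 1 by rewrite sP.
have {}rP : r ^+ 2 - ibar tau * r + ibar nu = 0.
  by have /eqP := rP; rewrite /P !hornerE.
have rq : r ^+ q <> r.
  move=> /(frobenius_fixed ibar)[b rb]; have /eqP := irr b; apply.
  by apply: (fmorph_inj ibar); rewrite rmorph0 -rP rb rmorphD rmorphB rmorphXn rmorphM.
have [theta thE] := frobenius_exists ibar.
have th_i b : theta (ibar b) = ibar b by rewrite thE -rmorphXn expf_card.
have rPq : (r ^+ q) ^+ 2 - ibar tau * r ^+ q + ibar nu = 0.
  by rewrite -thE -(th_i tau) -(th_i nu) -rmorphXn -rmorphM -rmorphB -rmorphD rP rmorph0.
have /eqP : (r ^+ q - r) * (r ^+ q + r - ibar tau) = 0.
  by rewrite -[RHS](subrr 0) -{1}rPq -rP; ring.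
rewrite mulf_eq0 subr_eq0 => /orP[/eqP//|]; rewrite subr_eq0 => /eqP e.
exists r; split=> //; first by rewrite addrC.
by have := rP; rewrite -e => e'; apply/eqP; rewrite -subr_eq0 -oppr_eq0 -[X in _ == X]e';
  apply/eqP; ring.
Qed.

Variables (k2 : finFieldType) (i : {rmorphism k -> k2}).
Hypothesis hk2 : #|k2| = (#|k| ^ 2)%N.

(** Only the cardinality of k2 is known. Over kbar the roots r and r^q satisfy z^(q^2) = z, so P
    divides X^(q^2) - X already over k, and over k2 the latter is a product of linear factors. *)
Lemma quadratic_root_quad : exists c : k2, c ^+ 2 = i tau * c - i nu.
Proof.
pose P := 'X^2 - tau *: 'X + nu%:P.
have [r [rq rtau rnu]] := quadratic_roots_closed.
have [theta thE] := frobenius_exists ibar.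
have rqq : (r ^+ q) ^+ q = r.
  have : theta (r + r ^+ q) = r + r ^+ q by rewrite rtau thE -rmorphXn expf_card.
  by rewrite rmorphD /= !thE addrC => /addIr.
have PE : map_poly ibar P = \prod_(z <- [:: r; r ^+ q]) ('X - z%:P).
  rewrite big_cons big_seq1 /P rmorphD rmorphB /= map_polyXn map_polyZ map_polyX map_polyC /=.
  by rewrite -rtau -rnu -mul_polyC !rmorphD rmorphM /=; ring.
have dvd : P %| 'X^#|k2| - 'X.
  rewrite -(dvdp_map ibar) PE uniq_roots_dvdp //.
    rewrite rmorphB /= map_polyXn map_polyX /root !hornerE ?hornerXn hk2 -mulnn.
    by rewrite /= ?andbT !exprM rqq !subrr eqxx /= ?rqq ?subrr ?eqxx.
  by rewrite uniq_rootsE /= inE andbT; apply/eqP => /esym.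
move: dvd; rewrite -(dvdp_map i).
have -> : map_poly i ('X^#|k2| - 'X) = \prod_(z <- index_enum k2) ('X - z%:P).
  by rewrite rmorphB /= map_polyXn map_polyX finField_genPoly.
move=> /dvdp_prod_XsubC[m Pm].
have sP : size P = 3.
  rewrite /P -addrA size_polyDl size_polyXn // ltnS.
  rewrite (leq_trans (size_polyD _ _)) // geq_max size_polyN.
  by rewrite (leq_trans (size_scale_leq _ _)) ?size_polyX // (leq_trans (size_polyC_leq1 _)).
have := eqp_size Pm; rewrite size_map_poly sP size_prod_XsubC.
case: (mask m _) Pm => // c s Pm _.
have : root (map_poly i P) c by rewrite (eqp_root Pm) big_cons rootM root_XsubC eqxx.
rewrite /P rmorphD rmorphB /= map_polyXn map_polyZ map_polyX map_polyC /root !hornerE.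
rewrite addrAC subr_eq0 => /eqP e; exists c; rewrite -e; ring.
Qed.

End IrreducibleQuadratic.

(** * Lattices *)

Section Opens.
Variables (k : fieldType) (X : curve k).
Local Notation F := (funField X).
Implicit Types (x : place X) (U V W : set (place X)).

Lemma place_inhabited : exists x : place X, True.
Proof.
have [t [N [ttr _]]] := curve_lin_dep X.
by have [x _] := transcendental_pole ttr; exists x.
Qed.

Lemma is_openI U V : is_open U -> is_open V -> is_open (U `&` V).
Proof. by rewrite /is_open setCI finite_setU. Qed.

Lemma is_openT : is_open (@setT (place X)).
Proof. by rewrite /is_open setCT; exact: finite_set0. Qed.

Lemma is_openS U V : is_open U -> U `<=` V -> is_open V.
Proof. by rewrite /is_open => Uo /subsetC UV; apply: sub_finite_set UV Uo. Qed.

Definition regular_locus n m (M : 'M[F]_(n, m)) : set (place X) :=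
  [set x | M \is a mxOver (valring x)].

Lemma regular_locus_open n m (M : 'M[F]_(n, m)) : is_open (regular_locus M).
Proof.
rewrite /is_open.
apply: (@sub_finite_set _ _ (\bigcup_(ij in [set: 'I_n * 'I_m])
  [set x | M ij.1 ij.2 \notin valring x])).
  move=> x /= nM; apply: contrapT => H; apply: nM; apply/mxOverP => a b.
  by apply: contrapT => /negP Mab; apply: H; exists (a, b).
apply: bigcup_finite; first exact: finite_finset.
by move=> ij _; exact: finite_poles.
Qed.

Definition unit_locus n (M : 'M[F]_n) : set (place X) :=
  regular_locus M `&` regular_locus (invmx M).

Lemma unit_locus_open n (M : 'M[F]_n) : is_open (unit_locus M).
Proof. by apply: is_openI; exact: regular_locus_open. Qed.

End Opens.

Section Lattices.
Variables (k : fieldType) (X : curve k).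
Local Notation F := (funField X).
Implicit Types (x : place X) (U V W : set (place X)).

(* The stalk at x consists of the row vectors v with v *m A x integral at x. *)
Record lattice n := MkLattice {
  lat_mx :> place X -> 'M[F]_n;
  lat_unit : forall x, lat_mx x \in unitmx;
  lat_open : is_open [set x | unit_locus (lat_mx x) x]
}.

Variable n : nat.
Implicit Types A : lattice n.

Definition Lat_pred A U : {pred 'rV[F]_n} :=
  fun v => `[< forall x, U x -> v *m A x \is a mxOver (valring x) >].

Lemma Lat_predP A U v :
  reflect (forall x, U x -> v *m A x \is a mxOver (valring x)) (v \in Lat_pred A U).
Proof. exact: asboolP. Qed.

Fact Lat_zmod A U : zmod_closed (Lat_pred A U).
Proof.
split=> [|v w /Lat_predP vU /Lat_predP wU]; apply/Lat_predP => x Ux.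
  by rewrite mul0mx rpred0.
by rewrite mulmxBl rpredB ?vU ?wU.
Qed.
HB.instance Definition _ A U :=
  GRing.isZmodClosed.Build 'rV[F]_n (Lat_pred A U) (Lat_zmod A U).

Record Lat_sec A U := MkLat { Lat_val :> 'rV[F]_n; Lat_valP : Lat_val \in Lat_pred A U }.
HB.instance Definition _ A U := [isSub for @Lat_val A U].
HB.instance Definition _ A U := [Choice of Lat_sec A U by <:].
HB.instance Definition _ A U := [SubChoice_isSubZmodule of Lat_sec A U by <:].

Lemma Oring_valring U (a : Oring U) x : U x -> Oval a \in valring x.
Proof. by move=> Ux; have /asboolP := OvalP a; apply. Qed.

Lemma mem_regular_on U (f : F) : (forall x, U x -> f \in valring x) -> f \in regular_on U.
Proof. by move=> fU; apply/asboolP. Qed.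

Fact Lat_scale_subproof A U (a : Oring U) (s : Lat_sec A U) :
  Oval a *: Lat_val s \in Lat_pred A U.
Proof.
have /Lat_predP sU := Lat_valP s; apply/Lat_predP => x Ux.
rewrite -scalemxAl; apply/mxOverP => i j; rewrite mxE rpredM ?(Oring_valring a Ux) //.
exact/mxOverP/sU.
Qed.
Definition Lat_scale A U (a : Oring U) (s : Lat_sec A U) : Lat_sec A U :=
  MkLat (Lat_scale_subproof a s).

Fact Lat_scaleA A U (a b : Oring U) (s : Lat_sec A U) :
  Lat_scale a (Lat_scale b s) = Lat_scale (a * b) s.
Proof. by apply: val_inj; rewrite /= scalerA. Qed.
Fact Lat_scale1 A U : left_id 1 (@Lat_scale A U).
Proof. by move=> s; apply: val_inj; rewrite /= scale1r. Qed.
Fact Lat_scaleDr A U : right_distributive (@Lat_scale A U) +%R.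
Proof. by move=> a s t; apply: val_inj; rewrite /= scalerDr. Qed.
Fact Lat_scaleDl A U (s : Lat_sec A U) : {morph (@Lat_scale A U)^~ s : a b / a + b}.
Proof. by move=> a b; apply: val_inj; rewrite /= scalerDl. Qed.
HB.instance Definition _ A U := GRing.Zmodule_isLmodule.Build (Oring U)
  (Lat_sec A U) (@Lat_scaleA A U) (@Lat_scale1 A U) (@Lat_scaleDr A U)
  (@Lat_scaleDl A U).

Fact Lat_res_subproof A U V (VU : V `<=` U) (s : Lat_sec A U) :
  Lat_val s \in Lat_pred A V.
Proof. by have /Lat_predP sU := Lat_valP s; apply/Lat_predP => x /VU; apply: sU. Qed.

Definition Lat A : premodule X :=
  @Premodule _ X (fun U => Lat_sec A U)
    (fun U V VU s => MkLat (Lat_res_subproof VU s)).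

Definition LatV A U (s : Lat A U) : 'rV[F]_n := Lat_val s.
(** The value is 0 when v is not integral on U; [mkLatK] is the specification. *)
Definition mkLat A U (v : 'rV[F]_n) : Lat A U := insubd (0 : Lat_sec A U) v.

Lemma LatV_inj A U : injective (@LatV A U).
Proof. by move=> s t; exact: val_inj. Qed.

Lemma LatVP A U (s : Lat A U) x : U x -> LatV s *m A x \is a mxOver (valring x).
Proof. by have /Lat_predP := Lat_valP s; apply. Qed.

Lemma mkLatK A U v : (forall x, U x -> v *m A x \is a mxOver (valring x)) ->
  LatV (mkLat A U v) = v.
Proof. by move=> vU; rewrite /LatV /mkLat insubdK //; apply/Lat_predP. Qed.

Lemma LatV_lin A U (a : Oring U) (s t : Lat A U) :
  LatV (a *: s + t) = Oval a *: LatV s + LatV t.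
Proof. by []. Qed.
Lemma LatVD A U (s t : Lat A U) : LatV (s + t) = LatV s + LatV t.
Proof. by []. Qed.
Lemma LatVZ A U (a : Oring U) (s : Lat A U) : LatV (a *: s) = Oval a *: LatV s.
Proof. by []. Qed.
Lemma LatV0 A U : LatV (0 : Lat A U) = 0.
Proof. by []. Qed.
Lemma LatV_sum A U (I : finType) (s : I -> Lat A U) :
  LatV (\sum_i s i) = \sum_i LatV (s i).
Proof. by apply: (big_morph _ (@LatVD A U) (LatV0 A U)). Qed.
Lemma LatV_res A U V (VU : V `<=` U) (s : Lat A U) : LatV (res VU s) = LatV s.
Proof. by []. Qed.

Definition mkO U (f : F) : Oring U := insubd (0 : Oring U) f.
Lemma mkOK U f : (forall x, U x -> f \in valring x) -> Oval (mkO U f) = f.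
Proof. by move=> fU; rewrite /mkO insubdK //; exact: mem_regular_on. Qed.
Lemma Oval_inj U : injective (@Oval k X U).
Proof. exact: val_inj. Qed.

Lemma Lat_presheaf A : is_presheaf (Lat A).
Proof. by split=> *; apply: val_inj. Qed.

(** Restriction does not change the vector, so compatible sections all carry the same one, read off
    at [i0]. *)
Lemma Lat_sheaf A : is_sheaf (Lat A).
Proof.
split; first exact: Lat_presheaf.
move=> I i0 V U Vo Uo VU cover s agree.
have valE i : LatV (s i) = LatV (s i0).
  by have := congr1 (@LatV A _) (agree i i0).
have vU x : U x -> LatV (s i0) *m A x \is a mxOver (valring x).
  by move=> /cover[i _ Vi]; rewrite -(valE i); exact: LatVP.
exists (mkLat A U (LatV (s i0))); split.
  by move=> i; apply: LatV_inj; rewrite LatV_res mkLatK.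
by move=> t tE; apply: LatV_inj; rewrite mkLatK // -(tE i0) LatV_res.
Qed.

(** The rows of [invmx (A x)] are a basis of the stalk at x, and also of the stalk at each z of
    [lat_nbhs A x], where [A x] and [A z] differ by a matrix invertible over the local ring at z. *)
Definition lat_basis A x U i : Lat A U := mkLat A U (row i (invmx (A x))).
Definition lat_nbhs A x : set (place X) :=
  [set z | unit_locus (invmx (A x) *m A z) z].

Lemma lat_nbhs_open A x : is_open (lat_nbhs A x).
Proof.
have o1 := lat_open A; have o2 := unit_locus_open (A x).
apply: is_openS (is_openI o1 o2) _ => z /= [[Az AVz] [Ax AVx]]; split.
  by apply: mxOverM.
have u := lat_unit A x; have uz := lat_unit A z.
have -> : invmx (invmx (A x) *m A z) = invmx (A z) *m A x.
  have uu : invmx (A x) *m A z \in unitmx by rewrite unitmx_mul unitmx_inv u.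
  apply: (can_inj (mulKmx uu)); rewrite mulmxV // mulmxA -(mulmxA _ (A z)).
  by rewrite mulmxV // mulmx1 mulVmx.
exact: mxOverM.
Qed.

Lemma lat_nbhs_self A x : lat_nbhs A x x.
Proof.
rewrite /lat_nbhs /= mulVmx ?lat_unit //; split; rewrite /regular_locus /= ?invmx1;
  by apply/mxOverP => i j; rewrite mxE; case: eqP => _; rewrite ?rpred1 ?rpred0.
Qed.

Lemma lat_nbhsE A x z : lat_nbhs A x z -> forall (v : 'rV_n),
  (v *m A z \is a mxOver (valring z)) = (v *m A x \is a mxOver (valring z)).
Proof.
move=> [r1 r2] v.
have uu : invmx (A x) *m A z \in unitmx by rewrite unitmx_mul unitmx_inv !lat_unit.
have e : v *m A z = v *m A x *m (invmx (A x) *m A z).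
  by rewrite mulmxA mulmxK ?lat_unit.
apply/idP/idP => h; last by rewrite e mxOverM.
have -> : v *m A x = v *m A z *m invmx (invmx (A x) *m A z) by rewrite e mulmxK.
by rewrite mxOverM.
Qed.

Lemma lat_basisK A x U i : U `<=` lat_nbhs A x ->
  LatV (lat_basis A x U i) = row i (invmx (A x)).
Proof.
move=> Ux; apply: mkLatK => z /Ux; rewrite -row_mul => -[/mxOverP r _].
by apply/mxOverP => a b; rewrite mxE.
Qed.

Lemma lat_coord_regular A x U (s : Lat A U) : U `<=` lat_nbhs A x ->
  forall i z, U z -> (LatV s *m A x) 0 i \in valring z.
Proof.
move=> Ux i z Uz; have := LatVP s Uz; rewrite (lat_nbhsE (Ux z Uz)).
by move=> /mxOverP.
Qed.

Lemma lat_expand A x U (s : Lat A U) : U `<=` lat_nbhs A x ->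
  s = \sum_i mkO U ((LatV s *m A x) 0 i) *: lat_basis A x U i.
Proof.
move=> Ux; apply: LatV_inj; rewrite LatV_sum.
have reg := lat_coord_regular s Ux.
rewrite (eq_bigr (fun i => (LatV s *m A x) 0 i *: row i (invmx (A x)))) => [|i _].
  by rewrite -mulmx_sum_row mulmxK ?lat_unit.
by rewrite LatVZ lat_basisK // mkOK // => z; exact: reg.
Qed.

Lemma Lat_vector_bundle A : vector_bundle n (Lat A).
Proof.
split; first exact: Lat_sheaf.
move=> x; exists (lat_nbhs A x); split; [exact: lat_nbhs_open|exact: lat_nbhs_self|].
exists (fun i => lat_basis A x _ i) => V VU Vo s.
have reg := lat_coord_regular s VU.
have resE i : res VU (lat_basis A x _ i) = lat_basis A x V i.
  by apply: LatV_inj; rewrite LatV_res !lat_basisK.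
exists (fun i => mkO V ((LatV s *m A x) 0 i)); split.
  by rewrite {1}(lat_expand s VU); apply: eq_bigr => i _; rewrite resE.
move=> a sE; apply: funext => i; apply: Oval_inj; rewrite mkOK; last exact: reg.
rewrite sE.
under eq_bigr do rewrite resE.
rewrite LatV_sum; under eq_bigr do rewrite LatVZ lat_basisK //.
have -> : \sum_j Oval (a j) *: row j (invmx (A x)) = (\row_j Oval (a j)) *m invmx (A x).
  by rewrite mulmx_sum_row; apply: eq_bigr => j _; rewrite mxE.
by rewrite mulmxKV ?lat_unit // mxE.
Qed.

End Lattices.

(** * Homomorphisms *)

Section Homs.
Variables (k : fieldType) (X : curve k).
Implicit Types (x : place X) (U V W : set (place X)) (M N E G : premodule X).

Lemma homD M N (h : forall U, M U -> N U) U : is_hom h -> is_open U ->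
  forall s t, h U (s + t) = h U s + h U t.
Proof. by move=> [hl _] Uo s t; have := hl U Uo 1 s t; rewrite !scale1r. Qed.

Lemma hom0 M N (h : forall U, M U -> N U) U : is_hom h -> is_open U -> h U 0 = 0.
Proof.
move=> hh Uo; apply: (addIr (h U 0)); rewrite -(homD hh Uo) !add0r //.
Qed.

Lemma homZ M N (h : forall U, M U -> N U) U : is_hom h -> is_open U ->
  forall a s, h U (a *: s) = a *: h U s.
Proof.
by move=> hh Uo a s; have := hh.1 U Uo a s 0; rewrite (hom0 hh Uo) !addr0.
Qed.

Lemma hom_sum M N (h : forall U, M U -> N U) U : is_hom h -> is_open U ->
  forall (I : finType) (s : I -> M U), h U (\sum_i s i) = \sum_i h U (s i).
Proof. by move=> hh Uo I s; apply: (big_morph _ (homD hh Uo) (hom0 hh Uo)). Qed.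

Lemma hom_res M N (h : forall U, M U -> N U) U V (VU : V `<=` U) : is_hom h ->
  is_open U -> is_open V -> forall s, h V (res VU s) = res VU (h U s).
Proof. by move=> [_ hr] Uo Vo s; apply: hr. Qed.

Lemma res_comp M U V W (VU : V `<=` U) (WV : W `<=` V) (WU : W `<=` U) :
  is_presheaf M -> is_open U -> is_open V -> is_open W ->
  forall s : M U, res WV (res VU s) = res WU s.
Proof. by move=> [_ rc _] Uo Vo Wo s; apply: rc. Qed.

Lemma res_lin M U V (VU : V `<=` U) : is_presheaf M -> is_open U -> is_open V ->
  forall (a : Oring U) (s t : M U), res VU (a *: s + t) = Ores VU a *: res VU s + res VU t.
Proof. by move=> [_ _ rl] Uo Vo a s t; apply: rl. Qed.

Lemma resD M U V (VU : V `<=` U) : is_presheaf M -> is_open U -> is_open V ->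
  forall (s t : M U), res VU (s + t) = res VU s + res VU t.
Proof.
move=> Mp Uo Vo s t; have := res_lin VU Mp Uo Vo 1 s t; rewrite scale1r => ->.
by congr (_ + _); rewrite -[RHS]scale1r; congr (_ *: _); exact: val_inj.
Qed.

Lemma res0 M U V (VU : V `<=` U) : is_presheaf M -> is_open U -> is_open V ->
  res VU (0 : M U) = 0.
Proof. by move=> Mp Uo Vo; apply: (addIr (res VU (0 : M U))); rewrite -resD // !add0r. Qed.

Lemma resZ M U V (VU : V `<=` U) : is_presheaf M -> is_open U -> is_open V ->
  forall (a : Oring U) (s : M U), res VU (a *: s) = Ores VU a *: res VU s.
Proof. by move=> Mp Uo Vo a s; have := res_lin VU Mp Uo Vo a s 0; rewrite res0 // !addr0. Qed.

Lemma res_sum M U V (VU : V `<=` U) : is_presheaf M -> is_open U -> is_open V ->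
  forall (I : finType) (s : I -> M U), res VU (\sum_i s i) = \sum_i res VU (s i).
Proof. by move=> Mp Uo Vo I s; apply: (big_morph _ (resD VU Mp Uo Vo) (res0 VU Mp Uo Vo)). Qed.

Lemma comp_hom M N E (h : forall U, M U -> N U) (g : forall U, N U -> E U) :
  is_hom h -> is_hom g -> is_hom (fun U s => g U (h U s)).
Proof.
move=> [hl hr] [gl gr]; split=> [U Uo a s t|U V VU Uo Vo s].
  by rewrite hl // gl.
by rewrite hr // gr.
Qed.

Lemma id_hom M : is_hom (fun U (s : M U) => s).
Proof. by split. Qed.

Definition iso_pair M N (h : forall U, M U -> N U) (g : forall U, N U -> M U) :=
  [/\ is_hom h, is_hom g, forall U, is_open U -> cancel (h U) (g U) &
      forall U, is_open U -> cancel (g U) (h U)].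

Lemma isomorphicP M N : isomorphic M N <-> exists h g, @iso_pair M N h g.
Proof.
split=> [[h hh hb]|[h [g [hh _ hg gh]]]]; last by exists h => // U Uo; exists (g U); [exact:
  hg|exact: gh].
have gex U : exists g : N U -> M U, is_open U -> cancel (h U) g /\ cancel g (h U).
  (* Nothing is known off the open sets, and any map will do there. *)
  have [Uo|nUo] := pselect (is_open U); last by exists (fun=> 0).
  by have [g g1 g2] := hb U Uo; exists g.
pose gg U := projT1 (cid (gex U)).
have ggP U : is_open U -> cancel (h U) (gg U) /\ cancel (gg U) (h U).
  by rewrite /gg; case: cid.
exists h, gg; split=> //.
- split=> [U Uo a s t|U V VU Uo Vo s].
    have [hg gh] := ggP U Uo; apply: (can_inj hg); rewrite gh hh.1 //.
    by rewrite !gh.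
  have [hg gh] := ggP U Uo; have [hgV ghV] := ggP V Vo.
  by apply: (can_inj hgV); rewrite ghV hh.2 // gh.
- by move=> U Uo; have [] := ggP U Uo.
- by move=> U Uo; have [] := ggP U Uo.
Qed.

Lemma isomorphic_refl M : isomorphic M M.
Proof. by exists (fun U s => s); [exact: id_hom|move=> U _; exists id]. Qed.

Lemma isomorphic_sym M N : isomorphic M N -> isomorphic N M.
Proof.
move=> /isomorphicP[h [g [hh gh c1 c2]]]; apply/isomorphicP.
by exists g, h.
Qed.

Lemma isomorphic_trans M N E : isomorphic M N -> isomorphic N E -> isomorphic M E.
Proof.
move=> [h hh hb] [g gh gb]; exists (fun U s => g U (h U s)); first exact: comp_hom.
by move=> U Uo; apply: bij_comp; [exact: gb|exact: hb].
Qed.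

Lemma isomorphic_dsum M M' N N' : isomorphic M M' -> isomorphic N N' ->
  isomorphic (dsum M N) (dsum M' N').
Proof.
move=> /isomorphicP[h [g [hh gh c1 c2]]] /isomorphicP[h' [g' [hh' gh' c1' c2']]].
exists (fun U (s : dsum M N U) => (h U s.1, h' U s.2) : dsum M' N' U).
  split=> [U Uo a [s s'] [t t']|U V VU Uo Vo [s s']].
    by congr (_, _); rewrite /= ?hh.1 ?hh'.1.
  by congr (_, _); rewrite /= ?hh.2 ?hh'.2.
move=> U Uo; exists (fun s => (g U s.1, g' U s.2)).
  by move=> [s s'] /=; rewrite c1 // c1'.
by move=> [s s'] /=; rewrite c2 // c2'.
Qed.

(* The opens of the cover are indexed by the places themselves. *)
Lemma sheaf_glue G (W : place X -> set (place X)) U : is_sheaf G -> is_open U ->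
  (forall x, is_open (W x)) -> (forall x, W x x) ->
  forall s : (forall x, G (U `&` W x)),
  (forall x y V (V1 : V `<=` U `&` W x) (V2 : V `<=` U `&` W y), is_open V ->
     res V1 (s x) = res V2 (s y)) ->
  exists! t : G U, forall x, res (@subIsetl _ U (W x)) t = s x.
Proof.
move=> [Gp Gs] Uo Wo Wx s agree; have [x0 _] := place_inhabited X.
have Vo x : is_open (U `&` W x) by apply: is_openI.
have VU : U `<=` \bigcup_x (U `&` W x) by move=> x Ux; exists x.
have H := Gs _ x0 (fun x => U `&` W x) U Vo Uo (fun x => @subIsetl _ U (W x)) VU s.
apply: H => x y; apply: agree; exact: is_openI.
Qed.

Lemma sheaf_eq G (W : place X -> set (place X)) U : is_sheaf G -> is_open U ->
  (forall x, is_open (W x)) -> (forall x, W x x) ->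
  forall t t' : G U, (forall x, res (@subIsetl _ U (W x)) t = res (@subIsetl _ U (W x)) t') ->
  t = t'.
Proof.
move=> Gs Uo Wo Wx t t' e.
have [|u [_ uu]] := @sheaf_glue G W U Gs Uo Wo Wx (fun x => res (@subIsetl _ U (W x)) t').
  move=> x y V V1 V2 Vo; have VU : V `<=` U by move=> z /V1[].
  have Gp := Gs.1.
  rewrite (res_comp _ _ VU Gp) ?(res_comp _ _ VU Gp) //; exact: is_openI.
by rewrite -(uu t) // -(uu t').
Qed.

(** This produces the homomorphisms that the universal properties of tensor products and pullbacks
    ask for, from formulas in local bases. *)
Lemma glue_hom M G (W : place X -> set (place X))
    (c : forall (x : place X) U, M U -> G U) :
  is_presheaf M -> is_sheaf G ->
  (forall x, is_open (W x)) -> (forall x, W x x) ->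
  (forall x U, is_open U -> U `<=` W x -> forall (a : Oring U) (s t : M U),
     c x U (a *: s + t) = a *: c x U s + c x U t) ->
  (forall x U V (VU : V `<=` U), is_open U -> is_open V -> U `<=` W x ->
     forall s : M U, c x V (res VU s) = res VU (c x U s)) ->
  (forall x y U, is_open U -> U `<=` W x -> U `<=` W y ->
     forall s : M U, c x U s = c y U s) ->
  exists h : (forall U, M U -> G U), is_hom h /\
    forall x U, is_open U -> U `<=` W x -> forall s : M U, h U s = c x U s.
Proof.
move=> Mp Gs Wo Wx clin cres cagree; have Gp := Gs.1.
have WUo U x : is_open U -> is_open (U `&` W x) by move=> Uo; apply: is_openI.
have ex U (s : M U) : exists t : G U, is_open U ->
    forall x, res (@subIsetl _ U (W x)) t = c x _ (res (@subIsetl _ U (W x)) s).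
  have [Uo|nUo] := pselect (is_open U); last by exists 0.
  have [|t [tE _]] := @sheaf_glue G W U Gs Uo Wo Wx
      (fun x => c x _ (res (@subIsetl _ U (W x)) s)); last by exists t.
  move=> x y V V1 V2 Vo; have VU : V `<=` U by move=> z /V1[].
  have oUx := WUo U x Uo; have oUy := WUo U y Uo.
  rewrite -(cres _ _ _ V1 oUx Vo (@subIsetr _ U (W x))).
  rewrite -(cres _ _ _ V2 oUy Vo (@subIsetr _ U (W y))).
  rewrite !(res_comp _ _ VU Mp) //.
  by apply: cagree => // z; [move/V1 => []|move/V2 => []].
pose h U s := projT1 (cid (ex U s)).
have hE U (s : M U) : is_open U ->
    forall x, res (@subIsetl _ U (W x)) (h U s) = c x _ (res (@subIsetl _ U (W x)) s).
  by move=> Uo x; rewrite /h; case: cid => t /= /(_ Uo).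
exists h; split.
  split=> [U Uo a s t|U V VU Uo Vo s].
    apply: (sheaf_eq Gs Uo Wo Wx) => x; have oU := WUo U x Uo.
    by rewrite (res_lin _ Gp) // !hE // (res_lin _ Mp) // clin //; move=> z [].
  apply: (sheaf_eq Gs Vo Wo Wx) => x; have oU := WUo U x Uo; have oV := WUo V x Vo.
  rewrite hE //.
  have VWU : V `&` W x `<=` U `&` W x by move=> z [/VU].
  have VWU' : V `&` W x `<=` U by move=> z [/VU].
  rewrite (res_comp _ _ VWU' Mp) // (res_comp _ _ VWU' Gp) //.
  rewrite -(res_comp (@subIsetl _ U (W x)) VWU VWU' Mp) //.
  rewrite -(res_comp (@subIsetl _ U (W x)) VWU VWU' Gp) //.
  by rewrite hE // cres //; move=> z [].
move=> x U Uo UW s; apply: (sheaf_eq Gs Uo Wo Wx) => y; have oU := WUo U y Uo.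
rewrite hE // -cres //; apply: cagree => // z [] // /UW //.
Qed.

Lemma hom_eq_local M G (W : place X -> set (place X)) (h h' : forall U, M U -> G U) :
  is_sheaf G -> is_hom h -> is_hom h' ->
  (forall x, is_open (W x)) -> (forall x, W x x) ->
  (forall x U, is_open U -> U `<=` W x -> forall s : M U, h U s = h' U s) ->
  forall U, is_open U -> h U =1 h' U.
Proof.
move=> Gs hh hh' Wo Wx hE U Uo s; apply: (sheaf_eq Gs Uo Wo Wx) => x.
have oU : is_open (U `&` W x) by apply: is_openI.
by rewrite -!hom_res // (hE x) // => z [].
Qed.

End Homs.

Section LatticeHoms.
Variables (k : fieldType) (X : curve k).
Local Notation F := (funField X).
Implicit Types (x : place X) (U V W : set (place X)).

Definition lat_hom m n (A : lattice X m) (B : lattice X n) (H : 'M[F]_(m, n)) :=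
  forall x (v : 'rV_m), v *m A x \is a mxOver (valring x) ->
    v *m H *m B x \is a mxOver (valring x).

Lemma Lat_pred_open n (A : lattice X n) (v : 'rV_n) :
  is_open [set z | v *m A z \is a mxOver (valring z)].
Proof.
apply: is_openS (is_openI (lat_open A) (regular_locus_open v)) _ => z /= [[Az _] vz].
exact: mxOverM.
Qed.

Lemma LatV_surj n (A : lattice X n) (v : 'rV_n) :
  exists U (s : Lat A U), is_open U /\ LatV s = v.
Proof.
exists [set z | v *m A z \is a mxOver (valring z)], (mkLat A _ v).
by split; [exact: Lat_pred_open|rewrite mkLatK].
Qed.

Lemma lat_basis_res n (A : lattice X n) x U V (VU : V `<=` U) i :
  U `<=` lat_nbhs A x -> res VU (lat_basis A x U i) = lat_basis A x V i.
Proof.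
move=> Ux; apply: LatV_inj; rewrite LatV_res !lat_basisK //.
exact: subset_trans Ux.
Qed.

(** Every open meets the neighbourhood [U0] of [x0] in an open, and restriction does not change
    vectors. So h is given by its values on a basis over [U0], the rows of [R]; [A x0] turns a
    vector into its coordinates. *)
Lemma Lat_hom_matrix m n (A : lattice X m) (B : lattice X n)
    (h : forall U, Lat A U -> Lat B U) : is_hom h ->
  exists2 H : 'M[F]_(m, n), lat_hom A B H &
    forall U, is_open U -> forall s, LatV (h U s) = LatV s *m H.
Proof.
move=> hh; have [x0 _] := place_inhabited X; pose U0 := lat_nbhs A x0.
have U0o : is_open U0 := lat_nbhs_open A x0.
pose R := \matrix_(i < m) LatV (h U0 (lat_basis A x0 U0 i)).
have hE U : is_open U -> forall s, LatV (h U s) = LatV s *m (A x0 *m R).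
  move=> Uo s; pose W := U `&` U0.
  have Wo : is_open W by apply: is_openI.
  rewrite -(LatV_res (@subIsetl _ U U0) (h U s)) -(hom_res _ hh) //.
  have WU0 : W `<=` U0 := @subIsetr _ U U0.
  rewrite (lat_expand (res (@subIsetl _ U U0) s) WU0) hom_sum // LatV_sum.
  rewrite mulmxA [RHS]mulmx_sum_row; apply: eq_bigr => i _.
  rewrite homZ // LatVZ mkOK; last first.
    by move=> z Wz; exact: (lat_coord_regular (res (@subIsetl _ U U0) s) WU0).
  congr (_ *: _); rewrite rowK.
  by rewrite -(lat_basis_res WU0) // (hom_res _ hh) // LatV_res.
exists (A x0 *m R) => // x v vx.
pose U := [set z | v *m A z \is a mxOver (valring z)].
have Uo : is_open U := Lat_pred_open A v.
have vE : LatV (mkLat A U v) = v by rewrite mkLatK.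
by have := LatVP (h U (mkLat A U v)) (vx : U x); rewrite hE // vE.
Qed.

Lemma lat_hom_is_hom m n (A : lattice X m) (B : lattice X n) (H : 'M[F]_(m, n)) :
  lat_hom A B H -> exists2 h : (forall U, Lat A U -> Lat B U), is_hom h &
    forall U s, LatV (h U s) = LatV s *m H.
Proof.
move=> AB; pose h U (s : Lat A U) := mkLat B U (LatV s *m H).
have hE U s : LatV (h U s) = LatV s *m H.
  by rewrite /h mkLatK // => x Ux; apply: AB; exact: LatVP.
exists h => //; split=> [U Uo a s t|U V VU Uo Vo s]; apply: LatV_inj.
  by rewrite LatV_lin !hE LatV_lin mulmxDl scalemxAl.
by rewrite LatV_res !hE LatV_res.
Qed.

Lemma isomorphic_Lat m n (A : lattice X m) (B : lattice X n) :
  isomorphic (Lat A) (Lat B) <-> exists (H : 'M[F]_(m, n)) (H' : 'M[F]_(n, m)),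
    [/\ H *m H' = 1%:M, H' *m H = 1%:M, lat_hom A B H & lat_hom B A H'].
Proof.
split.
  move=> /isomorphicP[h [g [hh gh hg gh']]].
  have [H AB hE] := Lat_hom_matrix hh; have [H' BA gE] := Lat_hom_matrix gh.
  exists H, H'; split=> //.
    apply/row_matrixP => i; have [U [s [Uo sE]]] := LatV_surj A (row i 1%:M).
    by rewrite -[RHS]sE -[in RHS](hg U Uo s) gE // hE // sE row_mul row1 -rowE.
  apply/row_matrixP => i; have [U [s [Uo sE]]] := LatV_surj B (row i 1%:M).
  by rewrite -[RHS]sE -[in RHS](gh' U Uo s) hE // gE // sE row_mul row1 -rowE.
move=> [H [H' [HH' H'H AB BA]]].
have [h hh hE] := lat_hom_is_hom AB; have [g gh gE] := lat_hom_is_hom BA.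
exists h => // U Uo; exists (g U) => s; apply: LatV_inj.
  by rewrite gE hE -mulmxA HH' mulmx1.
by rewrite hE gE -mulmxA H'H mulmx1.
Qed.

Lemma isomorphic_Lat_rank m n (A : lattice X m) (B : lattice X n) :
  isomorphic (Lat A) (Lat B) -> m = n.
Proof.
move=> /isomorphic_Lat[H [H' [HH' H'H _ _]]].
by apply/eqP; rewrite eqn_leq (mulmx1_min HH') (mulmx1_min H'H).
Qed.

Lemma mxOver_row_mx m n p (S : {pred F}) (a : 'M_(m, n)) (b : 'M_(m, p)) :
  (row_mx a b \is a mxOver S) = (a \is a mxOver S) && (b \is a mxOver S).
Proof.
apply/mxOverP/andP => [h|[/mxOverP ha /mxOverP hb] i j].
  split; apply/mxOverP => i j.
    by have := h i (lshift p j); rewrite row_mxEl.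
  by have := h i (rshift n j); rewrite row_mxEr.
by rewrite mxE; case: fintype.splitP.
Qed.

Lemma mxOver_col_mx m n p (S : {pred F}) (a : 'M_(m, p)) (b : 'M_(n, p)) :
  (col_mx a b \is a mxOver S) = (a \is a mxOver S) && (b \is a mxOver S).
Proof.
apply/mxOverP/andP => [h|[/mxOverP ha /mxOverP hb] i j].
  split; apply/mxOverP => i j.
    by have := h (lshift n i) j; rewrite col_mxEu.
  by have := h (rshift m i) j; rewrite col_mxEd.
by rewrite mxE; case: fintype.splitP.
Qed.

Section Block.
Variables (m n : nat) (B : lattice X m) (C : lattice X n).

Let M x := block_mx (B x) 0 0 (C x).
Let M' x := block_mx (invmx (B x)) 0 0 (invmx (C x)).

Let MM' x : M x *m M' x = 1%:M.
Proof.
rewrite /M /M' mulmx_block !mulmx0 !mul0mx !addr0 !add0r.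
by rewrite !mulmxV ?lat_unit // -scalar_mx_block.
Qed.

Let M_unit x : M x \in unitmx.
Proof. by have [] := mulmx1_unit (MM' x). Qed.

Let M_inv x : invmx (M x) = M' x.
Proof. by rewrite -[LHS]mulmx1 -(MM' x) mulKmx. Qed.

Let M_open : is_open [set x | unit_locus (M x) x].
Proof.
apply: is_openS (is_openI (lat_open B) (lat_open C)) _ => x /= [[b b'] [c c']].
have z p q : (0 : 'M[F]_(p, q)) \is a mxOver (valring x) by apply/mxOver0/rpred0.
split; rewrite /regular_locus /= ?M_inv /M /M' /block_mx mxOver_col_mx !mxOver_row_mx ?z ?andbT.
  by rewrite [_ \is a _]b [_ \is a _]c.
by rewrite [_ \is a _]b' [_ \is a _]c'.
Qed.

Definition lat_block : lattice X (m + n) := MkLattice M_unit M_open.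

Lemma Lat_dsum : isomorphic (dsum (Lat B) (Lat C)) (Lat lat_block).
Proof.
pose h U (s : dsum (Lat B) (Lat C) U) := mkLat lat_block U (row_mx (LatV s.1) (LatV s.2)).
have rM x v w : row_mx v w *m lat_block x = row_mx (v *m B x) (w *m C x).
  by rewrite /lat_block /= /M mul_row_block !mulmx0 addr0 add0r.
have hE U s : LatV (h U s) = row_mx (LatV s.1) (LatV s.2).
  rewrite /h mkLatK // => x Ux; rewrite rM mxOver_row_mx.
  by rewrite (LatVP s.1 Ux) (LatVP s.2 Ux).
exists h.
  split=> [U Uo a s t|U V VU Uo Vo s]; apply: LatV_inj; last by rewrite LatV_res !hE.
  by rewrite LatV_lin !hE /= scale_row_mx add_row_mx.
move=> U Uo; exists (fun s => (mkLat B U (lsubmx (LatV s)), mkLat C U (rsubmx (LatV s)))).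
  move=> [s t] /=; rewrite hE row_mxKl row_mxKr.
  by congr (_, _); apply: LatV_inj; rewrite mkLatK // => x Ux; exact: LatVP.
move=> s /=.
have sx x : U x -> (lsubmx (LatV s) *m B x \is a mxOver (valring x)) &&
    (rsubmx (LatV s) *m C x \is a mxOver (valring x)).
  by move=> Ux; have := LatVP s Ux; rewrite -{1}[LatV s]hsubmxK rM mxOver_row_mx.
apply: LatV_inj; rewrite hE /= !mkLatK ?hsubmxK // => x /sx /andP[] //.
Qed.

End Block.

Lemma block_unit1 m n (B : lattice X m) (C : lattice X n) x (v : 'rV_m) (w : 'rV_n) :
  row_mx v w *m lat_block B C x = row_mx (v *m B x) (w *m C x).
Proof. by rewrite /lat_block /= mul_row_block !mulmx0 addr0 add0r. Qed.

End LatticeHoms.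

(** * Vector bundles as lattices *)

Section LocalBasis.
Variables (k : fieldType) (X : curve k).
Local Notation F := (funField X).
Implicit Types (x : place X) (U V W : set (place X)).
Variables (E : premodule X) (n : nat).
Hypothesis Ep : is_presheaf E.

Definition is_basis W (f : 'I_n -> E W) := forall V (VW : V `<=` W), is_open V ->
  forall s : E V, exists! a : 'I_n -> Oring V, s = \sum_i a i *: res VW (f i).

Definition reg_vec V (v : 'rV[F]_n) := forall z, V z -> v \is a mxOver (valring z).

(** The coordinates are taken in F rather than in O(V), so that they can be compared over different
    opens and transformed by matrices. *)
Definition lincomb W (f : 'I_n -> E W) V (VW : V `<=` W) (v : 'rV[F]_n) : E V :=
  \sum_i mkO V (v 0 i) *: res VW (f i).

Lemma reg_vec_entry V v i : reg_vec V v -> forall z, V z -> v 0 i \in valring z.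
Proof. by move=> vV z /vV /mxOverP. Qed.

Lemma lincomb_res W (f : 'I_n -> E W) V V' (VW : V `<=` W) (V'V : V' `<=` V) (V'W : V' `<=` W) v :
  is_open W -> is_open V -> is_open V' -> reg_vec V v ->
  res V'V (lincomb f VW v) = lincomb f V'W v.
Proof.
move=> Wo Vo V'o vV; rewrite /lincomb (res_sum V'V Ep) //; apply: eq_bigr => i _.
rewrite (resZ V'V Ep) // (res_comp VW V'V V'W Ep) //; congr (_ *: _).
apply: Oval_inj; rewrite mkOK => [|z /V'V]; last exact: reg_vec_entry.
by rewrite [LHS]mkOK //; exact: reg_vec_entry.
Qed.

Lemma lincomb_lin W (f : 'I_n -> E W) V (VW : V `<=` W) (a : Oring V) v w :
  reg_vec V v -> reg_vec V w ->
  lincomb f VW (Oval a *: v + w) = a *: lincomb f VW v + lincomb f VW w.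
Proof.
move=> vV wV; rewrite /lincomb scaler_sumr -big_split; apply: eq_bigr => i _ /=.
rewrite scalerA -scalerDl; congr (_ *: _); apply: Oval_inj => /=.
have ve := reg_vec_entry i vV; have we := reg_vec_entry i wV.
rewrite [RHS]/= [in RHS]mkOK // [in RHS]mkOK // mkOK ?mxE // => z Vz.
by rewrite ?mxE rpredD ?we // rpredM ?ve //; exact: Oring_valring.
Qed.

Lemma lincomb_surj W (f : 'I_n -> E W) V (VW : V `<=` W) : is_basis f -> is_open V ->
  forall s : E V, exists v, reg_vec V v /\ s = lincomb f VW v.
Proof.
move=> fb Vo s; have [a [-> _]] := fb V VW Vo s.
have aE i : mkO V ((\row_j Oval (a j)) 0 i) = a i.
  by apply: Oval_inj; rewrite mxE mkOK // => z; exact: Oring_valring.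
exists (\row_i Oval (a i)); split.
  by move=> z Vz; apply/mxOverP => i j; rewrite mxE; exact: Oring_valring.
by apply: eq_bigr => i _; rewrite aE.
Qed.

Lemma lincomb_inj W (f : 'I_n -> E W) V (VW : V `<=` W) v w : is_basis f -> is_open V ->
  reg_vec V v -> reg_vec V w -> lincomb f VW v = lincomb f VW w -> v = w.
Proof.
move=> fb Vo vV wV e; have [a [_ au]] := fb V VW Vo (lincomb f VW v).
have := au (fun i => mkO V (v 0 i)) erefl; rewrite (au (fun i => mkO V (w 0 i)) e).
move=> aE; apply/rowP => i; have := congr1 (fun a => Oval (a i)) aE => /=.
by rewrite !mkOK //; exact: reg_vec_entry.
Qed.

Lemma is_basis_res W (f : 'I_n -> E W) W' (WW : W' `<=` W) : is_open W -> is_open W' ->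
  is_basis f -> is_basis (fun i => res WW (f i)).
Proof.
move=> Wo W'o fb V VW' Vo s; have VW : V `<=` W by apply: subset_trans WW.
have [a [sa au]] := fb V VW Vo s.
have rE i : res VW' (res WW (f i)) = res VW (f i) by rewrite (res_comp WW VW' VW Ep).
exists a; split=> [|b sb]; first by rewrite sa; apply: eq_bigr => i _; rewrite rE.
by apply: au; rewrite sb; apply: eq_bigr => i _; rewrite rE.
Qed.

End LocalBasis.

Section BundleLattice.
Variables (k : fieldType) (X : curve k).
Local Notation F := (funField X).
Implicit Types (x : place X) (U V W : set (place X)).

Lemma transition (E : premodule X) n U0 W (e : 'I_n -> E U0) (f : 'I_n -> E W) :
  is_presheaf E -> is_open U0 -> is_open W -> is_basis e -> is_basis f ->
  exists P Q : 'M[F]_n, [/\ P *m Q = 1%:M, Q *m P = 1%:M,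
    forall z, (U0 `&` W) z -> P \is a mxOver (valring z) /\ Q \is a mxOver (valring z) &
    forall V (V0 : V `<=` U0) (VW : V `<=` W) v, is_open V -> reg_vec V v ->
       lincomb e V0 v = lincomb f VW (v *m Q)].
Proof.
move=> Ep U0o Wo eb fb; pose V := U0 `&` W; have Vo : is_open V by apply: is_openI.
have V0 : V `<=` U0 := @subIsetl _ _ _; have VW : V `<=` W := @subIsetr _ _ _.
have /choice[p pP] := fun i => lincomb_surj VW fb Vo (res V0 (e i)).
have /choice[q qP] := fun i => lincomb_surj V0 eb Vo (res VW (f i)).
pose Q := \matrix_i p i; pose P := \matrix_i q i.
have Qreg z : V z -> Q \is a mxOver (valring z).
  by move=> Vz; apply/mxOverP => i j; rewrite mxE; have [/(_ z Vz)/mxOverP] := pP i.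
have Preg z : V z -> P \is a mxOver (valring z).
  by move=> Vz; apply/mxOverP => i j; rewrite mxE; have [/(_ z Vz)/mxOverP] := qP i.
(* A change of basis between two families over V, to be used in both directions. *)
have change (e1 e2 : set (place X)) (g1 : 'I_n -> E e1) (g2 : 'I_n -> E e2)
    (V1 : V `<=` e1) (V2 : V `<=` e2) (r : 'I_n -> 'rV[F]_n) :
    is_open e1 -> is_open e2 ->
    (forall i, reg_vec V (r i)) -> (forall i, res V1 (g1 i) = lincomb g2 V2 (r i)) ->
    forall V' (V'V : V' `<=` V) (V'1 : V' `<=` e1) (V'2 : V' `<=` e2) v, is_open V' -> reg_vec
      V' v ->
    lincomb g1 V'1 v = lincomb g2 V'2 (v *m \matrix_i r i).
  move=> o1 o2 rV rE V' V'V V'1 V'2 v V'o vV'.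
  have ve i := reg_vec_entry i vV'.
  have rV' i : reg_vec V' (r i) by move=> z /V'V /rV.
  rewrite {1}/lincomb.
  under eq_bigr do rewrite -(res_comp V1 V'V V'1 Ep) // rE (lincomb_res Ep g2 V2 V'V V'2) //.
  rewrite /lincomb; under eq_bigr do rewrite scaler_sumr.
  rewrite exchange_big; apply: eq_bigr => j _ /=.
  under eq_bigr do rewrite scalerA.
  rewrite -scaler_suml; congr (_ *: _); apply: Oval_inj.
  rewrite [LHS](big_morph (@Oval k X V') (id1 := 0) (op1 := +%R)) //.
  rewrite mkOK => [|z V'z]; last first.
    rewrite mxE rpred_sum // => i _; rewrite mxE rpredM ?ve //.
    exact: (reg_vec_entry j (rV' i)).
  rewrite mxE; apply: eq_bigr => i _; rewrite mxE [LHS]/= !mkOK //.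
    exact: (reg_vec_entry j (rV' i)).
  exact: ve.
have chQ := change _ _ e f V0 VW p U0o Wo (fun i => (pP i).1) (fun i => (pP i).2).
have chP := change _ _ f e VW V0 q Wo U0o (fun i => (qP i).1) (fun i => (qP i).2).
have VV : V `<=` V by [].
have rdelta i : reg_vec V (row i 1%:M).
  by move=> z _; apply/mxOverP => a b; rewrite !mxE; case: eqP => _; rewrite ?rpred1 ?rpred0.
have rM v (M : 'M[F]_n) : reg_vec V v -> (forall z, V z -> M \is a mxOver (valring z)) ->
    reg_vec V (v *m M).
  by move=> vV MV z Vz; rewrite mxOverM ?vV ?MV.
exists P, Q; split=> //.
- apply/row_matrixP => i; rewrite rowE -row1 -[RHS]mulmx1 mulmxA; apply/esym.
  rewrite mulmx1; apply: (lincomb_inj (VW := VW) fb) => //; first exact/rM/Qreg/rM.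
  by rewrite -(chQ V) // -?(chP V) //; exact: rM.
- apply/row_matrixP => i; rewrite rowE -row1 -[RHS]mulmx1 mulmxA; apply/esym.
  rewrite mulmx1; apply: (lincomb_inj (VW := V0) eb) => //; first exact/rM/Preg/rM.
  by rewrite -(chP V) // -?(chQ V) //; exact: rM.
- by move=> z Vz; split; [exact: Preg|exact: Qreg].
move=> V' V'0 V'W v V'o vV'.
have V'V : V' `<=` V by move=> z V'z; split; [exact: V'0|exact: V'W].
exact: chQ.
Qed.

(** A basis e over one open [U0] identifies the generic fibre with F^n, and the matrix at x is the
    transition from e to a basis [f x] around x. A section becomes its coordinate vector over [U0];
    gluing the local sections recovers it. *)
Lemma vector_bundle_Lat n (E : premodule X) : vector_bundle n E ->
  exists A : lattice X n, isomorphic E (Lat A).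
Proof.
move=> [Es El]; have Ep := Es.1; have [x0 _] := place_inhabited X.
have [U0 [U0o U0x0 [e eb]]] : exists U0, [/\ is_open U0, U0 x0 & exists e : 'I_n -> E U0,
  is_basis e].
  exact: El.
have loc x : exists Wf : {W : set (place X) & 'I_n -> E W}, [/\ is_open (projT1 Wf), projT1 Wf x,
    is_basis (projT2 Wf) & forall z, projT1 Wf z -> z = x \/ U0 z].
  (* Shrinking W leaves no point outside [U0] except possibly x, so that for distinct x and y the
     overlap of their neighbourhoods lies in [U0]. *)
  have [W [Wo Wx [f fb]]] := El x; pose W' := [set z | W z /\ (z = x \/ U0 z)].
  have WW : W' `<=` W by move=> z [].
  have W'o : is_open W'.
    by apply: is_openS (is_openI Wo U0o) _ => z [Wz U0z]; split=> //; right.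
  exists (existT _ W' (fun i => res WW (f i))); split=> //=.
  - by split=> //; left.
  - exact: is_basis_res.
  - by move=> z [].
have /choice[Wf WfP] := loc; pose W x := projT1 (Wf x).
pose f x : 'I_n -> E (W x) := projT2 (Wf x).
have Wo x : is_open (W x) by have [] := WfP x.
have Wx x : W x x by have [] := WfP x.
have fb x : is_basis (f x) by have [] := WfP x.
have WU0 x z : W x z -> z = x \/ U0 z by have [_ _ _] := WfP x; apply.
have /choice[P /choice[Q PQ]] := fun x => transition Ep U0o (Wo x) eb (fb x).
have Qu x : Q x \in unitmx by have [_ h _ _] := PQ x; have [] := mulmx1_unit h.
have Qinv x : invmx (Q x) = P x.
  by have [h _ _ _] := PQ x; rewrite -[LHS]mul1mx -h mulmxK.
have Qloc z x : U0 z -> W x z -> unit_locus (Q x) z.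
  move=> Uz Wz; have [_ _ /(_ z) h _] := PQ x.
  have [Pz Qz] : P x \is a mxOver (valring z) /\ Q x \is a mxOver (valring z) by apply: h; split.
  by split; rewrite /regular_locus /= ?Qinv.
have Ao : is_open [set x | unit_locus (Q x) x].
  by apply: is_openS U0o _ => z Uz; apply: Qloc.
pose A := MkLattice Qu Ao; exists A.
have ch x V (V0 : V `<=` U0) (VW : V `<=` W x) v : is_open V -> reg_vec V v ->
    lincomb e V0 v = lincomb (f x) VW (v *m Q x).
  by have [_ _ _] := PQ x; apply.
have regQ x V v : V `<=` U0 -> V `<=` W x -> reg_vec V v -> reg_vec V (v *m Q x).
  by move=> V0 VW vV z Vz; rewrite mxOverM ?vV //; have [] := Qloc z x (V0 z Vz) (VW z Vz).
have UU0o U : is_open U -> is_open (U `&` U0) by move=> Uo; apply: is_openI.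
have coor U (s : E U) : exists v, is_open U -> reg_vec (U `&` U0) v /\
    res (@subIsetl _ U U0) s = lincomb e (@subIsetr _ U U0) v.
  have [Uo|nUo] := pselect (is_open U); last by exists 0.
  have [v [vr ve]] := lincomb_surj (@subIsetr _ U U0) eb (UU0o U Uo) (res (@subIsetl _ U U0) s).
  by exists v.
pose c U s := projT1 (cid (coor U s)).
have cP U s : is_open U -> reg_vec (U `&` U0) (c U s) /\
    res (@subIsetl _ U U0) s = lincomb e (@subIsetr _ U U0) (c U s).
  by move=> Uo; rewrite /c; case: cid => v /= /(_ Uo).
have cu U s v : is_open U -> reg_vec (U `&` U0) v ->
    res (@subIsetl _ U U0) s = lincomb e (@subIsetr _ U U0) v -> c U s = v.
  move=> Uo vr ve; have [cr ce] := cP U s Uo.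
  by apply: (lincomb_inj (VW := @subIsetr _ U U0) eb (UU0o U Uo)) => //; rewrite -ce.
(* The coordinates near x are regular at x even when x is outside [U0]: being vectors over F, they
   are determined on the smaller open inside [U0], where the transition formula holds. *)
have cloc U s x : is_open U -> reg_vec (U `&` W x) (c U s *m Q x) /\
    res (@subIsetl _ U (W x)) s = lincomb (f x) (@subIsetr _ U (W x)) (c U s *m Q x).
  move=> Uo; have Vo : is_open (U `&` W x) by apply: is_openI.
  have [w [wr we]] := lincomb_surj (@subIsetr _ U (W x)) (fb x) Vo (res (@subIsetl _ U (W x)) s).
  suff -> : c U s *m Q x = w by [].
  pose V := (U `&` W x) `&` U0; have V'o : is_open V by apply: is_openI.
  have V1 : V `<=` U `&` W x by move=> z [].
  have V2 : V `<=` U `&` U0 by move=> z [[]].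
  have VU : V `<=` U by move=> z [[]].
  have VW : V `<=` W x by move=> z [[]].
  have V0 : V `<=` U0 by move=> z [].
  have [cr ce] := cP U s Uo.
  have crV : reg_vec V (c U s) by move=> z /V2; apply: cr.
  apply: (lincomb_inj (VW := VW) (fb x) V'o); first exact: regQ.
    by move=> z /V1; apply: wr.
  rewrite -(ch x V V0 VW) // -(lincomb_res Ep e (@subIsetr _ U U0) V2 V0) //; last exact: UU0o.
  rewrite -ce -(lincomb_res Ep (f x) (@subIsetr _ U (W x)) V1 VW) // -we.
  by rewrite !(res_comp _ _ VU Ep) //; exact: UU0o.
have cLat U s : is_open U -> forall x, U x -> c U s *m A x \is a mxOver (valring x).
  by move=> Uo x Ux; have [cr _] := cloc U s x Uo; apply: cr.
pose h U (s : E U) : Lat A U := mkLat A U (c U s).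
have hE U s : is_open U -> LatV (h U s) = c U s.
  by move=> Uo; rewrite mkLatK //; exact: cLat.
exists h.
  split=> [U Uo a s t|U V VU Uo Vo s]; apply: LatV_inj.
    rewrite LatV_lin !hE //; have [sr se] := cP U s Uo; have [tr te] := cP U t Uo.
    have aE : Oval a = Oval (Ores (@subIsetl _ U U0) a) by [].
    apply: cu => //.
      move=> z Uz; rewrite rpredD ?tr //; apply/mxOverP => i j; rewrite mxE rpredM //.
        by case: Uz => Uz _; exact: Oring_valring.
      by have /mxOverP := sr z Uz.
    by rewrite aE lincomb_lin // (res_lin _ Ep) ?se ?te //; exact: UU0o.
  rewrite LatV_res !hE //; have [sr se] := cP U s Uo.
  have V1 : V `&` U0 `<=` U `&` U0 by move=> z [/VU].
  have V2 : V `&` U0 `<=` U by move=> z [/VU].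
  apply: cu => //; first by move=> z /V1; apply: sr.
  have oU := UU0o U Uo; have oV := UU0o V Vo.
  rewrite -(lincomb_res Ep e (@subIsetr _ U U0) V1 (@subIsetr _ V U0)) // -se.
  by rewrite !(res_comp _ _ V2 Ep).
move=> U Uo.
have h_inj : injective (h U).
  move=> s t /(congr1 (@LatV _ _ _ A U)); rewrite !hE // => e'.
  apply: (sheaf_eq Es Uo Wo Wx) => x.
  by have [_ ->] := cloc U s x Uo; have [_ ->] := cloc U t x Uo; rewrite e'.
have h_surj (t : Lat A U) : exists s, h U s = t.
  pose v := LatV t.
  have vr x : reg_vec (U `&` W x) (v *m Q x).
    move=> z [Uz Wz]; case: (WU0 x z Wz) => [zx|U0z].
      by rewrite zx in Uz *; exact: (LatVP t Uz).
    have [q1 _] := Qloc z x U0z Wz; have [_ q2] := Qloc z z U0z (Wx z).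
    rewrite mxOverM //; have := LatVP t Uz; rewrite -/v /= => vz.
    by rewrite -(mulmxK (Qu z) v) mxOverM.
  have [|s [sE _]] := @sheaf_glue _ _ E W U Es Uo Wo Wx
      (fun x => lincomb (f x) (@subIsetr _ U (W x)) (v *m Q x)).
    move=> x y V V1 V2 Vo.
    have oUx : is_open (U `&` W x) by apply: is_openI.
    have oUy : is_open (U `&` W y) by apply: is_openI.
    have VWx : V `<=` W x by move=> z /V1[].
    have VWy : V `<=` W y by move=> z /V2[].
    rewrite (lincomb_res Ep (f x) _ V1 VWx) // (lincomb_res Ep (f y) _ V2 VWy) //.
    (* Only for x = y can the overlap leave [U0], and then there is nothing to compare. *)
    have [xy|xy] := eqVneq x y; first by subst y; rewrite (Prop_irrelevance VWx VWy).
    have V0 : V `<=` U0.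
      move=> z Vz; case: (WU0 x z (VWx z Vz)) => // zx; case: (WU0 y z (VWy z Vz)) => // zy.
      by rewrite -zx -zy eqxx in xy.
    have vV : reg_vec V v.
      move=> z Vz; have [_ q2] := Qloc z z (V0 z Vz) (Wx z).
      have Uz : U z by case: (V1 z Vz).
      by rewrite -(mulmxK (Qu z) v) mxOverM //; exact: (LatVP t Uz).
    by rewrite -!(ch _ _ V0).
  exists s; apply: LatV_inj; rewrite hE //; apply: cu => //.
    move=> z [Uz U0z]; have [_ q2] := Qloc z z U0z (Wx z).
    by rewrite -/v -(mulmxK (Qu z) v) mxOverM //; exact: (LatVP t Uz).
  rewrite -/v; have oU := UU0o U Uo; apply: (sheaf_eq Es oU Wo Wx) => x.
  pose V := (U `&` U0) `&` W x; have Vo : is_open V by apply: is_openI.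
  have V1 : V `<=` U `&` W x by move=> z [[]].
  have VU : V `<=` U by move=> z [[]].
  have VW : V `<=` W x by move=> z [].
  have V0 : V `<=` U0 by move=> z [[]].
  have oUx : is_open (U `&` W x) by apply: is_openI.
  have vU0 : reg_vec (U `&` U0) v.
    move=> z [Uz U0z]; have [_ q2] := Qloc z z U0z (Wx z).
    by rewrite -(mulmxK (Qu z) v) mxOverM //; exact: (LatVP t Uz).
  rewrite (res_comp _ _ VU Ep) // -(res_comp (@subIsetl _ U (W x)) V1 VU Ep) // sE.
  rewrite (lincomb_res Ep (f x) _ V1 VW) // (lincomb_res Ep e _ _ V0) //.
  by rewrite -(ch x V V0 VW) // => z [Vz _]; apply: vU0.
have /choice[g gK] := h_surj.
by exists g => // s; apply: h_inj; rewrite gK.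
Qed.

End BundleLattice.

(** * Line bundles and tensor products *)

Section Ideles.
Variables (k : fieldType) (X : curve k).
Local Notation F := (funField X).
Implicit Types (x : place X) (U V W : set (place X)) (a b : lattice X 1).

Lemma mxOver11 (S : {pred F}) (M : 'M[F]_1) : (M \is a mxOver S) = (M 0 0 \in S).
Proof. by apply/mxOverP/idP => [->//|h i j]; rewrite !ord1. Qed.

Lemma idele_neq0 a x : a x 0 0 != 0.
Proof. by have := lat_unit a x; rewrite unitmxE det_mx11 unitfE. Qed.

Lemma invmx11 (M : 'M[F]_1) : invmx M 0 0 = (M 0 0)^-1.
Proof. by rewrite [M in LHS]mx11_scalar invmx_scalar mxE eqxx. Qed.

Lemma unit_locus11 (M : 'M[F]_1) x :
  unit_locus M x <-> M 0 0 \in valring x /\ (M 0 0)^-1 \in valring x.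
Proof. by rewrite /unit_locus /regular_locus /= !mxOver11 invmx11. Qed.

Lemma idele_open a : is_open [set x | a x 0 0 \in valring x /\ (a x 0 0)^-1 \in valring x].
Proof. by apply: is_openS (lat_open a) _ => x /unit_locus11. Qed.

Lemma idele_exists (f : place X -> F) : (forall x, f x != 0) ->
  is_open [set x | f x \in valring x /\ (f x)^-1 \in valring x] ->
  exists a : lattice X 1, forall x, a x 0 0 = f x.
Proof.
move=> f0 fo; have u x : (f x)%:M \in @unitmx F 1.
  by rewrite unitmxE det_scalar1 unitfE.
have o : is_open [set x | unit_locus ((f x)%:M : 'M_1) x].
  by apply: is_openS fo _ => x /= h; apply/unit_locus11; rewrite mxE eqxx.
by exists (MkLattice u o) => x; rewrite /= mxE eqxx.
Qed.

Lemma idele_mul a b : exists c : lattice X 1, forall x, c x 0 0 = a x 0 0 * b x 0 0.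
Proof.
apply: idele_exists => [x|]; first by rewrite mulf_neq0 ?idele_neq0.
apply: is_openS (is_openI (idele_open a) (idele_open b)) _ => x /= [[a1 a2] [b1 b2]].
by rewrite invfM !rpredM.
Qed.

Lemma idele_inv a : exists c : lattice X 1, forall x, c x 0 0 = (a x 0 0)^-1.
Proof.
apply: idele_exists => [x|]; first by rewrite invr_eq0 idele_neq0.
by apply: is_openS (idele_open a) _ => x /= [a1 a2]; rewrite invrK.
Qed.

Lemma idele_one : exists c : lattice X 1, forall x, c x 0 0 = 1.
Proof.
apply: idele_exists => [x|]; first exact: oner_neq0.
by apply: is_openS (@is_openT _ X) _ => x _ /=; rewrite invr1 rpred1.
Qed.

Section Twist.
Variables (n : nat) (a : lattice X 1) (A : lattice X n).

Let twist_unit x : a x 0 0 *: A x \in unitmx.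
Proof. by rewrite unitmxZ ?lat_unit // unitfE idele_neq0. Qed.

Let twist_open : is_open [set x | unit_locus (a x 0 0 *: A x) x].
Proof.
apply: is_openS (is_openI (idele_open a) (lat_open A)) _ => x /= [[a1 a2] [A1 A2]].
split; rewrite /regular_locus /= ?invmxZ ?twist_unit //; apply/mxOverP => i j; rewrite mxE
  rpredM //.
  exact/mxOverP/A1.
exact/mxOverP/A2.
Qed.

Definition lat_twist : lattice X n := MkLattice twist_unit twist_open.
End Twist.

(** The relation on lattices that corresponds to equality in PBun_n; one equality of memberships
    covers both H and its inverse. *)
Definition lat_sim n (A B : lattice X n) := exists (a : lattice X 1) (H : 'M[F]_n), H \in unitmx /\
  forall x (v : 'rV_n), (v *m A x \is a mxOver (valring x)) =
    (a x 0 0 *: (v *m H *m B x) \is a mxOver (valring x)).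

Lemma lat_simP n (A B : lattice X n) :
  lat_sim A B <-> exists a, isomorphic (Lat A) (Lat (lat_twist a B)).
Proof.
split=> [[a [H [Hu HE]]]|[a /isomorphic_Lat[H [H' [HH' H'H AB BA]]]]].
  exists a; apply/isomorphic_Lat; exists H, (invmx H).
  rewrite mulmxV // mulVmx //; split=> // x v.
    by rewrite HE -scalemxAr.
  by move=> h; rewrite HE mulmxKV // scalemxAr.
exists a, H; split; first by have [] := mulmx1_unit HH'.
move=> x v; apply/idP/idP => [/AB|]; first by rewrite -scalemxAr.
by rewrite scalemxAr => /BA; rewrite -(mulmxA v) HH' mulmx1.
Qed.

Lemma lat_sim_sym n (A B : lattice X n) : lat_sim A B -> lat_sim B A.
Proof.
move=> [a [H [Hu HE]]]; have [b bE] := idele_inv a; exists b, (invmx H).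
rewrite unitmx_inv; split=> // x v; rewrite bE.
have -> : (a x 0 0)^-1 *: (v *m invmx H *m A x) = (a x 0 0)^-1 *: v *m invmx H *m A x.
  by rewrite -!scalemxAl.
by rewrite HE mulmxKV // -scalemxAl scalerA divff ?idele_neq0 // scale1r.
Qed.

Lemma lat_sim_trans n (A B C : lattice X n) : lat_sim A B -> lat_sim B C -> lat_sim A C.
Proof.
move=> [a [H [Hu HE]]] [b [K [Ku KE]]]; have [c cE] := idele_mul a b.
exists c, (H *m K); split; first by rewrite unitmx_mul Hu.
move=> x v; rewrite HE scalemxAl KE cE -!scalemxAl scalerA [b x 0 0 * _]mulrC.
by rewrite mulmxA.
Qed.

Lemma lat_sim_twist n a (A : lattice X n) : lat_sim (lat_twist a A) A.
Proof. by exists a, 1%:M; rewrite unitmx1; split=> // x v; rewrite mulmx1 -scalemxAr. Qed.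

Lemma lat_sim_refl n (A : lattice X n) : lat_sim A A.
Proof.
have [c cE] := idele_one; exists c, 1%:M; rewrite unitmx1; split=> // x v.
by rewrite mulmx1 cE scale1r.
Qed.

Lemma lat_sim_iso n (A B : lattice X n) : isomorphic (Lat A) (Lat B) -> lat_sim A B.
Proof.
move=> /isomorphic_Lat[H [H' [HH' H'H AB BA]]]; have [c cE] := idele_one.
exists c, H; split; first by have [] := mulmx1_unit HH'.
move=> x v; rewrite cE scale1r; apply/idP/idP => [/AB//|/BA].
by rewrite -(mulmxA v) HH' mulmx1.
Qed.

End Ideles.

Section Tensor.
Variables (k : fieldType) (X : curve k).
Local Notation F := (funField X).
Implicit Types (x : place X) (U V W : set (place X)) (M N T E : premodule X).

Section Bilinear.
Variables (M N E : premodule X) (b : forall U, M U -> N U -> E U).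
Hypothesis bb : is_bilinear b.
Variables (U : set (place X)) (Uo : is_open U).

Lemma bil0l t : b (0 : M U) t = 0.
Proof.
by have [b1 _ _] := bb; have := b1 U Uo (-1) 0 0 t; rewrite scaleN1r addr0 oppr0 scaleN1r addNr.
Qed.
Lemma bil0r s : b s (0 : N U) = 0.
Proof.
by have [_ b2 _] := bb; have := b2 U Uo (-1) s 0 0; rewrite scaleN1r addr0 oppr0 scaleN1r addNr.
Qed.
Lemma bilZl a s t : b (a *: s : M U) t = a *: b s t.
Proof. by have [b1 _ _] := bb; have := b1 U Uo a s 0 t; rewrite !addr0 bil0l addr0. Qed.
Lemma bilZr a s t : b s (a *: t : N U) = a *: b s t.
Proof. by have [_ b2 _] := bb; have := b2 U Uo a s t 0; rewrite !addr0 bil0r addr0. Qed.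
End Bilinear.

Lemma tensor_iso_args M M' N N' T : is_tensor M N T -> isomorphic M M' ->
  isomorphic N N' -> is_tensor M' N' T.
Proof.
move=> [Ts [b [b1 b2 b3] univ]] /isomorphicP[h [g [hh gh hg gh']]].
move=> /isomorphicP[h2 [g2 [hh2 gh2 hg2 gh2']]]; split=> //.
exists (fun U s t => b U (g U s) (g2 U t)).
  split=> [U Uo a s s' t|U Uo a s t t'|U V VU Uo Vo s t].
  - by rewrite gh.1 // b1.
  - by rewrite gh2.1 // b2.
  - by rewrite gh.2 // gh2.2 // b3.
move=> G Gs c [c1 c2 c3].
have cb : is_bilinear (fun U s t => c U (h U s) (h2 U t)).
  split=> [U Uo a s s' t|U Uo a s t t'|U V VU Uo Vo s t].
  - by rewrite hh.1 // c1.
  - by rewrite hh2.1 // c2.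
  - by rewrite hh.2 // hh2.2 // c3.
have [f [fh fb funiq]] := univ G Gs _ cb; exists f; split=> //.
  by move=> U Uo s t; rewrite fb // gh' // gh2'.
move=> f' f'h f'b; apply: funiq => // U Uo s t.
by rewrite -f'b // hg // hg2.
Qed.

Lemma tensor_unique M N T T' : is_tensor M N T -> is_tensor M N T' -> isomorphic T T'.
Proof.
move=> [Ts [b bb univ]] [T's [b' bb' univ']].
have [f [fh fb _]] := univ T' T's b' bb'; have [f' [f'h f'b _]] := univ' T Ts b bb.
have [e [_ _ eu]] := univ T Ts b bb; have [e' [_ _ eu']] := univ' T' T's b' bb'.
apply/isomorphicP; exists f, f'; split=> //.
- move=> U Uo s.
  rewrite [LHS](eu (fun U s => f' U (f U s)) (comp_hom fh f'h) _ U Uo s); last first.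
    by move=> V Vo s' t; rewrite fb // f'b.
  by rewrite -(eu (fun U s => s) (@id_hom _ _ T)).
- move=> U Uo s.
  rewrite [LHS](eu' (fun U s => f U (f' U s)) (comp_hom f'h fh) _ U Uo s); last first.
    by move=> V Vo s' t; rewrite f'b // fb.
  by rewrite -(eu' (fun U s => s) (@id_hom _ _ T')).
Qed.

Lemma tensor_iso M N T T' : is_tensor M N T -> is_sheaf T' -> isomorphic T T' ->
  is_tensor M N T'.
Proof.
move=> [Ts [b [b1 b2 b3] univ]] T's /isomorphicP[h [g [hh gh hg gh']]]; split=> //.
exists (fun U s t => h U (b U s t)).
  split=> [U Uo a s s' t|U Uo a s t t'|U V VU Uo Vo s t].
  - by rewrite b1 // hh.1.
  - by rewrite b2 // hh.1.
  - by rewrite b3 // hh.2.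
move=> G Gs c cb; have [f [fh fb fu]] := univ G Gs c cb.
exists (fun U s => f U (g U s)); split; first exact: comp_hom.
  by move=> U Uo s t; rewrite hg // fb.
move=> f' f'h f'b U Uo s; rewrite -{1}(gh' U Uo s).
by apply: (fu (fun U s => f' U (h U s))) => //; exact: comp_hom.
Qed.

Variables (n : nat) (A : lattice X n) (a : lattice X 1).

Let nb := lat_nbhs a.
Let gen x U : Lat a U := lat_basis a x U 0.
Let genE x U : U `<=` nb x -> LatV (gen x U) 0 0 = (a x 0 0)^-1.
Proof. by move=> Ux; rewrite lat_basisK // mxE invmx11. Qed.

Let nbE x z : nb x z -> (a x 0 0)^-1 * a z 0 0 \in valring z /\
  a x 0 0 * (a z 0 0)^-1 \in valring z.
Proof.
move=> /unit_locus11; rewrite !mxE big_ord1 invmx11 => -[h1 h2]; split=> //.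
by move: h2; rewrite invfM invrK.
Qed.

(** Near x, [Lat a] is generated by the section 1 / a_x, and a section v of the twist is the product
    of a_x v, a section of [Lat A], with this generator. *)
Let shrink x U (v : Lat (lat_twist a A) U) : Lat A U := mkLat A U (a x 0 0 *: LatV v).

Let shrinkE x U (v : Lat (lat_twist a A) U) : U `<=` nb x ->
  LatV (shrink x v) = a x 0 0 *: LatV v.
Proof.
move=> Ux; rewrite mkLatK // => z Uz; have [_ h2] := nbE (Ux z Uz).
have := LatVP v Uz; rewrite /= -scalemxAr => h.
have -> : a x 0 0 *: LatV v *m A z = (a x 0 0 * (a z 0 0)^-1) *: (a z 0 0 *: (LatV v *m A z)).
  by rewrite -scalemxAl !scalerA divfK // idele_neq0.
by apply/mxOverP => i j; rewrite mxE rpredM //; exact/mxOverP.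
Qed.

Let Lat1E U (s t : Lat a U) : LatV s 0 0 = LatV t 0 0 -> s = t.
Proof. by move=> e; apply: LatV_inj; apply/rowP => i; rewrite ord1. Qed.

(** Near x, a map through which c factors has to send v to [c (shrink x v) (gen x)]. Replacing x by
    y moves the unit r = a_x / a_y from one argument to the other, so these formulas agree and
    glue. *)
Lemma Lat_tensor : is_tensor (Lat A) (Lat a) (Lat (lat_twist a A)).
Proof.
split; first exact: Lat_sheaf.
pose b U (s : Lat A U) (t : Lat a U) := mkLat (lat_twist a A) U (LatV t 0 0 *: LatV s).
have bE U s t : LatV (b U s t) = LatV t 0 0 *: LatV s.
  rewrite mkLatK // => x Ux; rewrite /= -scalemxAr -scalemxAl scalerA.
  have := LatVP t Ux; rewrite mxOver11 mxE big_ord1 => tx.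
  apply/mxOverP => i j; rewrite mxE mulrC rpredM //; last by rewrite mulrC.
  exact/mxOverP/LatVP.
have bb : is_bilinear b.
  split=> [U Uo r s s' t|U Uo r s t t'|U V VU Uo Vo s t]; apply: LatV_inj.
  - by rewrite LatV_lin !bE LatV_lin scalerDr !scalerA mulrC.
  - by rewrite LatV_lin !bE LatV_lin !mxE scalerDl scalerA.
  - by rewrite LatV_res !bE !LatV_res.
exists b => // G Gs c cb; have [c1 c2 c3] := cb.
have nbo x : is_open (nb x) := lat_nbhs_open a x.
have nbx x : nb x x := lat_nbhs_self a x.
pose cl x U (v : Lat (lat_twist a A) U) := c U (shrink x v) (gen x U).
have genR x U V (VU : V `<=` U) : U `<=` nb x -> res VU (gen x U) = gen x V.
  exact: lat_basis_res.
have shrR x U V (VU : V `<=` U) v : U `<=` nb x -> res VU (shrink x v) = shrink x (res VU v).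
  move=> Ux; apply: LatV_inj; rewrite LatV_res !shrinkE ?LatV_res //.
  exact: subset_trans Ux.
have [|||h [hh hE]] := @glue_hom _ _ (Lat (lat_twist a A)) G nb cl (Lat_presheaf _) Gs nbo nbx.
- move=> x U Uo Ux r s t; rewrite /cl -c1 //; congr (c _ _ _); apply: LatV_inj.
  by rewrite LatV_lin !shrinkE // LatV_lin scalerDr !scalerA mulrC.
- by move=> x U V VU Uo Vo Ux s; rewrite /cl -c3 // genR // shrR.
- move=> x y U Uo Ux Uy s; rewrite /cl.
  pose r := mkO U (a x 0 0 / a y 0 0).
  have rE : Oval r = a x 0 0 / a y 0 0.
    apply: mkOK => z Uz; have [x1 x2] := nbE (Ux z Uz); have [y1 y2] := nbE (Uy z Uz).
    have -> : a x 0 0 / a y 0 0 = (a x 0 0 * (a z 0 0)^-1) * ((a y 0 0)^-1 * a z 0 0).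
      by field; rewrite !idele_neq0.
    exact: rpredM.
  have -> : shrink x s = r *: shrink y s.
    apply: LatV_inj; rewrite LatVZ !shrinkE // scalerA rE divfK //; exact: idele_neq0.
  have -> : gen y U = r *: gen x U.
    apply: Lat1E; rewrite LatVZ mxE !genE // rE mulrAC divff ?mul1r //; exact: idele_neq0.
  by rewrite (bilZl cb) // (bilZr cb).
have bl x U : is_open U -> U `<=` nb x -> forall v : Lat (lat_twist a A) U, v = b U (shrink x
  v) (gen x U).
  move=> Uo Ux v; apply: LatV_inj; rewrite bE shrinkE // genE // scalerA mulVf ?scale1r //.
  exact: idele_neq0.
exists h; split=> //.
  move=> U Uo s t; apply: (sheaf_eq Gs Uo nbo nbx) => x.
  have Vo : is_open (U `&` nb x) by apply: is_openI.
  have Vx : U `&` nb x `<=` nb x := @subIsetr _ _ _.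
  have [_ _ b3] := bb; rewrite -(hom_res _ hh) // -c3 // -b3 //.
  move: (res _ s) (res _ t) => {}s {}t; rewrite (hE x) // /cl.
  pose r := mkO (U `&` nb x) (a x 0 0 * LatV t 0 0).
  have rE : Oval r = a x 0 0 * LatV t 0 0.
    apply: mkOK => z Vz; have [_ x2] := nbE (Vx z Vz).
    have := LatVP t Vz; rewrite mxOver11 mxE big_ord1 => tz.
    have -> : a x 0 0 * LatV t 0 0 = (a x 0 0 * (a z 0 0)^-1) * (LatV t 0 0 * a z 0 0).
      by field; rewrite idele_neq0.
    exact: rpredM.
  have -> : shrink x (b _ s t) = r *: s.
    by apply: LatV_inj; rewrite LatVZ shrinkE // bE scalerA rE.
  have <- : r *: gen x (U `&` nb x) = t.
    by apply: Lat1E; rewrite LatVZ mxE genE // rE mulrAC divff ?mul1r // idele_neq0.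
  by rewrite (bilZl cb) // (bilZr cb).
move=> h' h'h h'b; apply: (hom_eq_local Gs h'h hh nbo nbx) => x U Uo Ux v.
by rewrite (hE x) // {1}(bl x U Uo Ux v) h'b.
Qed.

End Tensor.

Section ProjectiveClasses.
Variables (k : fieldType) (X : curve k).
Implicit Types (E : premodule X) (A : lattice X 2).

Lemma pbun_classE E A E' : isomorphic E (Lat A) ->
  pbun_class E E' <-> vector_bundle 2 E' /\
    exists a, isomorphic E' (Lat (lat_twist a A)).
Proof.
move=> EA; split=> [[E'b [L /vector_bundle_Lat[a La] ELE']]|[E'b [a E'a]]]; split=> //.
  exists a; apply: tensor_unique ELE' _.
  apply: tensor_iso_args (Lat_tensor A a) _ _; exact: isomorphic_sym.
exists (Lat a); first exact: Lat_vector_bundle.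
apply: tensor_iso E'b.1 (isomorphic_sym E'a).
apply: tensor_iso_args (Lat_tensor A a) _ (isomorphic_refl _); exact: isomorphic_sym.
Qed.

(** Through this lemma the fibres and the image of the map become questions on lattices up to
    similarity. *)
Lemma pbun_class_eq E A E1 A1 : isomorphic E (Lat A) -> isomorphic E1 (Lat A1) ->
  pbun_class E = pbun_class E1 <-> lat_sim A A1.
Proof.
move=> EA EA1; split=> [e|AA1].
  have : pbun_class E (Lat A).
    apply/(pbun_classE _ EA); split; first exact: Lat_vector_bundle.
    exact/lat_simP/lat_sim_refl.
  by rewrite e => /(pbun_classE _ EA1)[_ h]; apply/lat_simP.
have tw B B1 E' : lat_sim B B1 ->
    (exists a, isomorphic E' (Lat (lat_twist a B))) ->
    exists a, isomorphic E' (Lat (lat_twist a B1)).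
  move=> BB1 [a ia]; have /lat_simP[b ib] : lat_sim (lat_twist a B) B1.
    exact: lat_sim_trans (lat_sim_twist _ _) BB1.
  by exists b; apply: isomorphic_trans ia ib.
apply: funext => E'; apply: propext; split.
  by move=> /(pbun_classE _ EA)[vb h]; apply/(pbun_classE _ EA1); split=> //; apply: tw h.
move=> /(pbun_classE _ EA1)[vb h]; apply/(pbun_classE _ EA); split=> //.
exact: tw (lat_sim_sym AA1) h.
Qed.

End ProjectiveClasses.

(** * Pullback of lattices *)

Section Pullback.
Variables (k k' : fieldType) (i : {rmorphism k -> k'}).
Variables (X : curve k) (X' : curve k') (p : base_change i X X').
Local Notation F := (funField X).
Local Notation F' := (funField X').
Implicit Types (U : set (place X)) (V : set (place X')).

Lemma preimE U y : Defs.preim p U y <-> U (under p y).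
Proof.
split=> [[x Ux /lies_over_under->//]|Uy].
by exists (under p y) => //; exact: underP.
Qed.

Lemma preim_open U : is_open U -> is_open (Defs.preim p U).
Proof.
move=> Uo; rewrite /is_open.
apply: (@sub_finite_set _ _ (\bigcup_(x in ~` U) [set y | under p y = x])).
  by move=> y /= nU; exists (under p y) => // Uy; apply/nU/preimE.
by apply: bigcup_finite => // x _; exact: bc_finite_over.
Qed.

Lemma mxOver_map m n (M : 'M[F]_(m, n)) y :
  (map_mx p M \is a mxOver (valring y)) = (M \is a mxOver (valring (under p y))).
Proof.
apply/mxOverP/mxOverP => h a b.
  by have := h a b; rewrite mxE under_valring.
by rewrite mxE under_valring.
Qed.

Lemma unit_locus_map n (M : 'M[F]_n) y : unit_locus (map_mx p M) y <-> unit_locus M (under p y).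
Proof. by rewrite /unit_locus /regular_locus /= -map_invmx !mxOver_map. Qed.

Section PullLattice.
Variables (n : nat) (A : lattice X n).

Let pull_unit y : map_mx p (A (under p y)) \in unitmx.
Proof. by rewrite map_unitmx lat_unit. Qed.

Let pull_open : is_open [set y | unit_locus (map_mx p (A (under p y))) y].
Proof.
by apply: is_openS (preim_open (lat_open A)) _ => y /preimE /= h; apply/unit_locus_map.
Qed.

Definition lat_pull : lattice X' n := MkLattice pull_unit pull_open.

Lemma lat_pull_nbhs y : Defs.preim p (lat_nbhs A (under p y)) `<=` lat_nbhs lat_pull y.
Proof.
move=> z /preimE h; rewrite /lat_nbhs /= -map_invmx -map_mxM.
exact/unit_locus_map.
Qed.

End PullLattice.

Lemma pullback_iso_arg E M E' : is_pullback p E E' -> isomorphic E M -> is_pullback p M E'.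
Proof.
move=> [E's [eta etah univ]] /isomorphicP[h [g [hh gh hg gh']]]; split=> //.
exists (fun U s => eta U (g U s)); first exact: comp_hom gh etah.
move=> G Gs c ch; have [f [fh fe fu]] := univ G Gs _ (comp_hom hh ch).
exists f; split=> //; first by move=> U Uo s; rewrite fe // gh'.
move=> f' f'h f'e; apply: fu => // U Uo s.
by rewrite -{1}(hg U Uo s) f'e.
Qed.

Lemma pullback_unique E E' E'' : is_pullback p E E' -> is_pullback p E E'' -> isomorphic E' E''.
Proof.
move=> [Ts [b bb univ]] [T's [b' bb' univ']].
have [f [fh fb _]] := univ _ T's b' bb'; have [f' [f'h f'b _]] := univ' _ Ts b bb.
have [e [_ _ eu]] := univ _ Ts b bb; have [e' [_ _ eu']] := univ' _ T's b' bb'.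
apply/isomorphicP; exists f, f'; split=> //.
- move=> V Vo s.
  rewrite [LHS](eu (fun V s => f' V (f V s)) (comp_hom fh f'h) _ V Vo s); last first.
    by move=> U Uo s'; have := fb U Uo s'; rewrite /pushforward_hom => ->; exact: f'b.
  by rewrite -(eu (fun V s => s) (@id_hom _ _ E')).
- move=> V Vo s.
  rewrite [LHS](eu' (fun V s => f V (f' V s)) (comp_hom f'h fh) _ V Vo s); last first.
    by move=> U Uo s'; have := f'b U Uo s'; rewrite /pushforward_hom => ->; exact: fb.
  by rewrite -(eu' (fun V s => s) (@id_hom _ _ E'')).
Qed.

Section LatPullback.
Variables (n : nat) (A : lattice X n).
Local Notation pA := (lat_pull A).

Let eta U (s : Lat A U) : Lat pA (Defs.preim p U) := mkLat pA (Defs.preim p U) (map_mx p (LatV s)).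

Let etaE U (s : Lat A U) : LatV (eta s) = map_mx p (LatV s).
Proof.
rewrite mkLatK // => y /preimE Uy; rewrite /= -map_mxM mxOver_map.
exact: LatVP.
Qed.

Let W (y : place X') := Defs.preim p (lat_nbhs A (under p y)).
Let Wo y : is_open (W y). Proof. exact/preim_open/lat_nbhs_open. Qed.
Let Wy y : W y y. Proof. apply/preimE; exact: lat_nbhs_self. Qed.

Let Wn y V : V `<=` W y -> V `<=` lat_nbhs pA y.
Proof. by move=> VW; apply: subset_trans VW _; exact: lat_pull_nbhs. Qed.

Section Universal.
Variables (G : premodule X') (Gs : is_sheaf G).
Variable c : forall U, Lat A U -> pushforward p G U.
Hypothesis ch : is_hom c.

Let cG U (s : Lat A U) : G (Defs.preim p U) := c s.
Let cb y j : G (W y) := cG (lat_basis A (under p y) (lat_nbhs A (under p y)) j).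

Let cGD U : is_open U -> forall s t : Lat A U, cG (s + t) = cG s + cG t.
Proof. by move=> Uo s t; exact: (homD ch Uo). Qed.
Let cG0 U : is_open U -> cG (0 : Lat A U) = 0.
Proof. by move=> Uo; exact: (hom0 ch Uo). Qed.
Let cGZ U : is_open U -> forall a (s : Lat A U), cG (a *: s) = psharp p a *: cG s.
Proof. by move=> Uo a s; exact: (homZ ch Uo). Qed.
Let cG_res U U' (U'U : U' `<=` U) : is_open U -> is_open U' -> forall s : Lat A U,
  cG (res U'U s) = res (preimS U'U) (cG s).
Proof. by move=> Uo U'o s; exact: (hom_res U'U ch Uo U'o). Qed.

Let coords y V (v : Lat pA V) j : Oring V := mkO V ((LatV v *m pA y) 0 j).

Let coordsE y V (v : Lat pA V) j : V `<=` W y -> Oval (coords y v j) = (LatV v *m pA y) 0 j.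
Proof.
by move=> VW; apply: mkOK => z Vz; exact: (lat_coord_regular v (Wn VW)).
Qed.

(** Near y the pulled back basis generates, so this is the only possible value of the induced map.
    Restricting [cb] requires a proof of [V <= W y], hence the case distinction with default 0. *)
Let cl y V (v : Lat pA V) : G V :=
  match pselect (V `<=` W y) with
  | left VW => \sum_j coords y v j *: res VW (cb y j)
  | right _ => 0
  end.

Let clE y V (VW : V `<=` W y) (v : Lat pA V) :
  cl y v = \sum_j coords y v j *: res VW (cb y j).
Proof. by rewrite /cl; case: pselect => // VW'; rewrite (Prop_irrelevance VW' VW). Qed.

Let cl_lin y V : V `<=` W y -> forall a (s t : Lat pA V),
  cl y (a *: s + t) = a *: cl y s + cl y t.
Proof.
move=> VW a s t; rewrite !(clE VW) scaler_sumr -big_split; apply: eq_bigr => j _ /=.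
rewrite scalerA -scalerDl; congr (_ *: _); apply: Oval_inj.
by rewrite /= !coordsE // LatV_lin mulmxDl -scalemxAl !mxE.
Qed.

Let cl_res y V V' (V'V : V' `<=` V) : is_open V -> is_open V' -> V `<=` W y ->
  forall s : Lat pA V, cl y (res V'V s) = res V'V (cl y s).
Proof.
move=> Vo V'o VW s; have V'W : V' `<=` W y by apply: subset_trans VW.
rewrite (clE V'W) (clE VW) (res_sum V'V Gs.1) //; apply: eq_bigr => j _.
rewrite (resZ V'V Gs.1) // (res_comp VW V'V V'W Gs.1) //; congr (_ *: _).
by apply: Oval_inj; rewrite [RHS]/= !coordsE // LatV_res.
Qed.

Let cl_eta y U (s : Lat A U) V (VU : V `<=` Defs.preim p U) : is_open U -> is_open V ->
  V `<=` W y -> res VU (cG s) = cl y (res VU (eta s)).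
Proof.
(* Over U alone s need not expand in the basis at x; over [U1] it does, and V still lies above
   [U1]. *)
move=> Uo Vo VW; set x := under p y; pose U1 := U `&` lat_nbhs A x.
have U1o : is_open U1 by apply: is_openI => //; exact: lat_nbhs_open.
have U1U : U1 `<=` U by move=> z [].
have U1n : U1 `<=` lat_nbhs A x by move=> z [].
have VU1 : V `<=` Defs.preim p U1.
  by move=> z Vz; apply/preimE; split; apply/preimE; [exact: VU|exact: VW].
have oU := preim_open Uo; have oU1 := preim_open U1o.
rewrite -(res_comp (preimS U1U) VU1 VU Gs.1) // -cG_res //.
rewrite (lat_expand (res U1U s) U1n).
rewrite (big_morph _ (cGD U1o) (cG0 U1o)) (res_sum VU1 Gs.1) // (clE VW).
apply: eq_bigr => j _; rewrite cGZ // (resZ VU1 Gs.1) //.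
have xo := lat_nbhs_open A x; have pxo := preim_open xo.
rewrite -(lat_basis_res U1n) // cG_res // (res_comp (preimS U1n) VU1 VW Gs.1) //.
congr (_ *: _); apply: Oval_inj; rewrite coordsE // (LatV_res VU (eta s)) etaE /= mkOK.
  by rewrite -map_mxM [RHS]mxE.
by move=> z; exact: (lat_coord_regular (res U1U s) U1n).
Qed.

Let eta_expand y V (VW : V `<=` W y) (v : Lat pA V) :
  v = \sum_j coords y v j *:
    res VW (eta (lat_basis A (under p y) (lat_nbhs A (under p y)) j)).
Proof.
rewrite {1}(lat_expand v (Wn VW)); apply: eq_bigr => j _; congr (_ *: _).
apply: LatV_inj; rewrite LatV_res etaE !lat_basisK //; last exact: Wn.
by rewrite /= -map_invmx map_row.
Qed.

(** By [eta_expand], v is a combination of sections in the image of [eta], and on these [cl_eta]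
    gives a value that does not involve the chosen place. *)
Let cl_agree y y' V : is_open V -> V `<=` W y -> V `<=` W y' ->
  forall v : Lat pA V, cl y v = cl y' v.
Proof.
move=> Vo VW VW' v.
have clD s t : cl y' (s + t : Lat pA V) = cl y' s + cl y' t.
  by have := cl_lin VW' 1 s t; rewrite !scale1r.
have cl0 : cl y' (0 : Lat pA V) = 0 by apply: (addIr (cl y' (0 : Lat pA V))); rewrite -clD !add0r.
rewrite [in RHS](eta_expand VW v) (big_morph _ clD cl0) (clE VW).
apply: eq_bigr => j _; rewrite -[X in cl y' X]addr0 cl_lin // cl0 addr0.
by rewrite -cl_eta //; exact: lat_nbhs_open.
Qed.

Lemma Lat_pull_universal : exists h : (forall V, Lat pA V -> G V),
  [/\ is_hom h, forall U, is_open U -> forall s : Lat A U, h _ (eta s) = cG s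
    & forall h' : (forall V, Lat pA V -> G V), is_hom h' ->
      (forall U, is_open U -> forall s : Lat A U, h' _ (eta s) = cG s) ->
      forall V, is_open V -> h' V =1 h V].
Proof.
have [|||h [hh hE]] := @glue_hom _ _ (Lat pA) G W (fun y V v => cl y v) (Lat_presheaf _) Gs Wo Wy.
- by move=> y V Vo VW a s t; exact: cl_lin.
- by move=> y V V' V'V Vo V'o VW s; exact: cl_res.
- by move=> y y' V Vo VW VW' v; exact: cl_agree.
exists h; split=> //.
  move=> U Uo s; have oU := preim_open Uo; apply: (sheaf_eq Gs oU Wo Wy) => y.
  have Vo : is_open (Defs.preim p U `&` W y) by apply: is_openI.
  have VW : Defs.preim p U `&` W y `<=` W y := @subIsetr _ _ _.
  by rewrite -(hom_res _ hh) // (hE y) // -cl_eta.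
move=> h' h'h h'e; apply: (hom_eq_local Gs h'h hh Wo Wy) => y V Vo VW v.
rewrite (hE y) // (clE VW) {1}(eta_expand VW v) (hom_sum h'h) //.
have xo := lat_nbhs_open A (under p y); have pxo := preim_open xo.
by apply: eq_bigr => j _; rewrite (homZ h'h) // (hom_res _ h'h) // h'e.
Qed.

End Universal.

Lemma Lat_pullback : is_pullback p (Lat A) (Lat pA).
Proof.
split; first exact: Lat_sheaf.
exists (fun U s => eta s).
  split=> [U Uo a s t|U V VU Uo Vo s].
    apply: (@LatV_inj _ _ _ pA (Defs.preim p U)); rewrite etaE.
    rewrite [RHS](LatV_lin (psharp p a) (eta s) (eta t)) !etaE LatV_lin map_mxD map_mxZ.
    by [].
  apply: (@LatV_inj _ _ _ pA (Defs.preim p V)).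
  by rewrite etaE [RHS](LatV_res (preimS VU) (eta s)) etaE.
move=> G Gs c ch; exact: (Lat_pull_universal Gs ch).
Qed.

End LatPullback.
End Pullback.

(** * Decompositions and idempotents *)

Section Matrices2.
Variable R : comNzRingType.
Implicit Types (M N : 'M[R]_2).

Lemma ord2P (P : 'I_2 -> Prop) : P 0 -> P 1 -> forall j, P j.
Proof.
move=> P0 P1 j; case: (unliftP ord0 j) => [j' ->|->]; last exact: P0.
by rewrite ord1 (_ : lift ord0 ord0 = 1); last exact: val_inj.
Qed.

Lemma sum2 (f : 'I_2 -> R) : \sum_j f j = f 0 + f 1.
Proof. by rewrite !big_ord_recl big_ord0 addr0; congr (_ + f _); apply: val_inj. Qed.

Lemma mulmx2 m n (M : 'M[R]_(m, 2)) (N : 'M_(2, n)) a b : (M *m N) a b = M a 0 * N 0 b + M a 1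
  * N 1 b.
Proof. by rewrite mxE sum2. Qed.

Lemma det2 M : \det M = M 0 0 * M 1 1 - M 0 1 * M 1 0.
Proof.
have l0 : lift (0 : 'I_2) (0 : 'I_1) = 1 by exact: val_inj.
have l1 : lift (1 : 'I_2) (0 : 'I_1) = 0 by exact: val_inj.
rewrite (expand_det_row M 0) sum2 /cofactor !det_mx11 !mxE l0 l1 /=.
by rewrite expr0 expr1 mul1r mulN1r mulrN.
Qed.

Lemma trace2 M : \tr M = M 0 0 + M 1 1.
Proof. exact: sum2. Qed.

Lemma matrix2P M N : M 0 0 = N 0 0 -> M 0 1 = N 0 1 -> M 1 0 = N 1 0 -> M 1 1 = N 1 1 -> M = N.
Proof. by move=> *; apply/matrixP; apply: ord2P; apply: ord2P. Qed.

(** Cayley-Hamilton. *)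
Lemma mulmx2_sqr M : M *m M = \tr M *: M - (\det M)%:M.
Proof.
by apply: matrix2P; rewrite mulmx2 !mxE trace2 det2 /= ?mulr1n ?mulr0n; ring.
Qed.

(** The polarised form of Cayley-Hamilton. *)
Lemma mulmx2_anticomm M N : \tr M = 0 -> \tr N = 0 -> \tr (M *m N) = 0 ->
  M *m N + N *m M = 0.
Proof.
move=> M0 N0 MN0.
have -> : M *m N + N *m M =
    \tr M *: N + \tr N *: M + (\tr (M *m N) - \tr M * \tr N)%:M.
  by apply: matrix2P; rewrite !mxE !trace2 !mulmx2 !sum2 /= ?mulr1n ?mulr0n; ring.
by rewrite M0 N0 MN0 !scale0r mulr0 subrr !add0r raddf0.
Qed.

Lemma det2_sub M l : \det (M - l%:M) = l ^+ 2 - \tr M * l + \det M.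
Proof. by rewrite !det2 trace2 !mxE /= ?mulr1n ?mulr0n; ring. Qed.

Lemma trace2_sub M l : \tr (M - l%:M) = \tr M - l *+ 2.
Proof. by rewrite !trace2 !mxE /= ?mulr1n ?mulr0n; ring. Qed.

End Matrices2.

(* If every element of End has a characteristic polynomial with a double root
   in k, the nilpotents among them anticommute with square zero, so a
   combination of such elements is scalar plus square-zero, and is not a
   nontrivial idempotent. *)
Lemma scalar_nilpotent_idempotent (K : fieldType) n (c : 'I_n -> K) (l : 'I_n -> K)
    (N : 'I_n -> 'M[K]_2) (e : 'M[K]_2) :
  (forall a b, N a *m N b + N b *m N a = 0) -> (forall a, N a *m N a = 0) ->
  e = \sum_a c a *: (N a + (l a)%:M) -> e *m e = e -> e = 0 \/ e = 1%:M.
Proof.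
move=> Nanti Nsq eE ee; pose M := \sum_a c a *: N a; pose la := \sum_a c a * l a.
have eM : e = M + la%:M.
  rewrite eE /M /la -scalemx1 scaler_suml -big_split; apply: eq_bigr => a _ /=.
  by rewrite scalerDr -[(l a)%:M]scalemx1 scalerA.
have MM : M *m M = 0.
  rewrite /M; elim: n c {l eE la eM M} N Nanti Nsq => [|n IH] c N Nanti Nsq.
    by rewrite big_ord0 mul0mx.
  rewrite big_ord_recr /=; have SS := IH (fun a => c (widen_ord (leqnSn n) a))
    (fun a => N (widen_ord (leqnSn n) a)) (fun a b => Nanti _ _) (fun a => Nsq _).
  set S := \sum_(a < n) _ in SS *; set N' := N ord_max.
  have SN : S *m N' + N' *m S = 0.
    rewrite mulmx_suml mulmx_sumr -big_split big1 //= => a _.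
    by rewrite -scalemxAl -scalemxAr -scalerDr Nanti scaler0.
  rewrite mulmxDl !mulmxDr SS -!scalemxAl -!scalemxAr Nsq !scaler0 add0r addr0.
  by rewrite -scalerDr SN scaler0.
move: M la eM MM {eE} => M la eM MM.
(* Expansion of e e = e with M M = 0. If 2 la = 1, this forces la = la^2, so la is 0 or 1, which is
   absurd; otherwise M is scalar with square 0, so M = 0. *)
have key : (la *+ 2 - 1) *: M = (la - la ^+ 2)%:M.
  have E : la *: M + (la *: M + (la * la)%:M) = M + la%:M.
    rewrite -eM -[RHS]ee eM mulmxDl !mulmxDr MM add0r.
    by rewrite mul_mx_scalar !mul_scalar_mx scale_scalar_mx.
  have lin (m d : K) : la * m + (la * m + la * la * d) = m + la * d ->
      (la *+ 2 - 1) * m = (la - la ^+ 2) * d.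
    move=> h; transitivity (la * m + (la * m + la * la * d) - m - la * la * d); first by ring.
    by rewrite h; ring.
  apply/matrixP => a b; have := congr1 (fun A : 'M_2 => A a b) E.
  rewrite !mxE; case: (a == b); rewrite /= ?mulr1n ?mulr0n.
    by have := lin (M a b) 1; rewrite !mulr1.
  by have := lin (M a b) 0; rewrite !mulr0.
have [l2|l2] := eqVneq (la *+ 2 - 1) 0.
  have l1 : la *+ 2 = 1 by apply/eqP; rewrite -subr_eq0 l2.
  have : la - la ^+ 2 = 0.
    by move: key; rewrite l2 scale0r => /matrixP/(_ 0 0); rewrite !mxE mulr1n => <-.
  move=> /eqP; rewrite expr2 -{1}[la]mulr1 -mulrBr mulf_eq0 subr_eq0 => /orP[/eqP l0|/eqP l0].
    by move/eqP: l1; rewrite l0 mul0rn eq_sym oner_eq0.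
  by move/eqP: l1; rewrite -l0 mulr2n -subr_eq0 addrK oner_eq0.
have Ms : M = ((la - la ^+ 2) / (la *+ 2 - 1))%:M.
  apply: (scalerI l2); by rewrite key scale_scalar_mx mulrC divfK.
move: MM; rewrite Ms -scalar_mxM => /matrixP/(_ 0 0); rewrite !mxE mulr1n => /eqP.
rewrite mulf_eq0 orbb => /eqP m0; move: eM; rewrite Ms m0 raddf0 add0r => eM.
move: ee; rewrite eM -scalar_mxM => /matrixP/(_ 0 0); rewrite !mxE !mulr1n => /eqP.
rewrite -subr_eq0 -{3}[la]mulr1 -mulrBr mulf_eq0 subr_eq0 => /orP[] /eqP ->.
  by left; rewrite raddf0.
by right.
Qed.

Section Idempotents.
Variables (k : fieldType) (X : curve k).
Local Notation F := (funField X).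
Implicit Types (x : place X).

Lemma lat_homP m n (A : lattice X m) (B : lattice X n) (H : 'M[F]_(m, n)) :
  lat_hom A B H <-> forall x, invmx (A x) *m H *m B x \is a mxOver (valring x).
Proof.
split=> [AB x|AB x v vx].
  apply/mxOverP => a b; have := AB x (row a (invmx (A x))).
  rewrite -row_mul mulVmx ?lat_unit // => /(_ _).
  have r1 : row a 1%:M \is a mxOver (valring x).
    by apply/mxOverP => j l; rewrite !mxE; case: eqP => _; rewrite ?rpred1 ?rpred0.
  by move=> /(_ r1); rewrite -!row_mul => /mxOverP/(_ 0 b); rewrite mxE.
have -> : v *m H *m B x = v *m A x *m (invmx (A x) *m H *m B x).
  by rewrite !mulmxA mulmxK ?lat_unit.
exact: mxOverM.
Qed.

Lemma lat_homD m n (A : lattice X m) (B : lattice X n) H K :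
  lat_hom A B H -> lat_hom A B K -> lat_hom A B (H + K).
Proof. by move=> AH AK x v vx; rewrite mulmxDr mulmxDl rpredD ?AH ?AK. Qed.

Lemma lat_homM m n l (A : lattice X m) (B : lattice X n) (C : lattice X l) H K :
  lat_hom A B H -> lat_hom B C K -> lat_hom A C (H *m K).
Proof. by move=> AH AK x v vx; rewrite mulmxA; apply/AK/AH. Qed.

Lemma lat_hom_scalar n (A : lattice X n) c : lat_hom A A (const X c)%:M.
Proof.
move=> x v vx; rewrite mul_mx_scalar -scalemxAl; apply/mxOverP => a b.
by rewrite mxE rpredM ?const_valring //; exact/mxOverP.
Qed.

(** In a valuation ring one of the two entries divides the other; b is the entry of least order. *)
Lemma generating_entry x (w : 'rV[F]_2) : w != 0 ->
  exists b, b != 0 /\ forall s, (s *: w \is a mxOver (valring x)) = (s * b \in valring x).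
Proof.
move=> w0; have E s : (s *: w \is a mxOver (valring x)) =
    (s * w 0 0 \in valring x) && (s * w 0 1 \in valring x).
  apply/mxOverP/andP => [h|[h0 h1] a].
    by have := h 0 0; have := h 0 1; rewrite !mxE.
  by rewrite ord1; apply: ord2P; rewrite mxE.
have gen a b : a != 0 -> b / a \in valring x -> forall s, s * a \in valring x -> s * b \in
  valring x.
  move=> a0 ba s sa; have -> : s * b = s * a * (b / a) by field.
  exact: rpredM.
have [z0|nz0] := eqVneq (w 0 0) 0.
  exists (w 0 1); split.
    apply: contra_neq w0 => z1; apply/rowP; apply: ord2P; by rewrite mxE.
  by move=> s; rewrite E z0 mulr0 rpred0.
have [r|r] := boolP (w 0 1 / w 0 0 \in valring x).
  exists (w 0 0); split=> // s; rewrite E; apply/andb_idr; exact: gen.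
have nz1 : w 0 1 != 0 by apply: contraNneq r => ->; rewrite mul0r rpred0.
exists (w 0 1); split=> // s; rewrite E; apply/andb_idl; apply: gen => //.
by rewrite -invf_div; exact: valring_total.
Qed.

(** The idele b describes the intersection of the line F r with the lattice, a saturated line
    subbundle. *)
Lemma row_lattice (r : 'rV[F]_2) (A : lattice X 2) : r != 0 ->
  exists b : lattice X 1, forall x s,
    (s *: r *m A x \is a mxOver (valring x)) = (s * b x 0 0 \in valring x).
Proof.
move=> r0; have rA0 x : r *m A x != 0.
  by apply: contra_neq r0 => e; rewrite -(mulmxK (lat_unit A x) r) e mul0mx.
have /choice[b bP] := fun x => generating_entry x (rA0 x).
have [l rl] : exists l, r 0 l != 0 by apply/rV0Pn.
have [|B BE] := @idele_exists _ _ b (fun x => (bP x).1); last first.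
  by exists B => x s; rewrite BE -scalemxAl (bP x).2.
pose M := (r 0 l)^-1%:M : 'M[F]_1.
(* [b x] is a unit at x wherever A is unimodular, r is regular and the inverse of its nonzero entry
   [r 0 l] is regular. *)
apply: is_openS (is_openI (is_openI (lat_open A) (regular_locus_open r)) (regular_locus_open M)) _.
move=> x /= [[[Ax AVx] rx] Mx]; have [b0 bE] := bP x; split.
  by rewrite -[b x]mul1r -bE scale1r; apply: mxOverM.
have : (b x)^-1 *: (r *m A x) \is a mxOver (valring x) by rewrite bE mulVf ?rpred1.
move=> h; have : (b x)^-1 *: r \is a mxOver (valring x).
  by rewrite -(mulmxK (lat_unit A x) (_ *: r)) -scalemxAl mxOverM.
move=> /mxOverP/(_ 0 l); rewrite mxE => h2.
move: Mx; rewrite /regular_locus /= mxOver11 mxE eqxx mulr1n => Mx.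
by rewrite -[(b x)^-1](mulfK rl) rpredM.
Qed.

(** The images of e and 1 - e on the generic fibre are lines, spanned by r1 and r2. As e preserves
    each stalk, a combination of r1 and r2 is integral exactly when both of its terms are. *)
Lemma idempotent_decomposes (A : lattice X 2) (e : 'M[F]_2) : e *m e = e ->
  e != 0 -> e != 1%:M -> lat_hom A A e ->
  exists b1 b2 : lattice X 1, isomorphic (Lat A) (Lat (lat_block b1 b2)).
Proof.
move=> ee e0 e1 Ae.
have [i0 ei0] : exists a, row a e != 0.
  apply: contrapT => /forallNP H; case/eqP: e0; apply/row_matrixP => a.
  by have /negP := H a; rewrite negbK => /eqP->; rewrite row0.
have [j0 ej0] : exists a, row a (1%:M - e) != 0.
  apply: contrapT => /forallNP H; case/eqP: e1; apply/row_matrixP => a.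
  have /negP := H a; rewrite negbK raddfB /= subr_eq0 => /eqP-> //.
set r1 := row i0 e in ei0; set r2 := row j0 (1%:M - e) in ej0.
have r1e : r1 *m e = r1 by rewrite /r1 -row_mul ee.
have r2e : r2 *m e = 0 by rewrite /r2 -row_mul mulmxBl mul1mx ee subrr row0.
pose H : 'M[F]_(1 + 1, 2) := col_mx r1 r2.
have HE (v : 'rV_1) (w : 'rV_1) : row_mx v w *m H = v 0 0 *: r1 + w 0 0 *: r2.
  by rewrite mul_row_col [v]mx11_scalar [w]mx11_scalar !mul_scalar_mx !mxE !mulr1n.
have Hu : (H : 'M_2) \in unitmx.
  rewrite -row_free_unit; apply: inj_row_free => v.
  rewrite -(hsubmxK (v : 'rV_(1 + 1))); move: (lsubmx _) (rsubmx _) => v1 v2; rewrite HE => E.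
  have : v1 0 0 *: r1 = 0.
    by have := congr1 (mulmx^~ e) E; rewrite mul0mx mulmxDl -!scalemxAl r1e r2e scaler0 addr0.
  move=> E1; move: E; rewrite E1 add0r => /eqP; rewrite scaler_eq0 (negbTE ej0) orbF => /eqP w2.
  move/eqP: E1; rewrite scaler_eq0 (negbTE ei0) orbF => /eqP w1.
  by rewrite [v1]mx11_scalar [v2]mx11_scalar w1 w2 !raddf0 row_mx0.
have [b1 b1E] := row_lattice A ei0; have [b2 b2E] := row_lattice A ej0.
exists b1, b2.
have key x (v w : 'rV_1) : (row_mx v w *m H *m A x \is a mxOver (valring x)) =
   (row_mx v w *m lat_block b1 b2 x \is a mxOver (valring x)).
  rewrite HE block_unit1 mxOver_row_mx !mxOver11 ![(_ *m _) 0 0]mxE !big_ord1 -b1E -b2E mulmxDl.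
  apply/idP/andP => [h|[h1 h2]]; last exact: rpredD.
  have h1 : v 0 0 *: r1 *m A x \is a mxOver (valring x).
    have := Ae x _ (_ : (v 0 0 *: r1 + w 0 0 *: r2) *m A x \is a mxOver (valring x)).
    by rewrite mulmxDl mulmxDl -!scalemxAl r1e r2e scaler0 addr0 !scalemxAl; apply.
  by split=> //; rewrite -(addKr (v 0 0 *: r1 *m A x) (w 0 0 *: r2 *m A x)) addrC rpredB.
apply/isomorphic_Lat; exists (invmx H), H; split; rewrite ?mulVmx ?mulmxV //.
  move=> x v vx; rewrite -(hsubmxK (v *m invmx H : 'rV_(1 + 1))) -key hsubmxK.
  by rewrite mulmxKV.
by move=> x v; rewrite -(hsubmxK (v : 'rV_(1 + 1))) -key.
Qed.

Lemma decomposable_rank2 (E : premodule X) (A : lattice X 2) : isomorphic E (Lat A) ->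
  decomposable E <-> exists b1 b2 : lattice X 1, isomorphic (Lat A) (Lat (lat_block b1 b2)).
Proof.
move=> EA; split.
  move=> [m [n [M [N [m0 n0 /vector_bundle_Lat[B MB] /vector_bundle_Lat[C NC] EMN]]]]].
  have iso : isomorphic (Lat A) (Lat (lat_block B C)).
    apply: isomorphic_trans (isomorphic_sym EA) _; apply: isomorphic_trans EMN _.
    apply: isomorphic_trans (isomorphic_dsum MB NC) _; exact: Lat_dsum.
  have mn := isomorphic_Lat_rank iso.
  have m1 : m = 1 by lia.
  have n1 : n = 1 by lia.
  by subst m n; exists B, C.
move=> [b1 [b2 iso]]; exists 1, 1, (Lat b1), (Lat b2); split=> //; try exact: Lat_vector_bundle.
apply: isomorphic_trans EA _; apply: isomorphic_trans iso _.
apply: isomorphic_sym; exact: Lat_dsum.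
Qed.

Lemma decomposes_idempotent (A : lattice X 2) (b1 b2 : lattice X 1) :
  isomorphic (Lat A) (Lat (lat_block b1 b2)) ->
  exists e, [/\ e *m e = e, e != 0, e != 1%:M & lat_hom A A e].
Proof.
move=> /isomorphic_Lat[H [H' [HH' H'H AB BA]]].
pose d : 'M[F]_(1 + 1) := block_mx 1%:M 0 0 0.
have dd : d *m d = d by rewrite mulmx_block !mulmx0 !mul0mx mul1mx !addr0.
have dB : lat_hom (lat_block b1 b2) (lat_block b1 b2) d.
  have dE (v w : 'rV_1) : row_mx v w *m d = row_mx v 0.
    by rewrite mul_row_block !mulmx0 !addr0 mulmx1.
  move=> x v; rewrite -[v]hsubmxK dE !block_unit1.
  by rewrite !mxOver_row_mx mul0mx => /andP[-> _]; apply/mxOver0/rpred0.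
have inj K : H *m K *m H' = 0 -> K = 0.
  by move=> E; rewrite -[K]mul1mx -[K]mulmx1 -H'H !mulmxA -(mulmxA H' H) -(mulmxA H') E mulmx0
    mul0mx.
exists (H *m d *m H'); split.
- by rewrite !mulmxA -(mulmxA _ H' H) H'H mulmx1 -(mulmxA _ d d) dd.
- apply: contraTneq (oner_neq0 F) => /inj/matrixP/(_ (lshift 1 0) (lshift 1 0)).
  by rewrite block_mxEul !mxE eqxx negbK => /eqP.
- apply: contraTneq (oner_neq0 F) => E.
  have /inj/matrixP/(_ (rshift 1 0) (rshift 1 0)) : H *m (1%:M - d) *m H' = 0.
    by rewrite mulmxBr mulmxBl mulmx1 HH' E subrr.
  by rewrite mxE [(- d) _ _]mxE block_mxEdr !mxE eqxx subr0 negbK => /eqP.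
- exact: lat_homM (lat_homM AB dB) BA.
Qed.

End Idempotents.

Section TrivialLattice.
Variables (k : fieldType) (X : curve k).

Lemma lat_one_exists : exists I : lattice X 2, forall x, I x = 1%:M.
Proof.
have o : is_open [set x : place X | unit_locus (1%:M : 'M[funField X]_2) x].
  apply: is_openS (@is_openT _ X) _ => x _; split; rewrite /regular_locus /= ?invmx1;
  by apply/mxOverP => a b; rewrite mxE; case: eqP => _; rewrite ?rpred1 ?rpred0.
by exists (MkLattice (fun=> unitmx1 _ _) o).
Qed.

Lemma c0_isomorphic (I : lattice X 2) : (forall x, I x = 1%:M) ->
  isomorphic (dsum (OX X) (OX X)) (Lat I).
Proof.
move=> I1; pose h U (s : dsum (OX X) (OX X) U) : Lat I U :=
  mkLat I U (\row_j if val j == 0 then Oval (s.1 : Oring U) else Oval (s.2 : Oring U)).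
have hE U (s : dsum (OX X) (OX X) U) : LatV (h U s) =
    \row_j if val j == 0 then Oval (s.1 : Oring U) else Oval (s.2 : Oring U).
  rewrite mkLatK // => x Ux; rewrite I1 mulmx1; apply/mxOverP => a b; rewrite mxE.
  by case: ifP => _; exact: Oring_valring.
exists h.
  split=> [U Uo a s t|U V VU Uo Vo s]; apply: LatV_inj; apply/rowP => j.
    by rewrite LatV_lin !hE !mxE; case: ifP.
  by rewrite LatV_res !hE !mxE; case: ifP.
move=> U Uo; exists (fun t : Lat I U => (mkO U (LatV t 0 0) : (Oring U)^o, mkO U (LatV t 0 1) :
  (Oring U)^o)).
  by move=> [s t]; rewrite hE !mxE /=; congr (_, _); apply: Oval_inj; rewrite mkOK // => x;
    exact: Oring_valring.
move=> t; have tr j x : U x -> LatV t 0 j \in valring x.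
  by move=> Ux; have := LatVP t Ux; rewrite I1 mulmx1 => /mxOverP.
by apply: LatV_inj; apply/rowP; apply: ord2P; rewrite hE mxE /= mkOK // => x; exact: tr.
Qed.

End TrivialLattice.

(** * Descent of endomorphisms *)

Section EndomorphismDescent.
Variables (k : finFieldType) (kbar : closedFieldType) (ibar : {rmorphism k -> kbar}).
Variables (X : curve k) (Xbar : curve kbar) (pbar : base_change ibar X Xbar).
Local Notation F := (funField X).
Local Notation Fbar := (funField Xbar).
Local Notation cbar := (const Xbar).

Lemma matrix_span (M : 'M[Fbar]_2) : exists n (d : 'I_n -> kbar) (f : 'I_n -> 'M[F]_2),
  lin_indep ibar d /\ M = \sum_l cbar (d l) *: map_mx pbar (f l).
Proof.
pose S (M : 'M[Fbar]_2) := exists s : seq (kbar * 'M[F]_2),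
  M = \sum_(t <- s) cbar t.1 *: map_mx pbar t.2.
have S0 : S 0 by exists [::]; rewrite big_nil.
have SD N N' : S N -> S N' -> S (N + N').
  by move=> [s ->] [s' ->]; exists (s ++ s'); rewrite big_cat.
have [s sE] : S M.
  rewrite (matrix_sum_delta M); apply: (big_ind S) => // a _; apply: (big_ind S) => // b _.
  have [n [f [c ->]]] := bc_span pbar (M a b).
  exists [seq (c j, f j *: delta_mx a b) | j <- enum 'I_n].
  rewrite big_map big_enum scaler_suml /=; apply: eq_bigr => j _.
  by rewrite map_mxZ map_delta_mx scalerA mulrC.
have [r [d [B [dfree cB]]]] := lin_indep_basis ibar (fun j => (tnth (in_tuple s) j).1).
exists r, d, (fun l => \sum_j const X (B j l) *: (tnth (in_tuple s) j).2); split=> //.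
rewrite sE big_tnth.
under [RHS]eq_bigr do rewrite raddf_sum scaler_sumr.
rewrite [RHS]exchange_big; apply: eq_bigr => j _ /=.
rewrite cB rmorph_sum scaler_suml; apply: eq_bigr => l _.
by rewrite map_mxZ scalerA rmorphM (bc_const pbar) mulrC.
Qed.

(** Written in the stalk bases, the entries of the endomorphism are combinations of functions of F
    with free coefficients in kbar; [integral_descent] applies with the q-power map of kbar. *)
Lemma end_descent (A : lattice X 2) n (d : 'I_n -> kbar) (f : 'I_n -> 'M[F]_2) :
  lin_indep ibar d ->
  lat_hom (lat_pull pbar A) (lat_pull pbar A) (\sum_l cbar (d l) *: map_mx pbar (f l)) ->
  forall l, lat_hom A A (f l).
Proof.
move=> dfree /lat_homP H l; apply/lat_homP => x; apply/mxOverP => a b.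
have [theta thE] := frobenius_exists ibar.
have th_i e : theta (ibar e) = ibar e by rewrite thE -rmorphXn expf_card.
have th_surj e : exists e', theta e' = e.
  by have [e' <-] := @frobenius_surj_closed k _ e; exists e'.
have [phi [phi_p phi_c]] := scalar_extension_exists pbar th_i.
have th_fix e : theta e = e -> exists b, e = ibar b.
  by rewrite thE; exact: frobenius_fixed.
apply: (integral_descent th_i phi_p phi_c th_surj th_fix
  (a := fun l => (invmx (A x) *m f l *m A x) a b) dfree) => y yx.
have /mxOverP/(_ a b) := H y.
rewrite /= yx -map_invmx mulmx_sumr mulmx_suml summxE.
rewrite (eq_bigr (fun j => pbar ((invmx (A x) *m f j *m A x) a b) * cbar (d j))) // => j _.
by rewrite -scalemxAr -scalemxAl -!map_mxM mxE [map_mx _ _ _ _]mxE mulrC.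
Qed.

(** Both invariants can be computed in a basis of any stalk, so they are regular everywhere. *)
Lemma end_constants (A : lattice X 2) f : lat_hom A A f ->
  exists tau nu, \tr f = const X tau /\ \det f = const X nu.
Proof.
move=> /lat_homP H.
have [tau tE] : exists tau, \tr f = const X tau.
  apply: (regular_constant pbar) => x.
  have <- : \tr (invmx (A x) *m f *m A x) = \tr f.
    by rewrite mxtrace_mulC mulmxA mulmxV ?lat_unit // mul1mx.
  by rewrite rpred_sum // => a _; exact/mxOverP/H.
have [nu nE] : exists nu, \det f = const X nu.
  apply: (regular_constant pbar) => x.
  have <- : \det (invmx (A x) *m f *m A x) = \det f.
    rewrite !det_mulmx mulrAC -det_mulmx mulVmx ?lat_unit // det1 mul1r //.
  have h a b : (invmx (A x) *m f *m A x) a b \in valring x by exact/mxOverP/H.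
  by rewrite det2 rpredB ?rpredM.
by exists tau, nu.
Qed.

Lemma pullback_decomposes_endo (A : lattice X 2) :
  ~ (exists b1 b2 : lattice X 1, isomorphic (Lat A) (Lat (lat_block b1 b2))) ->
  (exists b1 b2 : lattice Xbar 1, isomorphic (Lat (lat_pull pbar A)) (Lat (lat_block b1 b2))) ->
  exists f tau nu, [/\ lat_hom A A f, f *m f = const X tau *: f - (const X nu)%:M &
    forall r : k, r ^+ 2 - tau * r + nu != 0].
Proof.
move=> nd [b1 [b2 /decomposes_idempotent[e [ee e0 e1 eA]]]]; apply: contrapT => H.
(* A root l in k must be double: otherwise (f - l) / (tau - 2 l) is a nontrivial idempotent, by
   Cayley-Hamilton, and A decomposes. *)
have dbl f : lat_hom A A f -> exists l, \tr f = const X l *+ 2 /\ \det f = const X l ^+ 2.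
  move=> fA; have [tau [nu [tE nE]]] := end_constants fA.
  have [l lE] : exists l, l ^+ 2 - tau * l + nu = 0.
    apply: contrapT => /forallNP nr; apply: H; exists f, tau, nu; split=> //.
      by rewrite mulmx2_sqr tE nE.
    by move=> r; apply/eqP/nr.
  have nuE : nu = tau * l - l ^+ 2.
    by apply/eqP; rewrite -subr_eq0 -[X in _ == X]lE; apply/eqP; ring.
  have [t2|t2] := eqVneq tau (l *+ 2).
    exists l; rewrite tE nE nuE t2 rmorphMn -rmorphXn; split=> //; congr (const X _); ring.
  case: nd; pose g := const X (tau - l *+ 2); have g0 : g != 0 by rewrite fmorph_eq0 subr_eq0.
  pose N := f - (const X l)%:M; pose ep := const X (tau - l *+ 2)^-1 *: N.
  have gV : const X (tau - l *+ 2)^-1 = g^-1 by rewrite fmorphV.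
  have NN : N *m N = g *: N.
    rewrite mulmx2_sqr /N trace2_sub det2_sub tE nE nuE /g.
    have -> : const X l ^+ 2 - const X tau * const X l + const X (tau * l - l ^+ 2) = 0.
      by rewrite rmorphB rmorphM rmorphXn; ring.
    by rewrite raddf0 subr0 rmorphB rmorphMn.
  have scal m : f = (const X m)%:M -> tau = m *+ 2.
    move=> fm; apply: (fmorph_inj (const X)); rewrite -tE fm mxtrace_scalar rmorphMn //.
  apply: (@idempotent_decomposes _ _ A ep).
  - by rewrite /ep -scalemxAl -scalemxAr NN gV [g^-1 *: (g *: N)]scalerA mulVf // scale1r.
  - rewrite /ep scaler_eq0 gV invr_eq0 (negbTE g0) /= subr_eq0.
    by apply: contra t2 => /eqP/scal->.
  - apply/eqP => epE; have : N = g%:M.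
      have := congr1 (fun M => g *: M) epE; rewrite /ep scalerA gV mulfV // scale1r scalemx1.
      exact.
    move=> /eqP; rewrite /N subr_eq /g -raddfD -rmorphD => /eqP/scal E; case/eqP: t2.
    apply/eqP; rewrite -subr_eq0.
    have -> : tau - l *+ 2 = (tau - l *+ 2 + l) *+ 2 - tau by ring.
    by rewrite -E subrr.
  - rewrite /ep -mul_mx_scalar; apply: lat_homM; last exact: lat_hom_scalar.
    rewrite /N -raddfN -rmorphN; apply: lat_homD => //; exact: lat_hom_scalar.
have [n [d [f [dfree eE]]]] := matrix_span e.
have fA l : lat_hom A A (f l) by move: l; apply: end_descent dfree _; rewrite -eE.
have /choice[la laP] := fun l => dbl (f l) (fA l).
pose N l := f l - (const X (la l))%:M.
have NA l : lat_hom A A (N l).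
  by rewrite /N -raddfN -rmorphN; apply: lat_homD => //; exact: lat_hom_scalar.
have Ntr l : \tr (N l) = 0 by rewrite trace2_sub (laP l).1 subrr.
have Ndet l : \det (N l) = 0.
  by rewrite det2_sub (laP l).1 (laP l).2; ring.
have Nsq l : N l *m N l = 0 by rewrite mulmx2_sqr Ntr Ndet scale0r raddf0 subrr.
have Nanti a b : N a *m N b + N b *m N a = 0.
  (* The product of two nilpotents is an endomorphism of determinant 0, so its double eigenvalue,
     and with it its trace, is 0. *)
  apply: mulmx2_anticomm => //; have [l [-> lE]] := dbl _ (lat_homM (NA a) (NA b)).
  move/eqP: lE; rewrite det_mulmx Ndet mul0r eq_sym expf_eq0 /= => /eqP->.
  by rewrite mul0rn.
have [] := @scalar_nilpotent_idempotent Fbar n (fun l => cbar (d l))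
  (fun l => pbar (const X (la l))) (fun l => map_mx pbar (N l)) e _ _ _ ee.
- by move=> a b; rewrite -!map_mxM -map_mxD Nanti map_mx0.
- by move=> a; rewrite -map_mxM Nsq map_mx0.
- rewrite eE; apply: eq_bigr => l _; congr (_ *: _).
  by rewrite -map_scalar_mx -map_mxD /N subrK.
- by move=> E; rewrite E eqxx in e0.
- by move=> E; rewrite E eqxx in e1.
Qed.

End EndomorphismDescent.

(** * Direct images of line bundles *)

Section QuadraticCover.
Variables (k k2 : finFieldType) (i : {rmorphism k -> k2}).
Hypothesis hk2 : #|k2| = (#|k| ^ 2)%N.
Variables (X : curve k) (X2 : curve k2) (p : base_change i X X2).
Local Notation F := (funField X).
Local Notation F2 := (funField X2).
Local Notation q := #|k|.
Implicit Types (x : place X) (y : place X2).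
Variable c : k2.
Hypothesis ck : forall b, c <> i b.
Variable sigma : {rmorphism F2 -> F2}.
Hypothesis sigma_p : forall f, sigma (p f) = p f.
Hypothesis sigma_c : forall d, sigma (const X2 d) = const X2 (d ^+ q).

Definition zeta : F2 := const X2 c.
Definition zeta' : F2 := const X2 (c ^+ q).

Lemma sigma_zeta : sigma zeta = zeta'. Proof. exact: sigma_c. Qed.
Lemma sigma_zeta' : sigma zeta' = zeta.
Proof. by rewrite sigma_c (expf_card_quad hk2). Qed.

Lemma zeta_diff : zeta - zeta' != 0.
Proof.
rewrite -rmorphB fmorph_eq0 subr_eq0 eq_sym; apply/eqP.
exact: (quad_conj_neq (i := i)).
Qed.

Let one_c (j : 'I_2) : k2 := if val j == 0 then 1 else c.

Let one_c_indep : lin_indep i one_c.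
Proof.
move=> b; rewrite !big_ord_recl big_ord0 /one_c /= addr0 mulr1 => /(quad_free ck)[b0 b1] j.
by case: (unliftP ord0 j) => [j' ->|->//]; rewrite ord1.
Qed.

Definition of_row (v : 'rV[F]_2) : F2 := p (v 0 0) + p (v 0 1) * zeta.

Let of_row_sum v : of_row v = \sum_j p (v 0 j) * const X2 (one_c j).
Proof.
by rewrite !big_ord_recl big_ord0 /one_c /= rmorph1 mulr1 addr0 /of_row;
  congr (_ + p (v _ _) * _); apply: val_inj.
Qed.

Lemma of_rowD v w : of_row (v + w) = of_row v + of_row w.
Proof. by rewrite /of_row !mxE !rmorphD /=; ring. Qed.
Lemma of_rowZ a v : of_row (a *: v) = p a * of_row v.
Proof. by rewrite /of_row !mxE !rmorphM /=; ring. Qed.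
Lemma of_row0 : of_row 0 = 0.
Proof. by rewrite /of_row !mxE !rmorph0 mul0r addr0. Qed.

Lemma of_row_inj : injective of_row.
Proof.
move=> v w e; apply/eqP; rewrite -subr_eq0; apply/eqP/rowP => j; rewrite [RHS]mxE.
apply: (bc_free (p := p) one_c_indep (a := fun j => (v - w) 0 j)).
by rewrite -of_row_sum -[v - w]/(v + - w) -scaleN1r of_rowD of_rowZ e rmorphN1 mulN1r subrr.
Qed.

Lemma of_row_surj z : exists v, of_row v = z.
Proof.
have [n [a [d ->]]] := bc_span p z.
have /choice[b0 /choice[b1 dE]] := fun j => quad_span hk2 ck (d j).
exists (\row_l if val l == 0 then \sum_j a j * const X (b0 j) else \sum_j a j * const X (b1 j)).
rewrite /of_row !mxE /= !rmorph_sum mulr_suml -big_split; apply: eq_bigr => j _ /=.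
by rewrite dE rmorphD !rmorphM /= !(bc_const p) mulrDr mulrA.
Qed.

Definition to_row z : 'rV[F]_2 := projT1 (cid (of_row_surj z)).
Lemma to_rowK : cancel to_row of_row.
Proof. by move=> z; rewrite /to_row; case: cid. Qed.
Lemma of_rowK : cancel of_row to_row.
Proof. by move=> v; apply: of_row_inj; rewrite to_rowK. Qed.

Lemma to_row_lin a z w : to_row (p a * z + w) = a *: to_row z + to_row w.
Proof. by apply: of_row_inj; rewrite of_rowD of_rowZ !to_rowK. Qed.

Lemma sigma_involutive z : sigma (sigma z) = z.
Proof.
rewrite -(to_rowK z) /of_row !rmorphD !rmorphM /= !sigma_p.
by rewrite sigma_zeta sigma_zeta'.
Qed.

Lemma sigma_fixed z : sigma z = z -> exists f, z = p f.
Proof.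
rewrite -(to_rowK z) /of_row rmorphD rmorphM /= !sigma_p sigma_zeta => /addrI/eqP.
rewrite -subr_eq0 -mulrBr mulf_eq0 -opprB oppr_eq0 (negbTE zeta_diff) orbF.
by move=> /eqP->; exists (to_row z 0 0); rewrite mul0r addr0.
Qed.

Let theta_ex := frobenius_exists i.
Let theta := projT1 (cid theta_ex).
Let thetaE d : theta d = d ^+ q.
Proof. by rewrite /theta; case: cid. Qed.
Let theta_i b : theta (i b) = i b.
Proof. by rewrite thetaE -rmorphXn expf_card. Qed.
Let theta_surj d : exists e, theta e = d.
Proof. by have [e <-] := frobenius_surj_fin hk2 d; exists e. Qed.
Let sigma_theta d : sigma (const X2 d) = const X2 (theta d).
Proof. by rewrite thetaE. Qed.

Definition conj_place y : place X2 := twist sigma_p sigma_theta theta_surj y.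

Lemma conj_placeE y f : ord (conj_place y) f = ord y (sigma f).
Proof. exact: twistE. Qed.

Lemma under_conj y : under p (conj_place y) = under p y.
Proof. exact: under_twist. Qed.

Lemma conj_placeK y : conj_place (conj_place y) = y.
Proof. by apply: place_inj => f; rewrite !conj_placeE sigma_involutive. Qed.

(** 1, zeta is an integral basis above every x, the extension of constants being unramified. *)
Lemma integral_row x (v : 'rV[F]_2) : v \is a mxOver (valring x) <->
  forall y, under p y = x -> of_row v \in valring y.
Proof.
split=> [/mxOverP vx y yx|H].
  by rewrite /of_row rpredD ?rpredM ?const_valring // under_valring yx.
have reg := @integral_descent _ _ i X X2 p theta theta_i sigma sigma_p sigma_theta
  theta_surj _ x 2 (fun j => v 0 j) one_c one_c_indep.
apply/mxOverP => a j; rewrite ord1; apply: reg => [d dfix|y yx].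
  by apply: (frobenius_fixed i); rewrite -thetaE.
by rewrite -of_row_sum H.
Qed.

Definition mul_mx (g : F2) : 'M[F]_2 := \matrix_(j < 2) to_row (g * (if val j == 0 then 1 else
  zeta)).

Lemma mul_mxE v g : of_row (v *m mul_mx g) = of_row v * g.
Proof.
rewrite mulmx_sum_row !big_ord_recl big_ord0 addr0 of_rowD !of_rowZ !rowK /= !to_rowK mulr1.
rewrite /of_row mulrDl mulrA [p (v 0 _) * g * zeta]mulrAC.
by congr (_ + p (v _ _) * _ * _); apply: val_inj.
Qed.

Lemma mul_mxM g h : mul_mx g *m mul_mx h = mul_mx (g * h).
Proof.
apply/row_matrixP => j; apply: of_row_inj; rewrite row_mul mul_mxE !rowK !to_rowK.
by rewrite mulrAC.
Qed.

Lemma mul_mx1 : mul_mx 1 = 1%:M.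
Proof.
apply/row_matrixP => j; apply: of_row_inj.
by rewrite -[in LHS](mul1mx (mul_mx 1)) row_mul mul_mxE mulr1.
Qed.

Lemma mul_mx_unit g : g != 0 -> mul_mx g \in unitmx.
Proof.
by move=> g0; have := mul_mxM g g^-1; rewrite divff // mul_mx1 => /mulmx1_unit[].
Qed.

Lemma mul_mxV g : g != 0 -> invmx (mul_mx g) = mul_mx g^-1.
Proof.
move=> g0; rewrite -[LHS]mulmx1 -mul_mx1 -(divff g0) -mul_mxM mulKmx //.
exact: mul_mx_unit.
Qed.

Lemma mul_mx_regular x g : (forall y, under p y = x -> g \in valring y) ->
  mul_mx g \is a mxOver (valring x).
Proof.
move=> gx; apply/mxOverP => a b; have : row a (mul_mx g) \is a mxOver (valring x).
  apply/integral_row => y yx; rewrite rowK to_rowK rpredM ?gx //.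
  by case: ifP => _; rewrite ?rpred1 ?const_valring.
by move=> /mxOverP/(_ 0 b); rewrite mxE.
Qed.

(* of_row identifies F^2 with F2, and the stalks of Lat A with those of p_* L_D. *)
Definition represents (D : divisor X2) (A : lattice X 2) := forall x (v : 'rV_2),
  v *m A x \is a mxOver (valring x) <->
  forall y, under p y = x -> of_row v \in ord_ge y (- D y).

Lemma ord_ge_mul y (m : int) (f g : F2) : g != 0 -> ord y g = m ->
  (f * g \in valring y) = (f \in ord_ge y (- m)).
Proof.
move=> g0 gm; have [->|f0] := eqVneq f 0; first by rewrite mul0r !rpred0.
by rewrite valringE ?mulf_neq0 // ord_geE // ord_mul // gm -[in RHS](lerD2r m) addNr.
Qed.

Lemma divisor_finite (D : divisor X2) : finite_set [set y | D y != 0].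
Proof. by case: D => D /= /asboolP. Qed.

(** Weak approximation on the finite fibre above x: one element has the required orders at all its
    places. *)
Lemma local_generators (m : place X2 -> int) : exists G : place X -> F2,
  (forall x, G x != 0) /\ forall y, ord y (G (under p y)) = m y.
Proof.
have /choice[G GP] : forall x, exists g : F2, g != 0 /\ forall y, under p y = x -> ord y g = m y.
  move=> x; have /finite_seqP[s sE] := bc_finite_over p x.
  have [g g0 gs] := prescribed_ords s m; exists g; split=> // y yx; apply: gs.
  by have : [set y | under p y = x] y by []; rewrite sE.
exists G; split=> [x|y]; first by have [] := GP x.
by have [_ h] := GP (under p y); apply: h.
Qed.

(** The matrix at x is multiplication by an element with the orders of D above x: v is in the stalk
    when its product with this element is regular there. *)
Lemma represents_exists (D : divisor X2) : exists A : lattice X 2, represents D A.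
Proof.
have [G [G0 GD]] := local_generators D.
have u x : mul_mx (G x) \in unitmx := mul_mx_unit (G0 x).
have o : is_open [set x | unit_locus (mul_mx (G x)) x].
  rewrite /is_open; apply: (@sub_finite_set _ _ (under p @` [set y | D y != 0])).
    move=> x /= nx; apply: contrapT => H; apply: nx.
    have D0 y : under p y = x -> ord y (G x) = 0.
      move=> yx; rewrite -yx GD; apply/eqP/negPn/negP => Dy; apply: H.
      by exists y.
    split; rewrite /regular_locus /= ?mul_mxV //; apply: mul_mx_regular => y yx.
      by rewrite valringE // D0.
    by rewrite valringE ?invr_eq0 // ord_inv // D0.
  by apply: finite_image; exact: divisor_finite.
exists (MkLattice u o) => x v /=; rewrite integral_row.
by split=> H y yx; have := H y yx; rewrite mul_mxE (@ord_ge_mul _ (D y)) // -yx.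
Qed.

Lemma represents_iso D A : represents D A ->
  isomorphic (pushforward p (LD D)) (Lat A).
Proof.
move=> rep; pose val U (s : pushforward p (LD D) U) : F2 := LD_val (s : LD_sec D _).
have valP U (s : pushforward p (LD D) U) y : U (under p y) -> val U s \in ord_ge y (- D y).
  by move=> Uy; have /asboolP := LD_valP (s : LD_sec D _); apply; apply/preimE.
pose h U (s : pushforward p (LD D) U) : Lat A U := mkLat A U (to_row (val U s)).
have hE U s : LatV (h U s) = to_row (val U s).
  rewrite mkLatK // => x Ux; apply/rep => y yx; rewrite to_rowK.
  by apply: valP; rewrite yx.
exists h.
  split=> [U Uo a s t|U V VU Uo Vo s]; apply: LatV_inj; last by rewrite LatV_res !hE.
  by rewrite LatV_lin !hE -to_row_lin.
move=> U Uo.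
have tP (t : Lat A U) : of_row (LatV t) \in LD_pred D (Defs.preim p U).
  apply/asboolP => y /preimE Uy; have /rep := LatVP t Uy; exact.
exists (fun t : Lat A U => (MkLD (tP t) : LD_sec D (Defs.preim p U))).
  by move=> s; apply: val_inj; rewrite /= hE to_rowK.
by move=> t; apply: LatV_inj; rewrite hE /val /= of_rowK.
Qed.

Lemma t_eq D D' A A' : represents D A -> represents D' A' ->
  t_ p D = t_ p D' <-> lat_sim A A'.
Proof. by move=> rA rA'; apply: pbun_class_eq; exact: represents_iso. Qed.

Lemma relCl_classN D : relCl_class p (- D) = - relCl_class p D.
Proof. by rewrite /relCl_class /divisor_class !raddfN. Qed.

Lemma relCl_class_surj (a : relCl p) : exists D, relCl_class p D = a.
Proof.
exists (generic_quotient.repr (generic_quotient.repr a)).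
by rewrite /relCl_class /divisor_class !generic_quotient.reprK.
Qed.

Lemma relCl_class_eq D D' : relCl_class p D = relCl_class p D' <->
  exists f C C', [/\ f != 0, is_pullback_divisor p C C' &
    forall y, D y = D' y + C' y + ord y f].
Proof.
split.
  move=> /eqP; rewrite /relCl_class -Quotient.idealrBE => /asboolP[C [C' [CC' e]]].
  have : divisor_class (D - D') = divisor_class C' by rewrite -e /divisor_class raddfB.
  move=> /eqP; rewrite /divisor_class -Quotient.idealrBE => /asboolP[f f0 fE].
  exists f, C, C'; split=> // y; have := fE y.
  rewrite -[LHS]/(D y - D' y - C' y) => <-; ring.
move=> [f [C [C' [f0 CC' fE]]]]; apply/eqP; rewrite /relCl_class -Quotient.idealrBE.
apply/asboolP; exists C, C'; split=> //.
rewrite /divisor_class -raddfB; apply/eqP; rewrite -Quotient.idealrBE.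
apply/asboolP; exists f => // y; rewrite -[LHS]/(D y - D' y - C' y) fE; ring.
Qed.

Lemma norm_exists z : exists f, p f = z * sigma z.
Proof.
have /sigma_fixed[f fE] : sigma (z * sigma z) = z * sigma z.
  by rewrite rmorphM /= sigma_involutive mulrC.
by exists f.
Qed.

Lemma ord_ge_shift y (m : int) (f g : F2) : g != 0 ->
  (f * g \in ord_ge y m) = (f \in ord_ge y (m - ord y g)).
Proof.
move=> g0; have [->|f0] := eqVneq f 0; first by rewrite mul0r !rpred0.
by rewrite !ord_geE ?mulf_neq0 // ord_mul // lerBlDr.
Qed.

Lemma divisor_exists (k' : fieldType) (Y : curve k') (m : place Y -> int) :
  finite_set [set z | m z != 0] -> exists D : divisor Y, forall z, D z = m z.
Proof. by move=> mf; exists (Divisor (asboolT mf)). Qed.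

Lemma conj_divisor_exists (D : divisor X2) : exists D' : divisor X2,
  forall y, D' y = D (conj_place y).
Proof.
apply: divisor_exists.
apply: (@sub_finite_set _ _ (conj_place @` [set y | D y != 0])).
  by move=> y /= Dy; exists (conj_place y) => //; exact: conj_placeK.
by apply: finite_image; exact: divisor_finite.
Qed.

(** D + D' is the pullback of the divisor on X whose coefficient at x is the order of the norm of a
    local generator of D above x. *)
Lemma relCl_class_conj (D D' : divisor X2) : (forall y, D' y = D (conj_place y)) ->
  relCl_class p D' = - relCl_class p D.
Proof.
move=> D'E; have [G [G0 GD]] := local_generators D.
have /choice[N NE] := norm_exists.
have N0 x : N (G x) != 0.
  by rewrite -(fmorph_eq0 p) NE mulf_neq0 ?fmorph_eq0.
have NG y : ord y (p (N (G (under p y)))) = D y + D' y.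
  rewrite NE ord_mul ?fmorph_eq0 // GD -conj_placeE -under_conj GD.
  by rewrite D'E.
have [|C CE] := @divisor_exists _ X (fun x => ord x (N (G x))).
  apply: (@sub_finite_set _ _ (under p @` ([set y | D y != 0] `|` [set y | D' y != 0]))).
    move=> x /= Cx; have [y yx] := over_exists p x; exists y => //.
    apply: contrapT => /not_orP[/negP D0 /negP D'0]; rewrite !negbK in D0 D'0.
    have [u ux] := ord_unif x; have yx' : lies_over p y x by apply/lies_over_under.
    (* At a place where D and D' vanish, the ramification index times the coefficient of C is 0; the
       index is not 0, since 1 / u is not regular at x. *)
    have : ord y (p u) * ord x (N (G x)) = 0.
      by rewrite -(ramification _ yx' ux) -yx NG (eqP D0) (eqP D'0).
    move=> /eqP; rewrite mulf_eq0 (negbTE Cx) orbF => /eqP pu.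
    have : p u^-1 \in valring y.
      by rewrite fmorphV valringE ?invr_eq0 ?fmorph_eq0 ?(unif_neq0 ux) // ord_inv ?fmorph_eq0
        ?(unif_neq0 ux) // pu.
    by rewrite under_valring yx valringE ?invr_eq0 ?(unif_neq0 ux) // ord_inv ?(unif_neq0 ux) // ux.
  by apply: finite_image; rewrite finite_setU; split; exact: divisor_finite.
rewrite -relCl_classN; apply/relCl_class_eq; exists 1, C, (D + D'); split.
- exact: oner_neq0.
- move=> y x f yx fx; rewrite -[LHS]/(D y + D' y) -NG CE.
  by have /lies_over_under-> := yx; rewrite (ramification _ yx fx).
- by move=> y; rewrite -[(- D) y]/(- D y) -[(D + D') y]/(D y + D' y) ord_one; ring.
Qed.

(** sigma is F-linear, with matrix S in the basis 1, zeta, and exchanges conjugate places. *)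
Lemma lat_sim_conj (D D' : divisor X2) A A' : (forall y, D' y = D (conj_place y)) ->
  represents D A -> represents D' A' -> lat_sim A' A.
Proof.
move=> D'E rA rA'; have [a aE] := idele_one X.
pose S := \matrix_(j < 2) to_row (sigma (if val j == 0 then 1 else zeta)).
have SE v : of_row (v *m S) = sigma (of_row v).
  rewrite mulmx_sum_row !big_ord_recl big_ord0 addr0 of_rowD !of_rowZ !rowK /= !to_rowK.
  rewrite /of_row rmorphD rmorphM /= !sigma_p rmorph1 mulr1.
  by congr (_ + p (v _ _) * _); apply: val_inj.
have SS : S *m S = 1%:M.
  apply/row_matrixP => j; apply: of_row_inj.
  by rewrite -(mul1mx (S *m S)) mulmxA row_mul row_mul !SE sigma_involutive.
exists a, S; split; first by have [] := mulmx1_unit SS.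
move=> x v; rewrite aE scale1r.
have sE y : (sigma (of_row v) \in ord_ge y (- D y)) = (of_row v \in ord_ge (conj_place y) (- D'
  (conj_place y))).
  rewrite !unfold_in fmorph_eq0 conj_placeE D'E conj_placeK.
  by [].
apply/idP/idP.
  move=> /rA' H; apply/rA => y yx; rewrite SE sE; apply: H; rewrite under_conj //.
move=> /rA H; apply/rA' => y yx.
by have := H (conj_place y); rewrite under_conj SE sE conj_placeK => /(_ yx).
Qed.

(** The similarity is multiplication by f, and the twisting idele is a power of a uniformiser at
    each x, with the coefficient of C as exponent. *)
Lemma lat_sim_relCl D D' A A' : represents D A -> represents D' A' ->
  relCl_class p D = relCl_class p D' -> lat_sim A A'.
Proof.
move=> rA rA' /relCl_class_eq[f [C [C' [f0 CC' DE]]]].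
have /choice[u uP] : forall x : place X, exists u, ord x u = 1 := @ord_unif _ X.
have u0 x := unif_neq0 (uP x).
have uC0 x : u x ^ C x != 0 by rewrite expfz_eq0 negb_and u0 orbT.
have uCo : is_open [set x | u x ^ C x \in valring x /\ (u x ^ C x)^-1 \in valring x].
  rewrite /is_open; apply: (@sub_finite_set _ _ [set x | C x != 0]).
    by move=> x /= H; apply/eqP => C0; apply: H; rewrite C0 expr0z invr1 rpred1.
  by case: (C) => m /= /asboolP.
have [a aE] := idele_exists uC0 uCo; exists a, (mul_mx f).
split; first exact: mul_mx_unit.
move=> x v; rewrite 2!scalemxAl.
have E y : under p y = x ->
    (of_row (a x 0 0 *: v *m mul_mx f) \in ord_ge y (- D' y)) = (of_row v \in ord_ge y (- D y)).
  move=> yx; have pa0 : p (a x 0 0) != 0 by rewrite fmorph_eq0 idele_neq0.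
  rewrite mul_mxE of_rowZ mulrC mulrA mulrC ord_ge_shift ?mulf_neq0 // ord_mul // DE.
  have -> : ord y (p (a x 0 0)) = C' y.
    rewrite aE rmorphXz ?unitfE // ordXz ?fmorph_eq0 // mulrC.
    by rewrite (CC' y x (u x)) //; exact/lies_over_under.
  by congr (_ \in ord_ge _ _); ring.
apply/idP/idP => [/rA H|/rA' H]; first by apply/rA' => y yx; rewrite E ?H.
by apply/rA => y yx; rewrite -E ?H.
Qed.

(** * Similarities between direct images *)

Hypothesis regX : forall f : F, (forall x, f \in valring x) -> exists b, f = const X b.

Lemma regular_constant2 z : (forall y, z \in valring y) -> exists d, z = const X2 d.
Proof.
move=> zreg; have rr x : to_row z \is a mxOver (valring x).
  by apply/integral_row => y _; rewrite to_rowK.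
have /choice[b bE] : forall j, exists b, to_row z 0 j = const X b.
  by move=> j; apply: regX => x; have /mxOverP := rr x.
exists (i (b 0) + i (b 1) * c); rewrite -{1}(to_rowK z) /of_row !bE !(bc_const p).
by rewrite rmorphD rmorphM.
Qed.

(* An F-linear endomorphism of F2 is alpha + beta sigma; composing with
   multiplication by zeta separates the two parts. *)
Lemma linear_decomposition (H : 'M[F]_2) : exists al be, forall z,
  of_row (to_row z *m H) = al * z + be * sigma z.
Proof.
pose h1 := of_row (row 0 H); pose hz := of_row (row 1 H).
(* The solution of al + be = h(1), al zeta + be zeta' = h(zeta). *)
exists ((hz - h1 * zeta') / (zeta - zeta')), ((h1 * zeta - hz) / (zeta - zeta')) => z.
have zd := zeta_diff.
rewrite mulmx_sum_row !big_ord_recl big_ord0 addr0 of_rowD !of_rowZ.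
rewrite (_ : lift ord0 ord0 = 1); last exact: val_inj.
rewrite -/h1 -/hz -{3 4}(to_rowK z) /of_row rmorphD rmorphM /= !sigma_p sigma_zeta.
by field.
Qed.

(** Evaluating h at a local generator G of the stalk and at zeta G, and eliminating, shows that z
    |-> al z and z |-> be sigma(z) separately map stalks into stalks, because zeta - zeta' is a
    constant and so a unit at every place. *)
Lemma hom_bounds (D D' : divisor X2) (h : F2 -> F2) al be (g : place X -> F2) :
  (forall x, g x != 0) -> (forall z, h z = al * z + be * sigma z) ->
  (forall x z, (forall y, under p y = x -> z \in ord_ge y (- D y)) ->
     forall y, under p y = x -> g x * h z \in ord_ge y (- D' y)) ->
  (al != 0 -> forall y, D y - D' y <= ord y al + ord y (g (under p y))) /\
  (be != 0 -> forall y, D (conj_place y) - D' y <= ord y be + ord y (g (under p y))).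
Proof.
move=> g0 hE hD; have [G [G0 GD]] := local_generators (fun y => - D y).
have zd := zeta_diff.
have in1 y0 y : under p y = under p y0 -> G (under p y0) \in ord_ge y (- D y).
  by move=> <-; rewrite ord_geE // GD.
have in2 y0 y : under p y = under p y0 -> zeta * G (under p y0) \in ord_ge y (- D y).
  by move=> e; rewrite -[- D y]add0r ord_geM ?in1 // ord_ge0E const_valring.
have sc y m z d : z \in ord_ge y m -> const X2 d * z \in ord_ge y m.
  by move=> zm; rewrite -[m]add0r ord_geM // ord_ge0E const_valring.
have m1 y := hD _ _ (in1 y) y erefl; have m2 y := hD _ _ (in2 y) y erefl.
split=> nz y.
  have : al * (g (under p y) * G (under p y)) \in ord_ge y (- D' y).
    have -> : al * (g (under p y) * G (under p y)) = const X2 ((c - c ^+ q)^-1) *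
        (g (under p y) * h (zeta * G (under p y)) -
         zeta' * (g (under p y) * h (G (under p y)))).
      rewrite fmorphV rmorphB -/zeta -/zeta' !hE rmorphM /= sigma_zeta; by field.
    by apply: (sc); rewrite rpredB ?m2 //; apply: (sc).
  by rewrite ord_geE ?mulf_neq0 // !ord_mul ?mulf_neq0 // GD; lia.
have : be * (g (under p y) * sigma (G (under p y))) \in ord_ge y (- D' y).
  have -> : be * (g (under p y) * sigma (G (under p y))) = const X2 ((c ^+ q - c)^-1) *
      (g (under p y) * h (zeta * G (under p y)) -
       zeta * (g (under p y) * h (G (under p y)))).
    rewrite fmorphV rmorphB -/zeta -/zeta' !hE rmorphM /= sigma_zeta; field.
    by rewrite -opprB oppr_eq0.
  by apply: (sc); rewrite rpredB ?m2 //; apply: (sc).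
rewrite ord_geE ?mulf_neq0 ?fmorph_eq0 // !ord_mul ?mulf_neq0 ?fmorph_eq0 //.
by rewrite -conj_placeE -under_conj GD; lia.
Qed.

Lemma relCl_class_ord (D D' : divisor X2) (f : F2) (a : lattice X 1) : f != 0 ->
  (forall y, D y = D' y + ord y (p (a (under p y) 0 0)) + ord y f) ->
  relCl_class p D = relCl_class p D'.
Proof.
move=> f0 DE; have [C CE] : exists C : divisor X, forall x, C x = ord x (a x 0 0).
  apply: divisor_exists; have := idele_open a; rewrite /is_open.
  by apply: sub_finite_set => x /= Cx [a1 a2]; rewrite ord_eq0 ?eqxx in Cx.
have [C' C'E] : exists C' : divisor X2, forall y, C' y = ord y (p (a (under p y) 0 0)).
  apply: divisor_exists; have := preim_open p (idele_open a); rewrite /is_open.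
  apply: sub_finite_set => y /= Cy /preimE[a1 a2]; move: Cy.
  by rewrite ord_eq0 ?eqxx // -?fmorphV under_valring.
apply/relCl_class_eq; exists f, C, C'; split=> // [y x u yx ux|y].
  rewrite C'E CE; have /lies_over_under e := yx; rewrite e.
  exact: ramification.
by rewrite C'E DE.
Qed.

Lemma lat_sim_relCl_conv (D D' : divisor X2) A A' : represents D A -> represents D' A' ->
  lat_sim A A' ->
  relCl_class p D = relCl_class p D' \/ relCl_class p D = - relCl_class p D'.
Proof.
move=> rA rA' [a [H [Hu HE]]].
have [al [be hE]] := linear_decomposition H.
have [al' [be' hE']] := linear_decomposition (invmx H).
pose g x := p (a x 0 0); have g0 x : g x != 0 by rewrite fmorph_eq0 idele_neq0.
have gV0 x : (g x)^-1 != 0 by rewrite invr_eq0.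
have key x v : (forall y, under p y = x -> of_row v \in ord_ge y (- D y)) <->
    (forall y, under p y = x -> g x * of_row (v *m H) \in ord_ge y (- D' y)).
  rewrite -(rA x v) HE scalemxAl rA' of_rowZ; exact: iff_refl.
have [b1 b2] := hom_bounds g0 hE (fun x z zD => (key x (to_row z)).1
   (fun y yx => eq_ind_r (fun w => w \in ord_ge y (- D y)) (zD y yx) (to_rowK z))).
have [|b1' b2'] := @hom_bounds D' D _ al' be' (fun x => (g x)^-1) gV0 hE'.
  move=> x z zD y yx; have := (key x (to_row ((g x)^-1 * of_row (to_row z *m invmx H)))).2.
  rewrite to_rowK; apply=> // y' y'x.
  have -> : (g x)^-1 * of_row (to_row z *m invmx H) =
      of_row ((a x 0 0)^-1 *: (to_row z *m invmx H)) by rewrite of_rowZ fmorphV.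
  rewrite of_rowK -scalemxAl mulmxKV // of_rowZ to_rowK fmorphV mulrA.
  by rewrite divff ?mul1r ?zD // g0.
(* The composite of the two maps is the identity; comparing its values at 1 and zeta isolates the
   coefficient of z. *)
have inv : al' * al + be' * sigma be = 1.
  have e z : (al' * al + be' * sigma be) * z + (al' * be + be' * sigma al) * sigma z = z.
    rewrite -[RHS]to_rowK -[in RHS](mulmxK Hu (to_row z)) -[to_row z *m H]of_rowK hE' hE.
    by rewrite rmorphD !rmorphM /= sigma_involutive; ring.
  have e1 := e 1; have ez := e zeta; rewrite rmorph1 !mulr1 sigma_zeta in e1 ez.
  have zd := zeta_diff; apply: (mulIf zd).
  transitivity ((al' * al + be' * sigma be) * zeta + (al' * be + be' * sigma al) * zeta' -
    (al' * al + be' * sigma be + (al' * be + be' * sigma al)) * zeta'); first by ring.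
  by rewrite ez e1 !mul1r.
have [aa|aa] := eqVneq (al' * al) 0.
  right; have bb : be' * sigma be = 1 by rewrite -inv aa add0r.
  have [be'0 be0] : be' != 0 /\ be != 0.
    by have : be' * sigma be != 0; [rewrite bb oner_eq0|rewrite mulf_eq0 negb_or fmorph_eq0 =>
      /andP[]].
  have [E EE] := conj_divisor_exists D'.
  rewrite -(relCl_class_conj EE).
  apply: (@relCl_class_ord _ _ be'^-1 a); first by rewrite invr_eq0.
  move=> y; rewrite EE ord_inv //.
  have := b2 be0 (conj_place y); have := b2' be'0 y.
  rewrite conj_placeK conj_placeE under_conj conj_placeE -[sigma (g _)]/(sigma (p _)) sigma_p
    ord_inv // -/(g _).
  (* The two bounds have opposite left sides, and right sides with sum 0, so both are equalities and
     give the divisor exactly. *)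
  have : ord y be' + ord y (sigma be) = 0 by rewrite -ord_mul ?fmorph_eq0 // bb ord_one.
  lia.
left; have [al'0 al0] : al' != 0 /\ al != 0 by apply/andP; rewrite -negb_or -mulf_eq0.
have B y := b1 al0 y; have B' y := b1' al'0 y.
have [d dE] : exists d, al' * al = const X2 d.
  apply: regular_constant2 => y; rewrite valringE // ord_mul //.
  by have := B y; have := B' y; rewrite ord_inv //; lia.
apply: (@relCl_class_ord _ _ al a) => // y.
have := B y; have := B' y; rewrite ord_inv // -/(g _).
have : ord y al' + ord y al = 0 by rewrite -ord_mul // dE ord_const.
lia.
Qed.

Lemma represents0 (I : lattice X 2) : (forall x, I x = 1%:M) -> represents 0 I.
Proof.
move=> I1 x v; rewrite I1 mulmx1 integral_row.
by split=> H y yx; have := H y yx; rewrite -[(- (0 : divisor X2) y)]/(- 0) oppr0.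
Qed.

(** * Decomposability of direct images *)

Variables tau nu : k.
Hypothesis c_quadratic : c ^+ 2 = i tau * c - i nu.
Hypothesis irr : forall r : k, r ^+ 2 - tau * r + nu != 0.

Let Z := mul_mx zeta.

Lemma zeta_sqr : zeta * zeta = p (const X tau) * zeta - p (const X nu).
Proof. by rewrite !(bc_const p) -!rmorphM -rmorphB -expr2 c_quadratic. Qed.

Lemma mul_mx_zetaE : Z *m Z = const X tau *: Z - (const X nu)%:M.
Proof.
apply/row_matrixP => j; rewrite !rowE; move: (delta_mx 0 j) => v.
rewrite mulmxA mulmxBr mul_mx_scalar -scalemxAr; apply: of_row_inj.
rewrite -scaleNr of_rowD !of_rowZ !mul_mxE -mulrA zeta_sqr rmorphN; ring.
Qed.

Lemma represents_zeta D A : represents D A -> lat_hom A A Z.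
Proof.
move=> rA x v /rA H; apply/rA => y yx; rewrite mul_mxE.
by rewrite -[- D y]addr0 ord_geM ?H // ord_ge0E const_valring.
Qed.

Lemma block2E (b1 b2 : lattice X 1) x (v : 'rV[F]_2) :
  (v *m lat_block b1 b2 x \is a mxOver (valring x)) =
  (v 0 0 * b1 x 0 0 \in valring x) && (v 0 1 * b2 x 0 0 \in valring x).
Proof.
pose v' : 'rV[F]_(1 + 1) := v.
have E : v' *m lat_block b1 b2 x = row_mx (lsubmx v' *m b1 x) (rsubmx v' *m b2 x).
  by rewrite -block_unit1 hsubmxK.
transitivity (row_mx (lsubmx v' *m b1 x) (rsubmx v' *m b2 x) \is a mxOver (valring x)).
  by rewrite -E.
rewrite mxOver_row_mx !mxOver11 ![(_ *m _) 0 0]mxE !big_ord1.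
have -> : lsubmx v' 0 0 = v 0 0 by rewrite mxE; congr (v _ _); exact: val_inj.
by have -> : rsubmx v' 0 0 = v 0 1 by rewrite mxE; congr (v _ _); exact: val_inj.
Qed.

(* The off-diagonal entries of zeta, acting on a decomposition M + N, are maps
   N -> M and M -> N whose composite is a nonzero constant. *)
Lemma decomposable_trivial D A (I : lattice X 2) : represents D A -> (forall x, I x = 1%:M) ->
  (exists b1 b2 : lattice X 1, isomorphic (Lat A) (Lat (lat_block b1 b2))) ->
  lat_sim A I.
Proof.
move=> rA I1 [b1 [b2 iso]]; apply: lat_sim_trans (lat_sim_iso iso) _.
have [H [H' [HH' H'H AB BA]]] := (isomorphic_Lat _ _).1 iso.
pose P : 'M[F]_2 := H' *m Z *m H.
have PB : lat_hom (lat_block b1 b2) (lat_block b1 b2) P.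
  exact: lat_homM (lat_homM BA (represents_zeta rA)) AB.
have PP : P *m P = const X tau *: P - (const X nu)%:M.
  rewrite /P !mulmxA -(mulmxA _ H H') HH' mulmx1 -(mulmxA _ Z Z) mul_mx_zetaE.
  rewrite mulmxBr mulmxBl -scalemxAr -scalemxAl mul_mx_scalar -scalemxAl; congr (_ - _).
  by rewrite (H'H : H' *m H = 1%:M) scalemx1.
clearbody P; have b10 x := idele_neq0 b1 x; have b20 x := idele_neq0 b2 x.
(* The vector (1 / b1_x, 0) generates the first summand of the stalk, and its image under P is
   integral; [P1] treats the second summand. *)
have P0 x : P 0 0 \in valring x /\ (b1 x 0 0)^-1 * P 0 1 * b2 x 0 0 \in valring x.
  have := PB x (\row_j if val j == 0 then (b1 x 0 0)^-1 else 0).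
  rewrite !block2E !mulmx2 !mxE /= mulVf // mul0r rpred1 rpred0 => /(_ isT).
  by rewrite !mul0r !addr0 mulrAC mulVf // mul1r => /andP[].
have P1 x : (b2 x 0 0)^-1 * P 1 0 * b1 x 0 0 \in valring x.
  have := PB x (\row_j if val j == 0 then 0 else (b2 x 0 0)^-1).
  rewrite !block2E !mulmx2 !mxE /= mulVf // mul0r rpred1 rpred0 => /(_ isT).
  by rewrite !mul0r !add0r => /andP[].
have [f fE] : exists f, P 0 0 = const X f by apply: regX => x; have [] := P0 x.
have [kap kE] : exists kap, P 0 1 * P 1 0 = const X kap.
  apply: regX => x; have -> : P 0 1 * P 1 0 =
    ((b1 x 0 0)^-1 * P 0 1 * b2 x 0 0) * ((b2 x 0 0)^-1 * P 1 0 * b1 x 0 0).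
    by field; rewrite b10 b20.
  by rewrite rpredM ?P1 // (P0 x).2.
have eq0 : P 0 0 * P 0 0 + P 0 1 * P 1 0 = const X tau * P 0 0 - const X nu.
  by have := congr1 (fun M : 'M_2 => M 0 0) PP; rewrite mulmx2 !mxE mulr1n.
(* If kap = 0, the constant entry P_00 is a root in k of the irreducible polynomial of zeta. *)
have kap0 : kap != 0.
  apply: contra (irr f) => /eqP k0; apply/eqP; apply: (fmorph_inj (const X)).
  rewrite rmorph0 rmorphD rmorphB rmorphXn rmorphM -fE.
  have := eq0; rewrite kE k0 rmorph0 addr0 => e; rewrite expr2 e; ring.
have P01 : P 0 1 != 0.
  by apply: contra_neq kap0 => z; move: kE; rewrite z mul0r => /esym/eqP; rewrite fmorph_eq0 =>
    /eqP.
have P10 : P 1 0 != 0.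
  by apply: contra_neq kap0 => z; move: kE; rewrite z mulr0 => /esym/eqP; rewrite fmorph_eq0 =>
    /eqP.
(* P_01 is an isomorphism between the two summands up to the constant kap; dividing the second
   coordinate by it makes both summands equal to b1, which the twist removes. *)
pose K : 'M[F]_2 := \matrix_(a, b) if a == b then (if val a == 0 then 1 else (P 0 1)^-1) else 0.
exists b1, K; split.
  rewrite unitmxE det2 !mxE /=. by rewrite mulr0 subr0 mul1r unitfE invr_eq0.
move=> x v; rewrite I1 mulmx1 block2E.
have -> : (b1 x 0 0 *: (v *m K) \is a mxOver (valring x)) =
    (v 0 0 * b1 x 0 0 \in valring x) && (b1 x 0 0 * (v 0 1 / P 0 1) \in valring x).
  have E0 : (b1 x 0 0 *: (v *m K)) 0 0 = v 0 0 * b1 x 0 0.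
    by rewrite mxE mulmx2 !mxE /= mulr1 mulr0 addr0 mulrC.
  have E1 : (b1 x 0 0 *: (v *m K)) 0 1 = b1 x 0 0 * (v 0 1 / P 0 1).
    by rewrite mxE mulmx2 !mxE /= mulr0 add0r.
  rewrite -E0 -E1; apply/mxOverP/andP => [h|[h0 h1] a]; first by split; exact: h.
  by rewrite ord1; apply: ord2P.
congr (_ && _); have u1 := (P0 x).2; have u2 := P1 x.
apply/idP/idP => h.
  have -> : b1 x 0 0 * (v 0 1 / P 0 1) = (v 0 1 * b2 x 0 0) *
      ((b2 x 0 0)^-1 * P 1 0 * b1 x 0 0) * const X kap^-1.
    by rewrite fmorphV -kE; field; rewrite P01 P10 b20.
  by rewrite rpredM ?const_valring // rpredM.
have -> : v 0 1 * b2 x 0 0 = b1 x 0 0 * (v 0 1 / P 0 1) * ((b1 x 0 0)^-1 * P 0 1 * b2 x 0 0).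
  by field; rewrite P01 b10.
exact: rpredM.
Qed.

(** In the basis 1, zeta, multiplication by zeta is a companion matrix. *)
Lemma zeta_entry : [/\ Z 0 0 = 0, Z 0 1 = 1, Z 1 0 = - const X nu & Z 1 1 = const X tau].
Proof.
have r0 : row 0 Z = \row_j (if val j == 0 then 0 else 1).
  apply: of_row_inj; rewrite rowK to_rowK /= mulr1 /of_row !mxE /=.
  by rewrite rmorph0 rmorph1 add0r mul1r.
have r1 : row 1 Z = \row_j (if val j == 0 then - const X nu else const X tau).
  apply: of_row_inj; rewrite rowK to_rowK /= /of_row !mxE /= zeta_sqr rmorphN; ring.
by split; [have /rowP/(_ 0) := r0|have /rowP/(_ 1) := r0|
  have /rowP/(_ 0) := r1|have /rowP/(_ 1) := r1]; rewrite !mxE.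
Qed.

Section Geometric.
Variables (kbar : closedFieldType) (ibar : {rmorphism k -> kbar}).
Variables (Xbar : curve kbar) (pbar : base_change ibar X Xbar).
Local Notation cbar := (const Xbar).

(** Over kbar the polynomial of zeta has distinct roots r and r', so (zeta - r) / (r' - r) is
    idempotent; its nonzero off-diagonal entry shows that it is neither 0 nor 1. *)
Lemma represents_pullback_decomposable D A : represents D A ->
  exists b1 b2 : lattice Xbar 1, isomorphic (Lat (lat_pull pbar A)) (Lat (lat_block b1 b2)).
Proof.
move=> rA; have [r [rq rs rp]] := quadratic_roots_closed ibar irr.
set r' := r ^+ #|k| in rq rs rp.
pose Zb := map_mx pbar Z; pose N := Zb - (cbar r)%:M.
have g0 : cbar (r' - r) != 0 by rewrite fmorph_eq0 subr_eq0; apply/eqP.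
have Zbe : Zb *m Zb = (cbar r + cbar r') *: Zb - (cbar r * cbar r')%:M.
  rewrite -map_mxM mul_mx_zetaE map_mxB map_mxZ map_scalar_mx /=.
  by rewrite !(bc_const pbar) -rs -rp rmorphD rmorphM.
have NN : N *m N = cbar (r' - r) *: N.
  rewrite /N mulmxBl !mulmxBr Zbe mul_mx_scalar !mul_scalar_mx scale_scalar_mx rmorphB.
  apply/matrixP => a b; rewrite !mxE; case: (a == b); rewrite /= ?mulr1n ?mulr0n; ring.
have ZA : lat_hom (lat_pull pbar A) (lat_pull pbar A) Zb.
  apply/lat_homP => y; rewrite /= -map_invmx -!map_mxM mxOver_map.
  by have /lat_homP := represents_zeta rA; apply.
have [_ Z01 _ _] := zeta_entry.
have N01 : N 0 1 = 1.
  by rewrite mxE [Zb 0 1]mxE Z01 rmorph1 !mxE /= mulr0n subr0.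
have gV : cbar (r' - r)^-1 = (cbar (r' - r))^-1 by rewrite fmorphV.
apply: (@idempotent_decomposes _ _ _ (cbar (r' - r)^-1 *: N)).
- by rewrite -scalemxAl -scalemxAr NN gV [_^-1 *: (_ *: N)]scalerA mulVf // scale1r.
- apply: contra_neq g0 => /matrixP/(_ 0 1); rewrite mxE N01 mulr1 [RHS]mxE gV => /eqP.
  by rewrite invr_eq0 => /eqP.
- apply: contra_neq g0 => /matrixP/(_ 0 1); rewrite mxE N01 mulr1 [RHS]mxE gV => /eqP.
  by rewrite invr_eq0 => /eqP.
- rewrite -mul_mx_scalar; apply: lat_homM; last exact: lat_hom_scalar.
  rewrite /N -raddfN -rmorphN; apply: lat_homD => //; exact: lat_hom_scalar.
Qed.

Lemma t_dichotomy D : PBun2tr pbar (t_ p D) \/ t_ p D = c0 X.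
Proof.
have [A rA] := represents_exists D; have [I I1] := lat_one_exists X.
have cA : t_ p D = pbun_class (Lat A).
  apply/(pbun_class_eq (represents_iso rA) (isomorphic_refl _)); exact: lat_sim_refl.
have [dec|nd] := pselect (exists b1 b2 : lattice X 1, isomorphic (Lat A) (Lat (lat_block b1 b2))).
  right; apply/(pbun_class_eq (represents_iso rA) (c0_isomorphic I1)).
  exact: decomposable_trivial rA I1 dec.
left; exists (Lat A); split=> //; first exact: Lat_vector_bundle.
  by move=> /(decomposable_rank2 (isomorphic_refl _)).
exists (Lat (lat_pull pbar A)); first exact: Lat_pullback.
apply/(decomposable_rank2 (isomorphic_refl _)); exact: represents_pullback_decomposable rA.
Qed.

End Geometric.

(** * Lattices stable under zeta *)

Lemma clear_denominators m n (M : 'M[F]_(m, n)) x :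
  exists d, d != 0 /\ d *: M \is a mxOver (valring x).
Proof.
have [u ux] := ord_unif x; have u0 := unif_neq0 ux.
pose N := (\sum_a \sum_b `|ord x (M a b)|)%N.
exists (u ^+ N); split; first by rewrite expf_neq0.
apply/mxOverP => a b; rewrite mxE; have [->|M0] := eqVneq (M a b) 0; first by rewrite mulr0 rpred0.
rewrite valringE ?mulf_neq0 ?expf_neq0 // ord_mul ?expf_neq0 // ordX ux.
have : (`|ord x (M a b)| <= N)%N.
  rewrite /N (bigD1 a) //= (bigD1 b) //=; apply: leq_trans (leq_addr _ _).
  exact: leq_addr.
by rewrite natz; move: (ord x (M a b)) N => z l; lia.
Qed.

(* A submodule of F2 over the semilocal ring of functions regular above x that
   is bounded and nonzero is principal; it is cut out by its minimal orders. *)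
Lemma fractional_ideal x (L : F2 -> Prop) :
  (forall g h, L g -> L h -> L (g + h)) ->
  (forall r g, (forall y, under p y = x -> r \in valring y) -> L g -> L (r * g)) ->
  (exists g, g != 0 /\ L g) ->
  (exists d, d != 0 /\ forall g, L g -> forall y, under p y = x -> d * g \in valring y) ->
  exists m : place X2 -> int, (forall g, L g <-> forall y, under p y = x -> g \in ord_ge y (m y)) /\
    forall y, under p y = x -> exists g, [/\ g != 0, L g & ord y g = m y].
Proof.
move=> LD LM [g0 [g0nz Lg0]] [d [d0 dL]].
have minex y : exists m : int, under p y = x ->
    (forall g, L g -> g \in ord_ge y m) /\ exists g, [/\ g != 0, L g & ord y g = m].
  have [yx|nyx] := pselect (under p y = x); last by exists 0.
  have bd g : L g -> g != 0 -> - ord y d <= ord y g.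
    by move=> Lg gnz; have := dL g Lg y yx; rewrite valringE ?mulf_neq0 // ord_mul //; lia.
  (* Orders of elements of L at y are at least - ord y d; shifting by [ord y d] makes the minimum
     one of natural numbers. *)
  have ex : exists n : nat, `[< exists g, [/\ g != 0, L g & ord y g = n%:Z - ord y d] >].
    exists `|(ord y g0 + ord y d)%R|%N; apply/asboolP; exists g0; split=> //.
    by have := bd g0 Lg0 g0nz; lia.
  have [n /asboolP[g [gnz Lg gE]] nmin] := ex_minnP ex.
  exists (n%:Z - ord y d) => _; split; last by exists g.
  move=> h Lh; have [->|hnz] := eqVneq h 0; first exact: rpred0.
  rewrite ord_geE //; have hb := bd h Lh hnz.
  have : (n <= `|(ord y h + ord y d)%R|)%N.
    by apply: nmin; apply/asboolP; exists h; split=> //; lia.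
  lia.
have /choice[m mP] := minex.
exists m; split; last by move=> y yx; have [_] := mP y yx.
have /finite_seqP[s sE] := bc_finite_over p x.
have sP y : y \in undup s <-> under p y = x.
  rewrite mem_undup; split=> h; first by have : [set` s] y by []; rewrite -sE.
  by have : [set y | under p y = x] y by []; rewrite sE.
have /choice[gg ggP] : forall y, exists g, under p y = x -> [/\ g != 0, L g & ord y g = m y].
  move=> y; have [yx|nyx] := pselect (under p y = x); last by exists 0.
  by have [_ [g gP]] := mP y yx; exists g.
(* e_y has order 0 at y and, at the other places z above x, an order so large that e_y g_y has order
   above m_z. Hence the sum u of the e_y g_y has order m_y at every y and generates L. *)
have /choice[e eP] : forall y, exists e : F2, e != 0 /\ forall z, z \in undup s ->
    ord z e = if z == y then 0 else (`|m z| + `|ord z (gg y)|)%N.+1%:Z.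
  move=> y; have [e e0 eE] := prescribed_ords (undup s)
    (fun z => if z == y then 0 else (`|m z| + `|ord z (gg y)|)%N.+1%:Z).
  by exists e.
have L0 : L 0.
  by have := LM 0 g0 (fun y _ => rpred0 _) Lg0; rewrite mul0r.
pose u := \sum_(y <- undup s) e y * gg y.
have Lu : L u.
  rewrite /u big_seq; apply: (big_ind L) => // y /sP yx; apply: LM; last by have [] := ggP y yx.
  move=> z /sP zs; have [e0 eE] := eP y.
  by rewrite valringE // eE //; case: eqP.
have ou y : y \in undup s -> u != 0 /\ ord y u = m y.
  move=> ys; have yx := (sP y).1 ys; have [gnz Lg gE] := ggP y yx; have [e0 eE] := eP y.
  have eg : ord y (e y * gg y) = m y by rewrite ord_mul // eE // eqxx add0r.
  rewrite /u (bigD1_seq y) ?undup_uniq //= -eg; apply: ord_addl; first by rewrite mulf_neq0.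
  rewrite eg big_seq_cond; apply: rpred_sum => z /andP[zs zy].
  have [gznz _ _] := ggP z ((sP z).1 zs); have [ez0 ezE] := eP z.
  rewrite ord_geE ?mulf_neq0 // ord_mul // ezE // eq_sym (negbTE zy).
  by lia.
move=> g; split=> [Lg y yx|H]; first by have [h _] := mP y yx; apply: h.
have [y0 y0x] := over_exists p x; have [u0 _] := ou y0 ((sP y0).2 y0x).
rewrite -(divfK u0 g); apply: LM => // y yx; have [_ uE] := ou y ((sP y).2 yx).
have := H y yx; have [->|gnz] := eqVneq g 0; first by rewrite mul0r !rpred0.
by rewrite ord_geE // valringE ?mulf_neq0 ?invr_eq0 // ord_div // uE subr_ge0.
Qed.

(** Each stalk is stable under the local ring at x and under zeta, hence under all functions regular
    above x, as 1, zeta is an integral basis. So it is a fractional ideal, which is the unit ideal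
    wherever B is unimodular. *)
Lemma zeta_stable_represented (B : lattice X 2) : lat_hom B B Z -> exists D, represents D B.
Proof.
move=> BZ; pose L x g := to_row g *m B x \is a mxOver (valring x).
have toD g h : to_row (g + h) = to_row g + to_row h.
  by have := to_row_lin 1 g h; rewrite rmorph1 mul1r scale1r.
have LE x : exists m : place X2 -> int,
    (forall g, L x g <-> forall y, under p y = x -> g \in ord_ge y (m y)) /\
    forall y, under p y = x -> exists g, [/\ g != 0, L x g & ord y g = m y].
  apply: fractional_ideal.
  - by move=> g h Lg Lh; rewrite /L toD mulmxDl rpredD.
  - move=> r g rx Lg; have := (integral_row x (to_row r)).2.
    rewrite to_rowK => /(_ rx)/mxOverP rO.
    have -> : r * g = p (to_row r 0 0) * g + p (to_row r 0 1) * (g * zeta).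
      by rewrite -{1}(to_rowK r) /of_row; ring.
    rewrite /L to_row_lin mulmxDl.
    have -> : to_row (p (to_row r 0 1) * (g * zeta)) = to_row r 0 1 *: (to_row g *m Z).
      by apply: of_row_inj; rewrite to_rowK of_rowZ mul_mxE to_rowK.
    have sc a (w : 'rV[F]_2) : a \in valring x -> w \is a mxOver (valring x) ->
        a *: w \is a mxOver (valring x).
      by move=> ax /mxOverP wx; apply/mxOverP => b l; rewrite mxE rpredM.
    by rewrite rpredD // -scalemxAl sc //; exact: BZ.
  - have [d [d0 dB]] := clear_denominators (B x) x.
    exists (p d); split; first by rewrite fmorph_eq0.
    have -> : p d = p d * 1 + 0 by rewrite mulr1 addr0.
    rewrite /L to_row_lin.
    have -> : to_row 0 = 0 by apply: of_row_inj; rewrite to_rowK of_row0.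
    rewrite addr0 -scalemxAl scalemxAr mxOverM //.
    by apply/integral_row => y _; rewrite to_rowK rpred1.
  - have [d [d0 dB]] := clear_denominators (invmx (B x)) x.
    exists (p d); split; first by rewrite fmorph_eq0.
    move=> g Lg y yx; rewrite -(to_rowK g) -of_rowZ; move: y yx; apply/integral_row.
    rewrite -(mulmxK (lat_unit B x) (to_row g)) scalemxAr; exact: mxOverM.
have /choice[m mP] := LE.
have [D DE] : exists D : divisor X2, forall y, D y = - m (under p y) y.
  apply: divisor_exists; have := preim_open p (lat_open B); rewrite /is_open.
  apply: sub_finite_set => y /= my /preimE[Bx BVx]; move: my; apply/negP; rewrite negbK oppr_eq0.
  have Lint g : L (under p y) g <-> forall z, under p z = under p y -> g \in valring z.
    rewrite -(to_rowK g) -integral_row to_rowK; split=> h; last exact: mxOverM.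
    by rewrite -(mulmxK (lat_unit B (under p y)) (to_row g)) mxOverM.
  have [mL mex] := mP (under p y); have [g [gnz Lg gE]] := mex y erefl.
  have := (mL 1).1 ((Lint 1).2 (fun z _ => rpred1 _)) y erefl.
  rewrite ord_geE ?oner_eq0 // ord_one.
  have := (Lint g).1 Lg y erefl; rewrite valringE // gE; lia.
exists D => x v; have [mL _] := mP x.
have E : L x (of_row v) <-> v *m B x \is a mxOver (valring x) by rewrite /L of_rowK.
split=> [/E/mL H|H]; first by move=> y yx; rewrite DE opprK yx; apply: H.
by apply/E/mL => y yx; have := H y yx; rewrite DE opprK yx.
Qed.

(** In the basis formed by the first unit vector and its image under f, the matrix of f is the
    companion matrix Z; after this change of basis f becomes multiplication by zeta. *)
Lemma endo_represented (A : lattice X 2) f : lat_hom A A f ->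
  f *m f = const X tau *: f - (const X nu)%:M -> exists D, pbun_class (Lat A) = t_ p D.
Proof.
move=> fA ff; have [Z00 Z01 Z10 Z11] := zeta_entry.
have f01 : f 0 1 != 0.
  apply/eqP => f01; have e : f 0 0 * f 0 0 = const X tau * f 0 0 - const X nu.
    by have := congr1 (fun M : 'M_2 => M 0 0) ff; rewrite mulmx2 f01 mul0r addr0 !mxE mulr1n.
  (* f_00 would be an eigenvalue in F. If it had a pole, its inverse would be regular, and so would
     f_00 = tau - nu / f_00; hence it is a constant, a root in k. *)
  have [r rE] : exists r, f 0 0 = const X r.
    apply: regX => x; apply/negPn/negP => nr; have /negP := nr; apply.
    have [z|nz] := eqVneq (f 0 0) 0; first by rewrite z rpred0.
    have -> : f 0 0 = const X tau - const X nu * (f 0 0)^-1.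
      by apply: (mulIf nz); rewrite e mulrBl mulfVK.
    by rewrite rpredB ?rpredM ?const_valring // valring_total.
  have /eqP := irr r; apply; apply: (fmorph_inj (const X)).
  by rewrite rmorph0 rmorphD rmorphB rmorphXn rmorphM -rE expr2 e; ring.
pose H : 'M[F]_2 := \matrix_(a, b) if val a == 0 then (b == 0)%:R else f 0 b.
have H0 b : H 0 b = (b == 0)%:R by rewrite mxE.
have H1 b : H 1 b = f 0 b by rewrite mxE.
have Hu : H \in unitmx.
  by rewrite unitmxE det2 !H0 !H1 /= mul1r mul0r subr0 unitfE.
have HZ : H *m f = Z *m H.
  have ff0 b : f 0 0 * f 0 b + f 0 1 * f 1 b = const X tau * f 0 b - const X nu * (b == 0)%:R.
    have := congr1 (fun M : 'M_2 => M 0 b) ff; rewrite mulmx2 => ->.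
    by rewrite !mxE eq_sym; case: (b == 0); rewrite /= ?mulr1n ?mulr0n ?mulr1 ?mulr0.
  apply/matrixP => a b; move: a; apply: ord2P; rewrite !mulmx2 ?H0 ?H1 ?Z00 ?Z01 ?Z10 ?Z11.
    by rewrite /= !mul0r !mul1r add0r addr0.
  by rewrite ff0; ring.
have u x : H *m A x \in unitmx by rewrite unitmx_mul Hu lat_unit.
have o : is_open [set x | unit_locus (H *m A x) x].
  apply: is_openS (is_openI (lat_open A) (unit_locus_open H)) _ => x /= [[Ax AVx] [Hx HVx]].
  split; first exact: mxOverM.
  have -> : invmx (H *m A x) = invmx (A x) *m invmx H.
    by apply: (can_inj (mulKmx (u x))); rewrite mulmxV // mulmxA mulmxK ?lat_unit // mulmxV.
  exact: mxOverM.
pose B := MkLattice u o.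
have BZ : lat_hom B B Z.
  by move=> x v; rewrite /= -(mulmxA v Z) (mulmxA Z) -HZ !mulmxA => h; apply: fA.
have [D rD] := zeta_stable_represented BZ; exists D.
apply/(pbun_class_eq (isomorphic_refl _) (represents_iso rD)).
have [a aE] := idele_one X; exists a, (invmx H); rewrite unitmx_inv; split=> // x v.
by rewrite aE scale1r /= mulmxA mulmxKV.
Qed.

End QuadraticCover.

(** * Fibres and image of the map *)

Section TrMap.
Variables (k k2 : finFieldType) (i : {rmorphism k -> k2}).
Hypothesis hk2 : #|k2| = (#|k| ^ 2)%N.
Variables (X : curve k) (X2 : curve k2) (p : base_change i X X2).
Variable c : k2.
Hypothesis ck : forall b, c <> i b.
Variable sigma : {rmorphism funField X2 -> funField X2}.
Hypothesis sigma_p : forall f, sigma (p f) = p f.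
Hypothesis sigma_c : forall d, sigma (const X2 d) = const X2 (d ^+ #|k|).
Hypothesis regX : forall f : funField X, (forall x, f \in valring x) ->
  exists b, f = const X b.

Lemma t_eq_relCl (D D' : divisor X2) :
  t_ p D = t_ p D' <->
  relCl_class p D = relCl_class p D' \/ relCl_class p D = - relCl_class p D'.
Proof.
have [A rA] := represents_exists hk2 ck sigma_p sigma_c D.
have [A' rA'] := represents_exists hk2 ck sigma_p sigma_c D'.
rewrite (t_eq hk2 ck rA rA').
split=> [|[DD'|DD']]; first exact: lat_sim_relCl_conv.
  exact: lat_sim_relCl DD'.
have [E ED'] := conj_divisor_exists hk2 ck sigma_p sigma_c D'.
have [B rB] := represents_exists hk2 ck sigma_p sigma_c E.
apply: lat_sim_trans (lat_sim_conj ck ED' rA' rB).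
by apply: (lat_sim_relCl hk2 ck rA rB); rewrite (relCl_class_conj ck ED').
Qed.

Lemma t0 : t_ p 0 = c0 X.
Proof.
have [I I1] := lat_one_exists X.
have rI := represents0 hk2 ck sigma_p sigma_c I1.
apply/(pbun_class_eq (represents_iso hk2 ck rI) (c0_isomorphic I1)).
exact: lat_sim_refl.
Qed.

Lemma PBun2tr_t (kbar : closedFieldType) (ibar : {rmorphism k -> kbar})
    (Xbar : curve kbar) (pbar : base_change ibar X Xbar) C :
  PBun2tr pbar C -> exists D, t_ p D = C.
Proof.
case=> E [vE ndE [E' pE' dE'] ->].
have [A EA] := vector_bundle_Lat vE.
have E'A := pullback_unique (pullback_iso_arg pE' EA) (Lat_pullback pbar A).
have ndA := contra_not (decomposable_rank2 EA).2 ndE.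
have [f [tau [nu [Af f2 irr]]]] :=
  pullback_decomposes_endo ndA ((decomposable_rank2 E'A).1 dE').
(* Here zeta is taken to be a root d of the characteristic polynomial of f instead of c; the classes
   [t_ p D] do not depend on this choice. *)
have [d d2] := quadratic_root_quad ibar irr i hk2.
have dk b : d <> i b.
  move=> db; have /negP[] := irr b; rewrite -(fmorph_eq0 i).
  by rewrite rmorphD rmorphB rmorphXn rmorphM -db d2 addrAC subrK subrr.
have [D AD] := endo_represented hk2 dk sigma_p sigma_c regX d2 irr Af f2.
exists D; rewrite -AD; apply/esym/(pbun_class_eq EA (isomorphic_refl (Lat A))).
exact: lat_sim_refl.
Qed.

End TrMap.

Theorem proposition6p4
  (k k2 : finFieldType) (kbar : closedFieldType)
  (i2 : {rmorphism k -> k2}) (hk2 : #|k2| = (#|k| ^ 2)%N)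
  (ibar : {rmorphism k -> kbar}) (hbar : forall z : kbar, algebraicOver ibar z)
  (X : curve k) (hX : geometrically_irreducible X)
  (X2 : curve k2) (p : base_change i2 X X2)
  (Xbar : curve kbar) (pbar : base_change ibar X Xbar) :
  exists t : relCl p -> (premodule X -> Prop),
    [/\ forall D : divisor X2, t (relCl_class p D) = t_ p D,
        forall c : premodule X -> Prop,
          (exists a, t a = c) <-> PBun2tr pbar c \/ c = c0 X
      & forall a b : relCl p, t b = t a <-> b = a \/ b = - a].
Proof.
have [c ck] := quad_element_exists i2 hk2.
have [tau [nu [tauE nuE c2]]] := quad_min_poly i2 hk2 c.
have irr := quad_irreducible hk2 ck tauE nuE.
have [theta thetaE] := frobenius_exists i2.
have theta_i b : theta (i2 b) = i2 b by rewrite thetaE -rmorphXn expf_card.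
have [sigma [sigma_p sigma_theta]] := scalar_extension_exists p theta_i.
have sigma_c d : sigma (const X2 d) = const X2 (d ^+ #|k|).
  by rewrite sigma_theta thetaE.
have regX := @regular_constant _ _ _ _ _ pbar.
have tE := t_eq_relCl hk2 (p := p) ck sigma_p sigma_c regX.
(* By [tE] the class [t_ p D] depends only on that of D, so any choice of representatives defines
   the map. *)
pose rep a := projT1 (cid (relCl_class_surj (p := p) a)).
have repK a : relCl_class p (rep a) = a by rewrite /rep; case: cid.
exists (fun a => t_ p (rep a)); split=> [D|C|a b]; last by rewrite tE !repK.
  by apply/tE; left; rewrite repK.
split=> [[a <-]|].
  exact: (t_dichotomy hk2 ck sigma_p sigma_c regX c2 irr).
have t_rep D : t_ p (rep (relCl_class p D)) = t_ p D by apply/tE; left; apply: repK.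
case=> [/(PBun2tr_t hk2 (p := p) sigma_p sigma_c regX)[D <-]|->].
  by exists (relCl_class p D).
by exists (relCl_class p 0); rewrite t_rep (t0 hk2 (p := p) ck sigma_p sigma_c).
Qed.
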